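(* The two specific elements $A,B\in\mathcal G(2221)_{3,+}$ described in the context (with dual generators $\check A,\check B$) satisfy the box jellyfish relations $$\begin{pmatrix} f\cdot j(\check A)\\ f\cdot j(\check B)\end{pmatrix}=R\begin{pmatrix} f(A\circ A)\\ f(A\circ B)\\ f(B\circ A)\\ f(B\circ B)\end{pmatrix},\qquad \begin{pmatrix} f\cdot j(A)\\ f\cdot j(B)\end{pmatrix}=R\begin{pmatrix} f(\check A\circ \check A)\\ f(\check A\circ \check B)\\ f(\check B\circ \check A)\\ f(\check B\circ \check B)\end{pmatrix},$$ where $R=(r_{kl})$ is the $2\times 4$ matrix with $r_{11}=\frac1{51}(33-8\sqrt{21})$, $r_{12}=\lambda_{4228250625,0,18810887175,0,36065983311,0,203997780,0,960400}^{(0.034194+0.063236 i)}$, $r_{13}=\lambda_{4228250625,0,18810887175,0,36065983311,0,203997780,0,960400}^{(0.034194-0.063236 i)}$, $r_{14}=\frac{659\sqrt{21}-2049}{2550}$, $r_{21}=\lambda_{2601,0,885,0,-125}^{(0.3277)}$, $r_{22}=\lambda_{2601,4896,18981,5700,925}^{(-0.1561+0.1682 i)}$, $r_{23}=\lambda_{2601,4896,18981,5700,925}^{(-0.1561-0.1682 i)}$, $r_{24}=\lambda_{65025,0,1149168,0,-6845}^{(-0.07717)}$; here $\lambda^{(z)}_{a_m,\dots,a_0}$ denotes the root of $\sum_i a_ix^i$ closest to $z$.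
   Context: **Diagrams.** Let $f^{(k)}$ be the Jones–Wenzl idempotent on $k$ strands. For $S,T$ both in $P_{n,+}$ or both in $P_{n,-}$: $S\circ T$ is the diagram with $S$ on the left and $T$ on the right, distinguished regions $\star$ of both at the top, joined to each other by $n-1$ parallel strings, with the remaining $n+1$ strings of each running down to the bottom boundary; the external distinguished region is the outer region at the top and left. $j(S)$ is the diagram in which all $2n$ strings of $S$ run down to the bottom (the $\star$ of $S$ being immediately to the left of its strings) and one additional string forms an arc from the bottom boundary, over the top of $S$, back to the bottom boundary; the external distinguished region is outside this arc. $f(S\circ T)$ and $f\cdot j(S)$ denote the diagrams obtained by attaching $f^{(2n+2)}$ to the $2n+2$ strings at the bottom of $S\circ T$ and $j(S)$. **Graph planar algebra.** For a finite bipartite graph $\Gamma$ with root $*$ and Perron–Frobenius eigenvector $\dim$ (eigenvalue $\delta$), the (spherical) graph planar algebra $\mathcal G(\Gamma)$ has $\mathcal G(\Gamma)_{n,+}$ (resp. $\mathcal G(\Gamma)_{n,-}$) equal to the complex functions on closed walks (loops) $\gamma=(\gamma(0),\dots,\gamma(2n-1))$ of length $2n$ with $\gamma(0)$ at even (resp. odd) distance from $*$. An $n$-box is a rectangle with $n$ strings on top and $n$ on the bottom and distinguished region $\star$ on the left; its regions are numbered clockwise from $\star$ ($0$ = left, $1,\dots,n-1$ = top, $n$ = right, $n+1,\dots,2n-1$ = bottom), and $\gamma(i)$ labels region $i$. Tangles act by Jones' state sum, each local maximum or minimum of a string contributing $\sqrt{\dim(v)/\dim(w)}$, with $v$ the vertex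 on the convex side and $w$ the vertex on the other side. The adjoint is $x^*(\gamma)=\overline{x(\gamma^{\rm rev})}$, where $\gamma^{\rm rev}$ is $\gamma$ traversed backwards from the same base point. An element is uncappable (a lowest weight vector) if joining any two adjacent boundary points by a cap gives $0$. The Fourier transform is $\mathcal F(x)(\gamma)=\sqrt{\frac{\dim\gamma(1)\dim\gamma(n+1)}{\dim\gamma(0)\dim\gamma(n)}}\;x(\gamma(1),\dots,\gamma(2n-1),\gamma(0))$, and $\rho=\mathcal F^2$. If $\rho(S)=\omega_SS$ and $\sigma_S^2=\omega_S$ is a chosen square root, then $\check S=\sigma_S^{-1}\mathcal F(S)$. **The generators.** $\Gamma=2221$ is the tree with a central vertex $c$ and four arms: arm $0$ (length $2$, its end is the root $*$), arms $1,2$ (length $2$), arm $3$ (length $1$); $\delta^2=\frac{5+\sqrt{21}}2$. Let $u_j$ be the neighbour of $c$ on arm $j$, $d_j=\dim u_j$. Here $n=3$; for a word $a=a_1a_2a_3$ let $\ell(a)=(c,u_{a_1},c,u_{a_2},c,u_{a_3})$. Put $\omega_A=e^{2\pi i/3}$, $\sigma_A=e^{2\pi i\cdot4/6}$, $\omega_B=\sigma_B=1$. Then $A_0$ (resp. $B_0$) is the unique uncappable element of $\mathcal G(\Gamma)_{3,+}$ with $\rho(A_0)=\omega_AA_0$ (resp. $\rho(B_0)=B_0$), vanishing on $\ell(111)$, $\ell(222)$ and on all $\ell(a)$, $a\in\{1,2,3\}^3$, with two cyclically consecutive $3$'s, and with $$A_0(\ell(a))=\kappa\sqrt{d_{a_3}/d_{a_1}}\;\mathbf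 A(a),\qquad B_0(\ell(a))=\kappa\sqrt{d_{a_3}/d_{a_1}}\;\mathbf B(a)$$ for the words below. The self-adjoint generators are $A=\gamma_AA_0$, $B=\gamma_BB_0$ with (principal roots) $\gamma_A=\frac12\sqrt{1-\sqrt{21}-i\sqrt{2(\sqrt{21}-3)}}$, $\gamma_B=\sqrt{-\frac{19}{20}+\frac{\sqrt{21}}{20}-\frac{i}{10}\sqrt{\frac12(9+19\sqrt{21})}}$. The constant $\kappa>0$ is the one for which $\mathrm{Tr}(A^2)=3\sqrt{55+12\sqrt{21}}$ (and then $\mathrm{Tr}(B^2)=\sqrt{\frac{60093+13113\sqrt{21}}{50}}$, $\mathrm{Tr}(AB)=0$). Values (same $\lambda$ notation): $\mathbf A(112)=\lambda^{(0.5762-0.5412i)}_{9,9,9,-18,21,-12,12,-6,1}$, $\mathbf A(122)=\lambda^{(0.3194+0.0964i)}_{9,9,9,-18,21,-12,12,-6,1}$, $\mathbf A(113)=\mathbf A(223)=\lambda^{(-0.4208+0.3953i)}_{81,81,54,-27,-27,-9,6,3,1}$, $\mathbf A(123)=\lambda^{(-0.6319-1.0945i)}_{9,9,12,-3,1}$, $\mathbf A(132)=\lambda^{(-1.1319+0.5621i)}_{9,27,30,12,1}$; $\mathbf B(112)=\lambda^{(-0.0605-0.1502i)}_{225,-45,288,-45,201,-39,36,3,1}$, $\mathbf B(122)=\lambda^{(0.3396+0.8433i)}_{225,-45,288,-45,201,-39,36,3,1}$, $\mathbf B(113)=\mathbf B(223)=\lambda^{(-0.3528-0.8759i)}_{45,36,42,3,-1}$,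 $\mathbf B(123)=\lambda^{(-0.9110+0.8759i)}_{45,54,24,-39,5}$, $\mathbf B(132)=\frac16(3+\sqrt{21})$. *)

(* Defs.v *)
From HB Require Import structures.
From mathcomp Require Import all_boot all_order all_algebra.
From mathcomp Require Import classical_sets reals trigo.
From mathcomp Require Import complex.

Set Implicit Arguments.
Unset Strict Implicit.
Unset Printing Implicit Defensive.

Import Order.TTheory GRing.Theory Num.Theory.

Local Open Scope ring_scope.
Local Open Scope complex_scope.

Section Numbers.
Variable R : realType.

(* [lambda_root z [:: a_m; ...; a_0]] is the root closest to z of
   a_m X^m + ... + a_0 (leading coefficient first). *)
Definition lambda_root (z : R[i]) (a : seq R[i]) : R[i] :=
  xget 0 [set x | root (Poly (rev a)) x /\
                  forall y, root (Poly (rev a)) y -> `|x - z| <= `|y - z|]%classic.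

Definition cis (t : R) : R[i] := cos t +i* sin t.

End Numbers.

Section GraphPlanarAlgebra.
Variables (R : realType) (V : finType) (e : rel V) (star : V).

Definition ball (k : nat) : {set V} :=
  iter k (fun B : {set V} => B :|: [set w | [exists v in B, e v w]]) [set star].

(* Distance to the root; for a connected graph the search always succeeds. *)
Definition dist (v : V) : nat := find (fun k => v \in ball k) (iota 0 #|V|).

Definition even_vertex (v : V) : bool := ~~ odd (dist v).

(* Loops (gamma(0), ..., gamma(2n-1)), with gamma(0) even when s is true (the
   spaces +) and odd when s is false (the spaces -). Meaningful for n > 0. *)
Definition loop (n : nat) (s : bool) :=
  {gamma : n.*2.-tuple V | cycle e gamma && (even_vertex (head star gamma) == s)}.

Definition gpa (n : nat) (s : bool) := {ffun loop n s -> R[i]^o}.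

(* Value on a list of vertices, extended by 0 outside the loops. *)
Definition gpa_at n s (x : gpa n s) (g : seq V) : R[i] :=
  oapp x 0 (obind insub (insub g : option (n.*2.-tuple V))).

Variable dim : V -> R.

Definition perron_frobenius (delta : R) : Prop :=
  (forall v, 0 < dim v) /\
  (forall v, \sum_(w | e v w) dim w = delta * dim v).

(* The weight of a maximum or minimum with v on its convex side. *)
Definition turn (v w : V) : R[i] := (Num.sqrt (dim v / dim w))%:C.

(* State sums. A horizontal line crossing k strings meets k+1 regions, whose
   labels, from left to right, form a list of k+1 vertices. A diagram with k
   strings at the top and l at the bottom is the operator taking a function phi
   of the bottom labels to the function of the top labels
     p |-> sum over the states extending p of (weight) * phi (bottom labels),
   so its (p, q) coefficient is obtained with phi the indicator of q, and
   [D1 \o D2] is the diagram D1 placed on top of D2. An elementary piece comes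
   with the number i of strings at its left; additional strings at its right
   are allowed. *)
Definition diagram := (seq V -> R[i]) -> (seq V -> R[i]).

(* A local maximum, creating the strings i and i+1 (counted from 0). *)
Definition cap (i : nat) : diagram := fun phi p =>
  let w := nth star p i in
  \sum_(v | e w v) turn v w * phi (take i.+1 p ++ v :: drop i p).

(* A local minimum, joining the strings i and i+1. *)
Definition cup (i : nat) : diagram := fun phi p =>
  let w := nth star p i in
  if w == nth star p i.+2
  then turn (nth star p i.+1) w * phi (take i.+1 p ++ drop i.+3 p) else 0.

(* The n-box x, placed on the strings i, ..., i+n-1. The list w labels the
   regions n+1, ..., 2n-1 at the bottom of the box, that is, from right to
   left. *)
Definition box n s (x : gpa n s) (i : nat) : diagram := fun phi p =>
  \sum_(w : n.-1.-tuple V)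
     gpa_at x (take n.+1 (drop i p) ++ w) *
     phi (take i.+1 p ++ rev w ++ drop (i + n) p).

(* m nested maxima (resp. minima), joining the strings i+k and i+2m-1-k. *)
Definition caps (i m : nat) : diagram := fun phi =>
  foldr cap phi (iota i m).

Definition cups (i m : nat) : diagram := fun phi =>
  foldl (fun psi k => cup k psi) phi (iota i m).

(* The boundary labels of an n-box labelled by the loop g, from left to right. *)
Definition top_labels (n : nat) (g : seq V) : seq V := take n.+1 g.
Definition bottom_labels (n : nat) (g : seq V) : seq V :=
  head star g :: rev (drop n g).

Definition to_gpa n s (D : diagram) : gpa n s :=
  [ffun gamma : loop n s =>
     let g : seq V := val (val gamma) in
     D (fun q => (q == bottom_labels n g)%:R) (top_labels n g)].

(* For a diagram with no string at the top and 2n strings at the bottom: the n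
   rightmost strings are bent to the right and upwards, to get an n-box. *)
Definition to_gpa_bottom n s (D : diagram) : gpa n s :=
  to_gpa n s (D \o cups n n).

Definition gpa_mul n s (x y : gpa n s) : gpa n s :=
  to_gpa n s (box x 0 \o box y 0).

(* The diagrammatic trace, an element of the 0-box space, i.e. a function on
   the vertices of parity s; the strings are closed up at the right. *)
Definition gpa_tr n s (x : gpa n s) (v : V) : R[i] :=
  (caps 0 n \o box x 0 \o cups 0 n) (fun q => (q == [:: v])%:R) [:: v].

Definition null_diagram (D : diagram) : Prop := forall phi p, D phi p = 0.

(* The caps join, in turn, two consecutive points at the top, two consecutive
   points at the bottom, the two leftmost points (around the distinguished
   region) and the two rightmost points. *)
Definition uncappable n s (x : gpa n s) : Prop :=
  [/\ forall i, (i.+1 < n)%N -> null_diagram (cap i \o box x 0),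
      forall i, (i.+1 < n)%N -> null_diagram (box x 0 \o cup i),
      null_diagram (cap 0 \o box x 1 \o cup 0) &
      null_diagram (cap n.-1 \o box x 0 \o cup n.-1)].

Definition fourier n s (x : gpa n s) : gpa n (~~ s) :=
  [ffun gamma : loop n (~~ s) =>
     let g : seq V := val (val gamma) in
     let d i := dim (nth star g (i %% n.*2)) in
     (Num.sqrt ((d 1%N * d n.+1) / (d 0%N * d n)))%:C * gpa_at x (rot 1 g)].

Definition rho n s (x : gpa n s) : gpa n (~~ ~~ s) := fourier (fourier x).

(* Quantum integers, [2] = delta. *)
Fixpoint qint (delta : R) (k : nat) : R :=
  if k is k1.+1 then
    if k1 is k2.+1 then delta * qint delta k1 - qint delta k2 else 1
  else 0.

(* Jones-Wenzl idempotents, by Wenzl's recursion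
   f^(k+1) = f^(k) - [k]/[k+1] f^(k) e_k f^(k), where e_k = cup over cap acts
   on the last two strings. *)
Fixpoint jones_wenzl (delta : R) (k : nat) : diagram := fun phi p =>
  if k is k1.+1 then
    if k1 is k2.+1 then
      let f := jones_wenzl delta k1 in
      f phi p - (qint delta k1 / qint delta k)%:C *
                (f \o cup k2 \o cap k2 \o f) phi p
    else phi p
  else phi p.

(* S o T for S, T with strings s_1, ..., s_2n and t_1, ..., t_2n, numbered
   clockwise from the distinguished region. Just above the boxes the strings
   are, from left to right,
     s_1 ... s_n | s_n t_{n+2} ... t_{2n} | t_1 ... t_n | t_n ... t_1,
   and below the boxes
     s_2n ... s_{n+1} | s_n t_{n+2} ... t_{2n} | t_{2n} ... t_{n+1} | t_n ... t_1.
   The n-1 minima turn t_{2n}, ..., t_{n+2} up to s_1, ..., s_{n-1}. *)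
Definition circ n s (S T : gpa n s) : diagram :=
  caps 0 n \o caps n.*2 n \o box S 0 \o box T n.*2 \o cups n.+1 n.-1.

(* j(S): the n upper strings of S are bent to the right and downwards. *)
Definition jdiag n s (S : gpa n s) : diagram :=
  cap 0 \o caps 1 n \o box S 1.

Definition f_circ (delta : R) n s (S T : gpa n s) : gpa n.+1 s :=
  to_gpa_bottom n.+1 s (circ S T \o jones_wenzl delta n.+1.*2).

Definition f_j (delta : R) n s (S : gpa n s) : gpa n.+1 (~~ s) :=
  to_gpa_bottom n.+1 (~~ s) (jdiag S \o jones_wenzl delta n.+1.*2).

End GraphPlanarAlgebra.

(* None is the central vertex, Some (inl j) its neighbour on arm j, and
   Some (inr j) the end of arm j, for j = 0, 1, 2. *)
Definition V2221 : finType := option ('I_4 + 'I_3)%type.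

Definition e2221 : rel V2221 := fun x y =>
  match x, y with
  | None, Some (inl _) | Some (inl _), None => true
  | Some (inl j), Some (inr k) | Some (inr k), Some (inl j) => j == k :> nat
  | _, _ => false
  end.

Definition root2221 : V2221 := Some (inr ord0).
Definition center : V2221 := None.
Definition u (j : nat) : V2221 := Some (inl (inord j)).

Definition ell (a1 a2 a3 : nat) : seq V2221 :=
  [:: center; u a1; center; u a2; center; u a3].

Section Generators.
Variable R : realType.
Local Notation C := R[i].
Local Notation gpa2221 := (gpa R e2221 root2221).

Definition sqrt21 : R := Num.sqrt 21.

Definition omega_A : C := cis (2 * pi / 3).
Definition sigma_A : C := cis (2 * pi * 4 / 6).
Definition omega_B : C := 1.
Definition sigma_B : C := 1.

(* [sqrtc] is the principal square root (nonnegative real part), unlike [sqrtC],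
   whose values have a nonnegative imaginary part. *)
Definition gamma_A : C :=
  sqrtc ((1 - sqrt21) -i* Num.sqrt (2 * (sqrt21 - 3))) / 2.

Definition gamma_B : C :=
  sqrtc ((- (19 / 20) + sqrt21 / 20)
           -i* (Num.sqrt ((9 + 19 * sqrt21) / 2) / 10)).

Definition A_values : seq (nat * nat * nat * C) :=
  [:: ((1, 1, 2)%N, lambda_root ((5762%:R / 10 ^+ 4) -i* (5412%:R / 10 ^+ 4))
                  [:: 9; 9; 9; -18; 21; -12; 12; -6; 1]);
      ((1, 2, 2)%N, lambda_root ((3194%:R / 10 ^+ 4) +i* (964 / 10 ^+ 4))
                  [:: 9; 9; 9; -18; 21; -12; 12; -6; 1]);
      ((1, 1, 3)%N, lambda_root ((- 4208%:R / 10 ^+ 4) +i* (3953%:R / 10 ^+ 4))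
                  [:: 81; 81; 54; -27; -27; -9; 6; 3; 1]);
      ((2, 2, 3)%N, lambda_root ((- 4208%:R / 10 ^+ 4) +i* (3953%:R / 10 ^+ 4))
                  [:: 81; 81; 54; -27; -27; -9; 6; 3; 1]);
      ((1, 2, 3)%N, lambda_root ((- 6319%:R / 10 ^+ 4) -i* (10945%:R / 10 ^+ 4))
                  [:: 9; 9; 12; -3; 1]);
      ((1, 3, 2)%N, lambda_root ((- 11319%:R / 10 ^+ 4) +i* (5621%:R / 10 ^+ 4))
                  [:: 9; 27; 30; 12; 1])].

Definition B_values : seq (nat * nat * nat * C) :=
  [:: ((1, 1, 2)%N, lambda_root ((- 605 / 10 ^+ 4) -i* (1502%:R / 10 ^+ 4))
                  [:: 225; -45; 288; -45; 201; -39; 36; 3; 1]);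
      ((1, 2, 2)%N, lambda_root ((3396%:R / 10 ^+ 4) +i* (8433%:R / 10 ^+ 4))
                  [:: 225; -45; 288; -45; 201; -39; 36; 3; 1]);
      ((1, 1, 3)%N, lambda_root ((- 3528%:R / 10 ^+ 4) -i* (8759%:R / 10 ^+ 4))
                  [:: 45; 36; 42; 3; -1]);
      ((2, 2, 3)%N, lambda_root ((- 3528%:R / 10 ^+ 4) -i* (8759%:R / 10 ^+ 4))
                  [:: 45; 36; 42; 3; -1]);
      ((1, 2, 3)%N, lambda_root ((- 9110%:R / 10 ^+ 4) +i* (8759%:R / 10 ^+ 4))
                  [:: 45; 54; 24; -39; 5]);
      ((1, 3, 2)%N, ((3 + sqrt21) / 6)%:C)].

Definition generator_spec (dim : V2221 -> R) (kappa : R) (omega : C)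
    (values : seq (nat * nat * nat * C)) (x : gpa2221 3 true) : Prop :=
  [/\ uncappable dim x,
      rho dim x = omega *: x,
      gpa_at x (ell 1 1 1) = 0 /\ gpa_at x (ell 2 2 2) = 0,
      forall a1 a2 a3 : nat,
        a1 \in [:: 1; 2; 3]%N -> a2 \in [:: 1; 2; 3]%N -> a3 \in [:: 1; 2; 3]%N ->
        [|| (a1 == 3) && (a2 == 3), (a2 == 3) && (a3 == 3)
          | (a3 == 3) && (a1 == 3)]%N ->
        gpa_at x (ell a1 a2 a3) = 0 &
      forall (a1 a2 a3 : nat) (z : C), (a1, a2, a3, z) \in values ->
        gpa_at x (ell a1 a2 a3) =
          (kappa * Num.sqrt (dim (u a3) / dim (u a1)))%:C * z].

Definition check (dim : V2221 -> R) (sigma : C) (x : gpa2221 3 true) :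
    gpa2221 3 false :=
  sigma^-1 *: fourier dim x.

Definition r11 : C := ((33 - 8 * sqrt21) / 51)%:C.
Definition r12 : C :=
  lambda_root ((34194%:R / 10 ^+ 6) +i* (63236%:R / 10 ^+ 6))
    [:: 4228250625%:R; 0; 18810887175%:R; 0; 36065983311%:R; 0; 203997780%:R; 0;
        960400%:R].
Definition r13 : C :=
  lambda_root ((34194%:R / 10 ^+ 6) -i* (63236%:R / 10 ^+ 6))
    [:: 4228250625%:R; 0; 18810887175%:R; 0; 36065983311%:R; 0; 203997780%:R; 0;
        960400%:R].
Definition r14 : C := ((659 * sqrt21 - 2049%:R) / 2550%:R)%:C.
Definition r21 : C :=
  lambda_root (3277%:R / 10 ^+ 4) [:: 2601%:R; 0; 885; 0; -125].
Definition r22 : C :=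
  lambda_root ((- 1561%:R / 10 ^+ 4) +i* (1682%:R / 10 ^+ 4))
    [:: 2601%:R; 4896%:R; 18981%:R; 5700%:R; 925].
Definition r23 : C :=
  lambda_root ((- 1561%:R / 10 ^+ 4) -i* (1682%:R / 10 ^+ 4))
    [:: 2601%:R; 4896%:R; 18981%:R; 5700%:R; 925].
Definition r24 : C :=
  lambda_root (- 7717%:R / 10 ^+ 5) [:: 65025%:R; 0; 1149168%:R; 0; - 6845%:R].

End Generators.

(* Main.v *)
From Stdlib Require Import ZArith.
From HB Require Import structures.
Require Import Defs.
From mathcomp Require Import all_boot all_order all_algebra.
From mathcomp Require Import reals trigo.
From mathcomp Require Import complex.
From mathcomp Require Import ring lra zify ssrZ.
Set Implicit Arguments.
Unset Strict Implicit.
Unset Printing Implicit Defensive.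
Import Order.TTheory GRing.Theory Num.Theory.
#[local] Delimit Scope Z_scope with ZZ.

(** In the graph planar algebra each relation is a finite family of identities
    between complex numbers, one for each boundary loop. Fix such a loop. Both
    sides are linear in the function Psi of walks with 8 steps that arises when
    f^(8) is applied to the indicator of the bottom labels of the loop ([bottom_at]).

    The Jones-Wenzl idempotent is killed by every cap ([cap_jw]). The weight of a
    maximum or minimum is a quotient of square roots of dimensions, so these
    roots can be absorbed into Psi; then Psi becomes harmonic: the sum of
    Psi(... w x w ...) over the neighbours x of w vanishes ([gauged_harmonic]). In
    the same gauge j(S) and S o T become sums of values of Psi, with coefficients
    given by one value of S, resp. by products of a value of S and a value of T
    ([jdiag_sum], [circ_sum_gauged]).

    The generators behave in the same way. An uncappable element is a harmonic
    function of cyclic walks, the rotation acts on it by a scalar, and the dual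
    generator is its rotation by one step; hence all its values follow from those
    on the words l(a) ([generator_weight], [loop_valueE]). The trace at the root
    gives kappa = 1 ([kappa_eq1]).

    What remains is that, for each vertex v0, an explicit combination of
    evaluations at walks from v0 to v0 vanishes on all harmonic functions.
    Harmonicity rewrites every walk into walks of a normal form ([harmonic_red]);
    the walks with a spike at the end of an arm give further relations between
    normal forms ([vanish_spike_relations]), and Gaussian elimination leaves the
    combination with coefficients that are all zero ([check_A], [check_B]).

    The coefficients are computed exactly. All constants lie in a field obtained
    from Q by five square roots, whose elements are coded by integers
    ([quadratic_code], [val_represents]). The roots of polynomials that define the
    generators and the matrix R have closed forms in this field. Each closed form
    is identified by two verifications: it is a root, and it lies in a
    disc around the given approximation that contains one root only
    ([lambda_root_fval]). *)

(** * The Jones-Wenzl idempotents are killed by caps *)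

Section QuantumIntegers.
Local Open Scope ring_scope.
Variables (R : realType) (delta : R).
Hypothesis delta_ge2 : 2 <= delta.

Lemma qintSS k : qint delta k.+2 = delta * qint delta k.+1 - qint delta k.
Proof. by []. Qed.

Lemma qint_gt0 k : 0 < qint delta k.+1.
Proof.
suff: 0 < qint delta k.+1 /\ qint delta k.+1 <= qint delta k.+2 by case.
have d2 := delta_ge2; elim: k => [|k [h1 h2]].
  by rewrite /= mulr1 subr0; split; lra.
split; first exact: lt_le_trans h2.
rewrite (qintSS k.+1); move: (qint delta k.+1) (qint delta k.+2) h1 h2 => x y.
by move=> h1 h2; nra.
Qed.

End QuantumIntegers.

Section JonesWenzl.
Local Open Scope ring_scope.
Local Open Scope complex_scope.
Variables (R : realType) (V : finType) (e : rel V) (star : V).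
Variables (dim : V -> R) (delta : R).

Local Notation cap := (cap e star dim).
Local Notation cup := (cup star dim).
Local Notation jw := (jones_wenzl e star dim delta).
Local Notation func := (seq V -> R[i]).

(** The isotopy relations hold on label lists that are walks only: straightening
   a string uses that the regions on its two sides are adjacent. *)
Definition eq_on (n : nat) (phi psi : func) : Prop :=
  forall p, size p = n -> sorted e p -> phi p = psi p.

Lemma eq_on_sym n phi psi : eq_on n phi psi -> eq_on n psi phi.
Proof. by move=> h p s w; rewrite h. Qed.
Lemma eq_on_trans n psi phi chi :
  eq_on n phi psi -> eq_on n psi chi -> eq_on n phi chi.
Proof. by move=> h1 h2 p s w; rewrite h1 // h2. Qed.

Lemma split_at (p : seq V) i : (i < size p)%N ->
  exists l w r, [/\ p = l ++ w :: r & size l = i].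
Proof.
move=> hi; exists (take i p), (nth star p i), (drop i.+1 p).
split; first by rewrite -drop_nth // cat_take_drop.
by rewrite size_takel // ltnW.
Qed.

Lemma capE i phi l w r : size l = i ->
  cap i phi (l ++ w :: r) =
  \sum_(v | e w v) turn dim v w * phi (l ++ [:: w, v, w & r]).
Proof.
move=> hl; rewrite /cap nth_cat hl ltnn subnn /=.
apply: eq_bigr => v _; rewrite take_cat drop_cat hl ltnn subnn drop0.
have -> : (i.+1 < i)%N = false by lia.
rewrite subSnn -catA /= .
by rewrite take0.
Qed.

Lemma cupE i phi l x y z r : size l = i ->
  cup i phi (l ++ [:: x, y, z & r]) =
  if x == z then turn dim y x * phi (l ++ x :: r) else 0.
Proof.
move=> hl; rewrite /cup !nth_cat hl ltnn subnn.
have -> : (i.+1 < i)%N = false by lia.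
have -> : (i.+2 < i)%N = false by lia.
have -> : (i.+1 - i = 1)%N by lia.
have -> : (i.+2 - i = 2)%N by lia.
rewrite /=; case: eqP => // _; congr (_ * phi _).
rewrite take_cat drop_cat hl.
have -> : (i.+1 < i)%N = false by lia.
have -> : (i.+3 < i)%N = false by lia.
have -> : (i.+1 - i = 1)%N by lia.
have -> : (i.+3 - i = 3)%N by lia.
by rewrite -catA /= ?take0 ?drop0.
Qed.

Hypothesis pf : perron_frobenius e dim delta.

Lemma turnM v w : turn dim v w * turn dim w v = 1.
Proof.
have [d0 _] := pf; rewrite /turn -rmorphM /= -sqrtrM ?divr_ge0 ?ltW //.
rewrite mulrA divfK ?gt_eqF // divff ?gt_eqF // sqrtr1 //.
Qed.

Lemma turn2 v w : turn dim v w * turn dim v w = (dim v / dim w)%:C.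
Proof.
have [d0 _] := pf.
by rewrite /turn -rmorphM /= -expr2 sqr_sqrtr // divr_ge0 ?ltW.
Qed.

Hypothesis esym : symmetric e.

Lemma sorted_ins l w v r :
  sorted e (l ++ w :: r) -> e w v -> sorted e (l ++ [:: w, v, w & r]).
Proof.
case: l => [|x l] /= h wv; first by rewrite wv esym wv.
by move: h; rewrite !cat_path /= wv [e v w]esym wv.
Qed.

Lemma sorted_del l x y r :
  sorted e (l ++ [:: x, y, x & r]) -> sorted e (l ++ x :: r).
Proof.
case: l => [|z l] /= => [/and3P[]//|].
by rewrite !cat_path /= => /and5P[-> -> _ _ ->].
Qed.

Lemma cap_ext n i phi psi : (i < n)%N -> eq_on n.+2 phi psi ->
  eq_on n (cap i phi) (cap i psi).
Proof.
move=> hi h p sp wp; rewrite -sp in hi.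
have [l [w [r [ep sl]]]] := split_at hi; subst p.
rewrite !(capE _ _ _ sl); apply: eq_bigr => v wv; rewrite h ?sorted_ins //.
by rewrite -sp !size_cat /= !addnS.
Qed.

Lemma split_at3 (p : seq V) i : (i.+2 < size p)%N ->
  exists l x y z r, [/\ p = l ++ [:: x, y, z & r] & size l = i].
Proof.
move=> hi; have [|l [x [r [ep sl]]]] := @split_at p i; first by lia.
move: hi; rewrite ep size_cat; case: r {ep} => [|y [|z r]] /= hi; try lia.
by exists l, x, y, z, r.
Qed.

Lemma cup_ext n i phi psi : (i < n)%N -> eq_on n phi psi ->
  eq_on n.+2 (cup i phi) (cup i psi).
Proof.
move=> hi h p sp wp; have [|l [x [y [z [r [ep sl]]]]]] := @split_at3 p i.
  by rewrite sp.
subst p; rewrite !(cupE _ _ _ _ _ sl); case: eqP wp => // <- wp.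
by rewrite h // ?(sorted_del wp) //; move: sp; rewrite !size_cat /=; lia.
Qed.

Lemma cap_cup n i phi : (i < n)%N -> eq_on n (cap i (cup i phi)) (fun p => delta%:C * phi p).
Proof.
have [d0 hd] := pf.
move=> hi p sp wp; rewrite -sp in hi.
have [l [w [r [ep sl]]]] := split_at hi; subst p.
rewrite (capE _ _ _ sl).
under eq_bigr => v _ do rewrite (cupE _ _ _ _ _ sl) eqxx mulrA turn2.
rewrite -mulr_suml -rmorph_sum /= -mulr_suml hd mulfK //.
by rewrite gt_eqF.
Qed.

Lemma sorted_mid l w u r : sorted e (l ++ [:: w, u & r]) -> e w u.
Proof.
case: l => [|z s] /=; first by move=> /andP[].
by rewrite cat_path /= => /and4P[].
Qed.

Lemma cap_cupS n i phi : (i.+1 < n)%N -> eq_on n (cap i.+1 (cup i phi)) phi.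
Proof.
move=> hi p sp wp.
have [|l [w [r [ep sl]]]] := @split_at p i; first by lia.
case: r ep => [|u r] ep; first by move: sp; rewrite ep size_cat /=; lia.
have -> : p = rcons l w ++ u :: r by rewrite cat_rcons.
rewrite (capE _ _ _ (_ : _ = i.+1)) ?size_rcons ?sl //.
under eq_bigr => v _ do rewrite cat_rcons (cupE _ _ _ _ _ sl).
have uw : e u w by rewrite esym; move: wp; rewrite ep; exact: sorted_mid.
rewrite (bigD1 w) //= eqxx mulrA turnM mul1r big1 ?addr0 ?cat_rcons //.
by move=> v /andP[_ vw]; rewrite eq_sym (negbTE vw) mulr0.
Qed.

Lemma cap_Scup n i phi : (i.+1 < n)%N -> eq_on n (cap i (cup i.+1 phi)) phi.
Proof.
move=> hi p sp wp.
have [|l [w [r [ep sl]]]] := @split_at p i; first by lia.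
case: r ep => [|u r] ep; first by move: sp; rewrite ep size_cat /=; lia.
rewrite {1}ep (capE _ _ _ sl).
under eq_bigr => v _.
  rewrite -cat_rcons (cupE _ _ _ _ _ (_ : _ = i.+1)); last first.
    by rewrite size_rcons sl.
  over.
have uw : e w u by move: wp; rewrite ep; exact: sorted_mid.
rewrite (bigD1 u) //= eqxx mulrA turnM mul1r big1 ?addr0 ?cat_rcons ?ep //.
by move=> v /andP[_ vw]; rewrite (negbTE vw) mulr0.
Qed.

(** A cap at the left shifts the numbering of the strings at its right by two,
   whence [j.+2]. *)
Lemma capC n i j phi : (i <= j < n)%N ->
  eq_on n (cap j (cap i phi)) (cap i (cap j.+2 phi)).
Proof.
move=> /andP[ij jn] p sp _; rewrite -sp in jn.
have [l [w [r [-> sl]]]] := split_at jn.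
move: ij; rewrite leq_eqVlt => /orP[/eqP ij|ij].
  rewrite ij (capE _ _ _ sl) [RHS](capE _ _ _ sl).
  under eq_bigr => v _ do rewrite (capE _ _ _ sl) big_distrr /=.
  under [RHS]eq_bigr => v _.
    rewrite -2!cat_rcons (capE _ _ _ (_ : _ = j.+2)); last first.
      by rewrite !size_rcons sl.
    rewrite big_distrr /=; over.
  rewrite exchange_big /=; apply: eq_bigr => v _; apply: eq_bigr => v' _.
  by rewrite !cat_rcons mulrCA.
have [|l1 [x [l2 [e1 sl1]]]] := @split_at l i; first by rewrite sl.
rewrite (capE _ _ _ sl) e1 -catA /= [RHS](capE _ _ _ sl1).
under eq_bigr => v _ do rewrite -catA /= (capE _ _ _ sl1) big_distrr /=.
have E v s : l1 ++ [:: x, v, x & l2 ++ s] = (l1 ++ [:: x, v, x & l2]) ++ s.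
  by rewrite -catA.
have sE v : size (l1 ++ [:: x, v, x & l2]) = j.+2.
  by move: sl; rewrite e1 !size_cat /=; lia.
under [RHS]eq_bigr => v _ do rewrite E (capE _ _ _ (sE v)) big_distrr /=.
rewrite exchange_big /=; apply: eq_bigr => v _; apply: eq_bigr => v' _.
by rewrite mulrCA -catA.
Qed.

Lemma cap_cupC n i j phi : (i <= j)%N -> (j.+2 < n)%N ->
  eq_on n (cap i (cup j.+2 phi)) (cup j (cap i phi)).
Proof.
move=> ij jn p sp _; have [|l [x [y [z [r [-> sl]]]]]] := @split_at3 p j; first by lia.
rewrite (cupE _ _ _ _ _ sl); move: ij; rewrite leq_eqVlt => /orP[/eqP ij|ij].
  rewrite ij !(capE _ _ _ sl).
  case: eqP => [xz|/eqP xz]; rewrite ?big_distrr /=; last apply: big1; last first.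
    by move=> v _; rewrite -2!cat_rcons (cupE _ _ _ _ _ (_ : _ = j.+2)) ?size_rcons ?sl // (negbTE xz) mulr0.
  apply: eq_bigr => v _; rewrite -2!cat_rcons (cupE _ _ _ _ _ (_ : _ = j.+2)) ?size_rcons ?sl //.
  by rewrite xz eqxx !cat_rcons mulrCA.
have [|l1 [w [l2 [e1 sl1]]]] := @split_at l i; first by rewrite sl.
rewrite e1 -!catA /= !(capE _ _ _ sl1).
have E v s : l1 ++ [:: w, v, w & l2 ++ s] = (l1 ++ [:: w, v, w & l2]) ++ s.
  by rewrite -catA.
have sE v : size (l1 ++ [:: w, v, w & l2]) = j.+2.
  by move: sl; rewrite e1 !size_cat /=; lia.
under eq_bigr => v _ do rewrite E (cupE _ _ _ _ _ (sE v)).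
case: eqP => [xz|/eqP xz]; last by rewrite big1 // => v _; rewrite mulr0.
rewrite big_distrr /=; apply: eq_bigr => v _; rewrite mulrCA.
by rewrite -catA /= ?take0 ?drop0.
Qed.

Lemma cup_capC n i j phi : (i <= j)%N -> (j.+2 < n)%N ->
  eq_on n (cap j.+2 (cup i phi)) (cup i (cap j phi)).
Proof.
move=> ij jn p sp _; have [|l [x [y [z [r [ep sl]]]]]] := @split_at3 p i; first by lia.
rewrite ep (cupE _ _ _ _ _ sl); move: ij; rewrite leq_eqVlt => /orP[/eqP ij|ij].
  rewrite -ij -2!cat_rcons (capE _ _ _ (_ : _ = i.+2)) ?size_rcons ?sl // (capE _ _ _ sl).
  under eq_bigr => v _ do rewrite !cat_rcons (cupE _ _ _ _ _ sl).
  case: eqP => [->|/eqP xz]; last by apply: big1 => v _; rewrite mulr0.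
  by rewrite big_distrr /=; apply: eq_bigr => v _; rewrite mulrCA.
have [|l1 [w [l2 [e1 sl1]]]] := @split_at r (j - i.+1)%N.
  by move: sp; rewrite ep size_cat /=; lia.
rewrite e1; have -> : l ++ [:: x, y, z & l1 ++ w :: l2] = (l ++ [:: x, y, z & l1]) ++ w :: l2.
  by rewrite -catA.
have -> : l ++ x :: l1 ++ w :: l2 = (l ++ x :: l1) ++ w :: l2 by rewrite -catA.
rewrite (capE _ _ _ (_ : _ = j.+2)); last by rewrite !size_cat /=; lia.
rewrite (capE _ _ _ (_ : _ = j)); last by rewrite !size_cat /=; lia.
under eq_bigr => v _ do rewrite -catA /= (cupE _ _ _ _ _ sl).
case: eqP => [->|/eqP xz]; last by apply: big1 => v _; rewrite mulr0.
by rewrite big_distrr /=; apply: eq_bigr => v _; rewrite mulrCA -catA.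
Qed.

Lemma cupC n i j phi : (i <= j)%N -> (j.+4 < n)%N ->
  eq_on n (cup i (cup j phi)) (cup j.+2 (cup i phi)).
Proof.
move=> ij jn p sp _; have [|l [x [y [z [r [ep sl]]]]]] := @split_at3 p i; first by lia.
rewrite ep (cupE _ _ _ _ _ sl); move: ij; rewrite leq_eqVlt => /orP[/eqP ij|ij].
  case: r ep => [|y' [|z' r]] ep; try by (move: sp; rewrite ep size_cat /=; lia).
  have -> : l ++ [:: x, y, z, y', z' & r] = rcons (rcons l x) y ++ [:: z, y', z' & r].
    by rewrite !cat_rcons.
  rewrite -ij (cupE _ _ _ _ _ sl).
  rewrite (cupE _ _ _ _ _ (_ : size (rcons (rcons l x) y) = i.+2)) ?size_rcons ?sl //.
  rewrite !cat_rcons (cupE _ _ _ _ _ sl).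
  case: (eqVneq x z) => [->|xz]; last by rewrite mulr0 if_same.
  by case: ifP => _; rewrite ?mulr0 // mulrCA.
have [|l1 [x' [y' [z' [r' [e1 sl1]]]]]] := @split_at3 r (j - i.+1)%N.
  by move: sp; rewrite ep size_cat /=; lia.
rewrite e1; have -> : l ++ [:: x, y, z & l1 ++ [:: x', y', z' & r']] = (l ++ [:: x, y, z & l1]) ++ [:: x', y', z' & r'].
  by rewrite -catA.
have -> : l ++ x :: l1 ++ [:: x', y', z' & r'] = (l ++ x :: l1) ++ [:: x', y', z' & r'] by rewrite -catA.
rewrite (cupE _ _ _ _ _ (_ : _ = j.+2)); last by rewrite !size_cat /=; lia.
rewrite (cupE _ _ _ _ _ (_ : _ = j)); last by rewrite !size_cat /=; lia.
rewrite -!catA /= (cupE _ _ _ _ _ sl).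
case: (eqVneq x z) => [->|xz]; last by rewrite mulr0 if_same.
by case: ifP => _; rewrite ?mulr0 // mulrCA.
Qed.

Lemma cap_lin n i a b phi psi : (i < n)%N ->
  eq_on n (cap i (fun p => a * phi p + b * psi p)) (fun p => a * cap i phi p + b * cap i psi p).
Proof.
move=> hi p sp _; rewrite /Defs.cap !big_distrr -big_split /=.
by apply: eq_bigr => v _; rewrite mulrDr [_ * (a * _)]mulrCA [_ * (b * _)]mulrCA.
Qed.

Lemma cup_lin i a b phi psi p :
  cup i (fun p => a * phi p + b * psi p) p = a * cup i phi p + b * cup i psi p.
Proof.
rewrite /Defs.cup; case: ifP => _; last by rewrite !mulr0 addr0.
by rewrite mulrDr [_ * (a * _)]mulrCA [_ * (b * _)]mulrCA.
Qed.

Hypothesis delta_ge2 : 2 <= delta.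

Definition wenzl_coef (k : nat) : R[i] := (qint delta k / qint delta k.+1)%:C.

(** Both terms are written as multiples, the form to which the linearity of caps
   and cups applies. *)
Lemma jwSS k phi p :
  jw k.+2 phi p = 1 * jw k.+1 phi p
     + (- wenzl_coef k.+1) * jw k.+1 (cup k (cap k (jw k.+1 phi))) p.
Proof. by rewrite mul1r mulNr. Qed.

Lemma jw0 phi : jw 0 phi = phi. Proof. by []. Qed.
Lemma jw1 phi : jw 1 phi = phi. Proof. by []. Qed.

#[local] Opaque jones_wenzl.

Lemma jw_ext n k phi psi : (k < n)%N -> eq_on n phi psi -> eq_on n (jw k phi) (jw k psi).
Proof.
elim: k phi psi => [|[|k] IH] phi psi kn h; [by rewrite !jw0|by rewrite !jw1|].
have kn' : (k.+1 < n)%N by lia.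
move=> p sp wp; rewrite (jwSS k phi) (jwSS k psi) (IH _ _ kn' h p sp wp); congr (_ + _ * _).
apply: (IH _ _ kn') => //.
have -> : n = (n - 2).+2 by lia.
apply: cup_ext; first by lia.
apply: cap_ext; first by lia.
have -> : (n - 2).+2 = n by lia.
exact: IH.
Qed.

Lemma jw_lin n k a b phi psi : (k < n)%N ->
  eq_on n (jw k (fun p => a * phi p + b * psi p)) (fun p => a * jw k phi p + b * jw k psi p).
Proof.
elim: k phi psi => [|[|k] IH] phi psi kn; [by rewrite !jw0|by rewrite !jw1|].
have kn' : (k.+1 < n)%N by lia.
have kn2 : (k < n - 2)%N by lia.
have en : n = (n - 2).+2 by lia.
move=> p sp wp; rewrite (jwSS k (fun p => a * phi p + b * psi p)) (jwSS k phi) (jwSS k psi) (IH _ _ kn' p sp wp).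
have -> : jw k.+1 (cup k (cap k (jw k.+1 (fun p => a * phi p + b * psi p)))) p =
  jw k.+1 (fun p => a * cup k (cap k (jw k.+1 phi)) p + b * cup k (cap k (jw k.+1 psi)) p) p.
  apply: (jw_ext kn' _ sp wp); rewrite en => q sq wq; rewrite -cup_lin.
  apply: (@cup_ext (n - 2) k _ _ kn2 _ q sq wq).
  apply: eq_on_trans (cap_lin _ _ _ _ kn2); apply: (cap_ext kn2).
  by rewrite -en; exact: (IH _ _ kn').
rewrite (IH _ _ kn' p sp wp).
move: (jw k.+1 phi p) (jw k.+1 psi p) (jw k.+1 (cup _ _) p) (jw k.+1 (cup _ _) p) => x y z t.
move: (wenzl_coef k.+1) => c; ring.
Qed.

Lemma jw_capC n k j phi : (k <= j < n)%N -> eq_on n (jw k (cap j phi)) (cap j (jw k phi)).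
Proof.
elim: k j phi n => [|[|k] IH] j phi n /andP[kj jn]; [by rewrite !jw0|by rewrite !jw1|].
move=> p sp wp.
have jk : (k.+1 <= j < n)%N by lia.
have -> : cap j (jw k.+2 phi) p = cap j (fun p => 1 * jw k.+1 phi p
     + (- wenzl_coef k.+1) * jw k.+1 (cup k (cap k (jw k.+1 phi))) p) p.
  by apply: eq_bigr => v _; rewrite (jwSS k phi).
rewrite (@cap_lin n _ _ _ _ _ jn p sp wp) (jwSS k (cap j phi)) (IH _ _ _ jk p sp wp).
congr (_ * _ + _ * _); rewrite -(IH _ _ _ jk p sp wp).
have en : n = (n - 2).+2 by lia.
have ej : j = (j - 2).+2 by lia.
have h1 : eq_on n (jw k.+1 (cap j phi)) (cap j (jw k.+1 phi)) by apply: IH.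
apply: (@jw_ext n _ _ _ _ _ _ sp wp); first by lia.
apply: (eq_on_trans (psi := (cup k (cap (j - 2) (cap k (jw k.+1 phi)))))); last first.
  apply: eq_on_sym; rewrite {1}ej; apply: cup_capC; lia.
rewrite en; apply: cup_ext; first by lia.
apply: (eq_on_trans (psi := (cap k (cap j (jw k.+1 phi))))).
  by apply: cap_ext; [lia|rewrite -en; exact: h1].
by apply: eq_on_sym; rewrite {2}ej; apply: capC; lia.
Qed.

Lemma jw_cupC n k j phi : (k <= j)%N -> (j.+2 < n)%N -> eq_on n (jw k (cup j phi)) (cup j (jw k phi)).
Proof.
elim: k j phi n => [|[|k] IH] j phi n kj jn; [by rewrite !jw0|by rewrite !jw1|].
move=> p sp wp.
have jk : (k.+1 <= j)%N by lia.
have -> : cup j (jw k.+2 phi) p = cup j (fun p => 1 * jw k.+1 phi p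
     + (- wenzl_coef k.+1) * jw k.+1 (cup k (cap k (jw k.+1 phi))) p) p.
  by rewrite /Defs.cup (jwSS k phi).
rewrite cup_lin (jwSS k (cup j phi)) (IH _ _ _ jk jn p sp wp).
congr (_ * _ + _ * _); rewrite -(IH _ _ _ jk jn p sp wp).
have en : n = (n - 2).+2 by lia.
have ej : j = (j - 2).+2 by lia.
apply: (@jw_ext n _ _ _ _ _ _ sp wp); first by lia.
apply: (eq_on_trans (psi := (cup k (cup (j - 2) (cap k (jw k.+1 phi)))))); last first.
  rewrite [X in eq_on _ _ (cup X _)]ej; apply: cupC; lia.
rewrite en; apply: cup_ext; first by lia.
apply: (eq_on_trans (psi := (cap k (cup j (jw k.+1 phi))))).
  by apply: cap_ext; [lia|rewrite -en; exact: (IH _ _ _ jk jn)].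
by rewrite [X in cup X (jw _ _)]ej; apply: cap_cupC; lia.
Qed.

#[local] Arguments qint : simpl never.

Lemma jw_zero n k phi : (k < n)%N -> eq_on n phi (fun=> 0) -> eq_on n (jw k phi) (fun=> 0).
Proof.
move=> kn h p sp wp.
have h2 : eq_on n phi (fun p => 0 * phi p + 0 * phi p).
  by move=> q sq wq; rewrite h // !mul0r addr0.
by rewrite (jw_ext kn h2 sp wp) (jw_lin _ _ _ _ kn sp wp) !mul0r addr0.
Qed.

Lemma cap_jwSS n k i phi : (i < n)%N ->
  eq_on n (cap i (jw k.+2 phi)) (fun p => 1 * cap i (jw k.+1 phi) p
     + (- wenzl_coef k.+1) * cap i (jw k.+1 (cup k (cap k (jw k.+1 phi)))) p).
Proof.
move=> hi p sp wp; rewrite -(cap_lin _ _ _ _ hi sp wp).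
by apply: eq_bigr => v _; rewrite (jwSS k phi).
Qed.

(** Wenzl's argument. The four properties are proved by one induction: the
   annihilation of the last cap uses the partial trace (the fourth property) and
   the absorption of the smaller idempotent, and the partial trace uses the
   idempotence. *)
Lemma jw_main k :
  [/\ forall n phi, (k.+1 < n)%N -> eq_on n (jw k.+1 (jw k.+1 phi)) (jw k.+1 phi),
      forall n phi, (k.+1 < n)%N -> eq_on n (jw k (jw k.+1 phi)) (jw k.+1 phi),
      forall n i phi, (i < k <= n)%N -> eq_on n (cap i (jw k.+1 phi)) (fun=> 0) &
      forall n phi, (k < n)%N -> eq_on n (cap k (jw k.+1 (cup k phi)))
        (fun p => (qint delta k.+2 / qint delta k.+1)%:C * jw k phi p)].
Proof.
elim: k => [|k [idem absorb kill ptr]].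
  split=> [n phi _|n phi _||n phi n0]; rewrite ?jw1 ?jw0 //.
  apply: eq_on_trans (cap_cup _ n0) _ => p _ _.
  by rewrite (_ : qint delta 2 = delta) ?divr1 // qintSS /qint mulr1 subr0.
have absorb' n phi : (k.+2 < n)%N -> eq_on n (jw k.+1 (jw k.+2 phi)) (jw k.+2 phi).
  move=> kn p sp wp; have kn' : (k.+1 < n)%N by lia.
  have h : eq_on n (jw k.+2 phi) (fun p => 1 * jw k.+1 phi p
     + (- wenzl_coef k.+1) * jw k.+1 (cup k (cap k (jw k.+1 phi))) p).
    by move=> q _ _; rewrite (jwSS k phi).
  rewrite (jw_ext kn' h sp wp) (jw_lin _ _ _ _ kn' sp wp) (jwSS k phi).
  by rewrite !(idem _ _ kn' p sp wp).
have kill' n i phi : (i < k.+1 <= n)%N -> eq_on n (cap i (jw k.+2 phi)) (fun=> 0).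
  move=> /andP[ik kn]; have i_n : (i < n)%N by lia.
  move=> p sp wp; rewrite (cap_jwSS _ _ i_n sp wp).
  move: ik; rewrite ltnS leq_eqVlt => /orP[/eqP ik|ik]; last first.
    have ik' : (i < k <= n)%N by lia.
    by rewrite !(kill _ _ _ ik' p sp wp) !mulr0 addr0.
  rewrite ik (ptr _ _ kn p sp wp).
  have kn1 : (k <= k < n)%N by lia.
  rewrite (jw_capC _ kn1 sp wp) mulrA.
  have -> : cap k (jw k (jw k.+1 phi)) p = cap k (jw k.+1 phi) p.
    by apply: (cap_ext kn _ sp wp); apply: absorb; lia.
  rewrite -mulrDl /wenzl_coef mulNr -rmorphM /=.
  rewrite mulf_div [qint delta k.+1 * _]mulrC divff ?subrr ?mul0r //.
  by apply: lt0r_neq0; apply: mulr_gt0; exact: (qint_gt0 delta_ge2).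
split; [|exact: absorb'|exact: kill'|].
- move=> n phi kn p sp wp; rewrite (jwSS k (jw k.+2 phi)) (absorb' _ _ kn p sp wp) mul1r.
  have kn' : (k.+1 < n)%N by lia.
  rewrite (@jw_zero n _ _ kn' _ p sp wp) ?mulr0 ?addr0 //.
  have kn2 : (k < n - 2)%N by lia.
  have en : n = (n - 2).+2 by lia.
  have h0 : eq_on n (cup k (fun=> 0)) (fun=> 0).
    by move=> q _ _; rewrite /Defs.cup; case: ifP => // _; rewrite mulr0.
  apply: eq_on_trans h0; rewrite en; apply: (cup_ext kn2).
  have kn3 : (k < k.+1 <= n - 2)%N by lia.
  apply: (eq_on_trans (psi := (cap k (jw k.+2 phi)))); last exact: kill'.
  by apply: (cap_ext kn2); rewrite -en; exact: absorb'.
move=> n phi kn p sp wp; rewrite (cap_jwSS _ _ kn sp wp).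
have kn1 : (k.+1 <= k.+1 < n)%N by lia.
have cupf : eq_on n.+2 (jw k.+1 (cup k.+1 phi)) (cup k.+1 (jw k.+1 phi)).
  by apply: jw_cupC; lia.
have -> : cap k.+1 (jw k.+1 (cup k.+1 phi)) p = delta%:C * jw k.+1 phi p.
  by rewrite (cap_ext kn cupf sp wp) (cap_cup _ kn sp wp).
have k_n : (k < n)%N by lia.
have -> : cap k.+1 (jw k.+1 (cup k (cap k (jw k.+1 (cup k.+1 phi))))) p = jw k.+1 phi p.
  rewrite -(jw_capC _ kn1 sp wp) -[RHS](idem _ _ kn p sp wp).
  apply: (jw_ext kn _ sp wp).
  apply: (eq_on_trans (psi := (cap k.+1 (cup k (jw k.+1 phi))))); last first.
    exact: cap_cupS.
  apply: (cap_ext kn); apply: (cup_ext k_n).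
  apply: (eq_on_trans (psi := (cap k (cup k.+1 (jw k.+1 phi))))); last first.
    exact: cap_Scup.
  exact: (cap_ext k_n).
rewrite mul1r -mulrDl /wenzl_coef -rmorphN -rmorphD /=; congr (_%:C * _).
rewrite (qintSS delta k.+1) mulrDl mulNr mulfK //; apply: lt0r_neq0.
exact: (qint_gt0 delta_ge2).
Qed.

Lemma cap_jw n k i phi : (i.+1 < k)%N -> (k < n.+2)%N ->
  eq_on n (cap i (jw k phi)) (fun=> 0).
Proof.
case: k => // k ik kn; have [_ _ kill _] := jw_main k.
by apply: kill; lia.
Qed.

End JonesWenzl.

(** * Exact arithmetic in a tower of quadratic extensions *)

(** Codes of numbers on which the kernel computes. Division by an integer serves to
   find numerators only; each of them is certified afterwards by [feqb]. *)
Record ring_code := RingCode {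
  carrier :> Type;
  code0 : carrier;
  code_add : carrier -> carrier -> carrier;
  code_mul : carrier -> carrier -> carrier;
  code_opp : carrier -> carrier;
  is_zero : carrier -> bool;
  code_int : Z -> carrier;
  code_div : carrier -> Z -> carrier }.

Definition integer_code : ring_code :=
  RingCode 0%ZZ Z.add Z.mul Z.opp (Z.eqb 0) id Z.div.

Section Quadratic.
Variables (o : ring_code) (d : o).

Definition quad_pair (x y : o) : option (o * o) :=
  if is_zero x && is_zero y then None else Some (x, y).

Definition quad_add (x y : option (o * o)) : option (o * o) :=
  match x, y with
  | None, _ => y
  | _, None => x
  | Some (a, b), Some (a', b') => quad_pair (code_add a a') (code_add b b')
  end.

Definition quad_mul (x y : option (o * o)) : option (o * o) :=
  match x, y with
  | Some (a, b), Some (a', b') =>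
      quad_pair (code_add (code_mul a a') (code_mul d (code_mul b b')))
                (code_add (code_mul a b') (code_mul b a'))
  | _, _ => None
  end.

Definition quad_opp (x : option (o * o)) : option (o * o) :=
  if x is Some (a, b) then Some (code_opp a, code_opp b) else None.

(** The pair (a, b) codes a + b sqrt d, and [None] codes 0, so that the products
   by the many vanishing components cost nothing. *)
Definition quadratic_code : ring_code :=
  RingCode None quad_add quad_mul quad_opp (fun x => if x is None then true else false)
    (fun n => quad_pair (code_int o n) (code0 o))
    (fun x n => if x is Some (a, b) then quad_pair (code_div a n) (code_div b n) else None).

End Quadratic.

(** All the constants of the statement lie in the field obtained from Q by adjoining
   successively sqrt 21, sqrt (6 sqrt 21 - 18), sqrt 3,
   nu = sqrt (125469 sqrt 21 - 574584) and i. *)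
Definition code21 : ring_code := @quadratic_code integer_code 21%ZZ.
Definition root21_code (a b : Z) : code21 := @quad_pair integer_code a b.
Definition code_beta : ring_code := @quadratic_code code21 (root21_code (-18) 6).
(** a + b sqrt 21 + (c + d sqrt 21) sqrt (6 sqrt 21 - 18) *)
Definition f4 (a b c d : Z) : code_beta := @quad_pair code21 (root21_code a b) (root21_code c d).
Definition code3 : ring_code := @quadratic_code code_beta (code_int code_beta 3).
Definition code_nu : ring_code :=
  @quadratic_code code3 (@quad_pair code_beta (f4 (-574584) 125469 0 0) (code0 code_beta)).
Definition KC : ring_code := @quadratic_code code_nu (code_int code_nu (-1)).

Definition re_ (x : code_beta) : code_nu := @quad_pair code3 (@quad_pair code_beta x (code0 code_beta)) (code0 code3).
Definition s3_ (x : code_beta) : code_nu := @quad_pair code3 (@quad_pair code_beta (code0 code_beta) x) (code0 code3).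
(** x + i y sqrt 3 *)
Definition cx (x y : code_beta) : KC := @quad_pair code_nu (re_ x) (s3_ y).
(** x sqrt 3 + i y *)
Definition xc (x y : code_beta) : KC := @quad_pair code_nu (s3_ x) (re_ y).
Definition f0 : code_beta := None.
Definition nu : KC := @quad_pair code_nu (@quad_pair code3 (code0 code3) (code_int code3 1)) (code0 code_nu).
Definition conjK (x : KC) : KC := if x is Some (a, b) then Some (a, code_opp b) else None.

Notation kz := (code_int KC).
Definition kmul (x y : KC) : KC := code_mul x y.
Definition kadd (x y : KC) : KC := code_add x y.
Definition kopp (x : KC) : KC := code_opp x.
Definition k0 : KC := code0 KC.

(** (n, x) stands for x / n *)
Definition fraction : Type := (Z * KC)%type.

Open Scope Z_scope.
Definition A112 : fraction := (24, cx (f4 (-3) 3 1 0) (f4 (-9) 1 (-1) 0)).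
Definition A122 : fraction := (24, cx (f4 (-3) 3 (-1) 0) (f4 9 (-1) (-1) 0)).
Definition A113 : fraction := (144, cx (f4 (-18) 6 (-9) (-3)) (f4 (-18) 6 3 1)).
Definition A123 : fraction := (12, cx (f4 (-3) (-1) 0 0) (f4 (-3) (-1) 0 0)).
Definition A132 : fraction := (72, cx (f4 (-54) (-6) 0 0) (f4 0 0 3 1)).
Definition B112 : fraction := (240, cx (f4 6 6 (-11) (-1)) (f4 (-78) 2 11 1)).
Definition B122 : fraction := (240, cx (f4 6 6 11 1) (f4 78 (-2) 11 1)).
Definition B113 : fraction := (360, cx (f4 (-72) (-12) 0 0) (f4 0 0 (-27) (-7))).
Definition B123 : fraction := (360, cx (f4 (-108) (-48) 0 0) (f4 0 0 27 7)).
Definition B132 : fraction := (6, cx (f4 3 1 0 0) f0).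
Definition gamA : fraction := (24, xc (f4 (-6) 2 0 0) (f4 0 0 (-3) (-1))).
Definition gamB : fraction := (188700, kmul nu (xc (f4 1019 229 0 0) (f4 0 0 (-1457) (-312)))).
Definition R11 : fraction := (51, cx (f4 33 (-8) 0 0) f0).
Definition R12 : fraction := (113220, kmul nu (cx (f4 183 3 0 0) (f4 123 19 0 0))).
Definition R13 : fraction := (113220, kmul nu (cx (f4 183 3 0 0) (f4 (-123) (-19) 0 0))).
Definition R14 : fraction := (2550, cx (f4 (-2049) 659 0 0) f0).
Definition R21 : fraction := (18870, kmul nu (cx (f4 163 33 0 0) f0)).
Definition R22 : fraction := (102, cx (f4 (-48) 7 0 0) (f4 (-68) 17 0 0)).
Definition R23 : fraction := (102, cx (f4 (-48) 7 0 0) (f4 68 (-17) 0 0)).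
Definition R24 : fraction := (255, kopp nu).
Close Scope Z_scope.

Local Open Scope ring_scope.

Record represents (o : ring_code) (F : pzRingType) (phi : o -> F) : Prop :=
  Represents {
    rep0 : phi (code0 o) = 0;
    repD : forall x y, phi (code_add x y) = phi x + phi y;
    repM : forall x y, phi (code_mul x y) = phi x * phi y;
    repN : forall x, phi (code_opp x) = - phi x;
    rep_zero : forall x, is_zero x -> phi x = 0;
    rep_int : forall n, phi (code_int o n) = (int_of_Z n)%:~R }.

Definition intval (F : pzRingType) (n : Z) : F := (int_of_Z n)%:~R.

Lemma integer_represents (F : pzRingType) : represents (o := integer_code) (@intval F).
Proof.
split=> //= [x y|x y|x|x]; rewrite /intval.
- by rewrite -[Z.add x y]/(x + y)%R rmorphD rmorphD.
- by rewrite -[Z.mul x y]/(x * y)%R rmorphM rmorphM.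
- by rewrite -[Z.opp x]/(- x)%R rmorphN rmorphN.
- by case: x.
Qed.

Lemma intval_nat (F : pzRingType) (n : nat) : n%:R = intval F (Z.of_nat n).
Proof.
by rewrite /intval (_ : int_of_Z (Z.of_nat n) = n%:Z) ?pmulrn //; lia.
Qed.

(** Reads a decimal literal into [Z] digit by digit, which keeps the large
   coefficients of the statement in binary. *)
Fixpoint decimal_Z (d : Decimal.uint) (acc : Z) : Z :=
  match d with
  | Decimal.Nil => acc
  | Decimal.D0 d => decimal_Z d (10 * acc)
  | Decimal.D1 d => decimal_Z d (10 * acc + 1)
  | Decimal.D2 d => decimal_Z d (10 * acc + 2)
  | Decimal.D3 d => decimal_Z d (10 * acc + 3)
  | Decimal.D4 d => decimal_Z d (10 * acc + 4)
  | Decimal.D5 d => decimal_Z d (10 * acc + 5)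
  | Decimal.D6 d => decimal_Z d (10 * acc + 6)
  | Decimal.D7 d => decimal_Z d (10 * acc + 7)
  | Decimal.D8 d => decimal_Z d (10 * acc + 8)
  | Decimal.D9 d => decimal_Z d (10 * acc + 9)
  end%ZZ.

#[local] Arguments Z.mul : simpl never.
#[local] Arguments Z.add : simpl never.

Lemma decimal_natE d n : Z.of_nat (Nat.of_uint_acc d n) = decimal_Z d (Z.of_nat n).
Proof.
elim: d n => //= d IH n; rewrite IH Nat.tail_mul_spec ?Nat.tail_add_spec //;
  by congr decimal_Z; do ?rewrite Nat2Z.inj_succ; rewrite Nat2Z.inj_mul; lia.
Qed.

Lemma intval_decimal (F : pzRingType) d :
  (Nat.of_num_uint (Number.UIntDecimal d))%:R = intval F (decimal_Z d 0).
Proof. by rewrite intval_nat [Nat.of_num_uint _]/(Nat.of_uint_acc d 0) decimal_natE. Qed.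

Lemma intval_ge0 (F : numDomainType) z : Z.leb 0 z -> 0 <= intval F z.
Proof. by move=> /Z.leb_le h; rewrite /intval ler0z; lia. Qed.

Lemma intval_ltZ (F : numDomainType) x y : Z.ltb x y -> intval F x < intval F y.
Proof. by move=> /Z.ltb_lt h; rewrite /intval ltr_int; lia. Qed.

Lemma intval_ltNge (F : numDomainType) x y : Z.ltb x y -> (intval F y <= intval F x) = false.
Proof. by move=> /Z.ltb_lt h; rewrite /intval ler_int; lia. Qed.

Lemma intval_real (R : rcfType) z : intval R[i]%C z = (intval R z)%:C%C.
Proof. by rewrite /intval rmorph_int. Qed.

#[local] Opaque intval.

Definition quad_val (o : ring_code) (F : pzRingType) (phi : o -> F) (s : F)
  (x : option (o * o)) : F :=
  if x is Some (a, b) then phi a + phi b * s else 0.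

Lemma quad_pair_val (o : ring_code) (F : pzRingType) (phi : o -> F) (s : F) x y :
  represents phi -> quad_val phi s (quad_pair x y) = phi x + phi y * s.
Proof.
move=> rp; rewrite /quad_pair; case: ifP => //= /andP[x0 y0].
by rewrite !(rep_zero rp) // mul0r addr0.
Qed.

Lemma quadratic_represents (o : ring_code) (d : o) (F : comNzRingType) (phi : o -> F) (s : F) :
  represents phi -> s * s = phi d ->
  represents (o := quadratic_code d) (quad_val phi s).
Proof.
move=> rp sd; split=> //=.
- case=> [[a b]|] [[a' b']|] /=; rewrite ?add0r ?addr0 // quad_pair_val //.
  by rewrite !(repD rp) mulrDl addrACA.
- have E (a b a' b' : F) :
      a * a' + s * s * (b * b') + (a * b' + b * a') * s = (a + b * s) * (a' + b' * s).
    by ring.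
  case=> [[a b]|] [[a' b']|] /=; rewrite ?mul0r ?mulr0 // quad_pair_val //.
  by rewrite !(repD rp) !(repM rp) -sd E.
- by case=> [[a b]|] /=; rewrite ?oppr0 // !(repN rp) mulNr opprD.
- by case.
by move=> n; rewrite quad_pair_val // (rep_int rp) (rep0 rp) mul0r addr0.
Qed.

Lemma represents_comp (o : ring_code) (F F' : pzRingType) (phi : o -> F) (f : {rmorphism F -> F'}) :
  represents phi -> represents (f \o phi).
Proof.
move=> rp; split=> /= [|x y|x y|x|x x0|n].
- by rewrite (rep0 rp) rmorph0.
- by rewrite (repD rp) rmorphD.
- by rewrite (repM rp) rmorphM.
- by rewrite (repN rp) rmorphN.
- by rewrite (rep_zero rp) // rmorph0.
by rewrite (rep_int rp) rmorph_int.
Qed.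

Section Values.
Variable R : realType.
Local Notation C := R[i].
Local Open Scope complex_scope.

Local Notation s21 := (sqrt21 R).
Definition s3 : R := Num.sqrt 3.
Definition sbeta : R := Num.sqrt (6 * s21 - 18).
Definition snu : R := Num.sqrt (125469%:R * s21 - 574584%:R).

Definition val21 : code21 -> R := quad_val (o := integer_code) (@intval R) s21.
Definition valbeta : code_beta -> R := quad_val (o := code21) val21 sbeta.
Definition val3 : code3 -> R := quad_val (o := code_beta) valbeta s3.
Definition valnu : code_nu -> R := quad_val (o := code3) val3 snu.
Definition code_val : KC -> C := quad_val (o := code_nu) (real_complex R \o valnu) 'i.
Lemma sqr_s21 : s21 * s21 = 21. Proof. by rewrite -expr2 sqr_sqrtr. Qed.
Lemma sqr_s3 : s3 * s3 = 3. Proof. by rewrite -expr2 sqr_sqrtr. Qed.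

Lemma s21_ge0 : 0 <= s21. Proof. exact: sqrtr_ge0. Qed.

Lemma le_of_sqr (c x : R) : 0 <= x -> c * c <= x * x -> c <= x.
Proof.
move=> h h2; have [c0|c0] := leP c 0; first exact: le_trans c0 h.
by rewrite -(@ler_pXn2r _ 2) ?nnegrE ?expr2 // ltW.
Qed.

Lemma s21_bounds : 4582575694%:R / 1000000000%:R <= s21 <= 4582575695%:R / 1000000000%:R.
Proof.
have s0 := s21_ge0; have e := sqr_s21.
by apply/andP; split; apply: le_of_sqr => //; rewrite ?e; lra.
Qed.

Lemma sqr_sbeta : sbeta * sbeta = 6 * s21 - 18.
Proof. by have h := s21_bounds; rewrite -expr2 sqr_sqrtr //; lra. Qed.

Lemma sqr_snu : snu * snu = 125469%:R * s21 - 574584%:R.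
Proof. by have h := s21_bounds; rewrite -expr2 sqr_sqrtr //; lra. Qed.

Lemma val21_represents : represents val21.
Proof.
by apply: (quadratic_represents (integer_represents R)); rewrite sqr_s21 intval_nat.
Qed.

Lemma valbeta_represents : represents valbeta.
Proof.
apply: (quadratic_represents val21_represents); rewrite sqr_sbeta /=.
by rewrite !intval_nat -(repN (integer_represents R)) addrC.
Qed.

Lemma val3_represents : represents val3.
Proof.
apply: (quadratic_represents valbeta_represents).
by rewrite sqr_s3 (rep_int valbeta_represents) intval_nat.
Qed.

Lemma valnu_represents : represents valnu.
Proof.
apply: (quadratic_represents val3_represents).
rewrite sqr_snu !intval_decimal -[decimal_Z _ 0]/125469%ZZ -[decimal_Z _ 0]/574584%ZZ.
by rewrite /= mul0r mul0r !addr0 -(repN (integer_represents R)) addrC.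
Qed.

Lemma val_represents : represents code_val.
Proof.
apply: (quadratic_represents (represents_comp (real_complex R) valnu_represents)).
rewrite (rep_int (represents_comp (real_complex R) valnu_represents)) /=.
by rewrite -['i * 'i]expr2 sqr_i.
Qed.
End Values.

(** * Locating roots of integer polynomials *)

Section LambdaRoots.
Variable R : realType.
Local Notation C := R[i].
Local Open Scope complex_scope.

Definition gauss_code : ring_code := @quadratic_code integer_code (-1)%ZZ.
Definition gauss_val : gauss_code -> C := quad_val (o := integer_code) (@intval C) 'i.

Lemma gauss_val_represents : represents gauss_val.
Proof.
apply: (quadratic_represents (integer_represents C)).
by rewrite -['i * 'i]expr2 sqr_i (repN (integer_represents C) 1%ZZ) -(intval_nat C 1).
Qed.

Definition horner_desc (F : pzRingType) (a : seq F) (x : F) : F :=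
  foldl (fun s c => s * x + c) 0 a.

Definition horner_asc (l : seq C) (h : C) : C := foldr (fun c s => c + h * s) 0 l.

Lemma horner_asc_cons c l h : horner_asc (c :: l) h = c + h * horner_asc l h.
Proof. by []. Qed.

Lemma root_horner_desc (a : seq C) (x : C) : root (Poly (rev a)) x = (horner_desc a x == 0).
Proof.
rewrite /root horner_Poly /horner_desc -[in RHS](revK a) foldl_rev; congr (_ == 0).
by elim: (rev a) => //= c l ->.
Qed.

Fixpoint scale_desc (n q : Z) (a : seq Z) : seq Z :=
  if a is c :: a then Z.mul c q :: scale_desc n (Z.mul q n) a else [::].

Lemma horner_scale (F : fieldType) (n : Z) (a : seq Z) (x t : F) :
  intval F n != 0 -> intval F n * x = t ->
  (horner_desc (map (@intval F) (scale_desc n n a)) t == 0) =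
  (horner_desc (map (@intval F) a) x == 0).
Proof.
move=> n0 nx; have rz := integer_represents F.
suff E s q : foldl (fun s c => s * t + c) (s * intval F q)
    (map (@intval F) (scale_desc n (Z.mul q n) a)) =
  foldl (fun s c => s * x + c) s (map (@intval F) a) * (intval F q * intval F n ^+ size a).
  have := E 0 1%ZZ; rewrite mul0r [Z.mul 1 n]Z.mul_1_l => E1.
  rewrite /horner_desc E1 !mulf_eq0 (negbTE (expf_neq0 _ n0)) orbF.
  by rewrite -(intval_nat F 1) oner_eq0 orbF.
elim: a s q => [|c a IH] s q /=; first by rewrite expr0 mulr1.
have -> : s * intval F q * t + intval F (Z.mul c (Z.mul q n)) =
    (s * x + intval F c) * intval F (Z.mul q n).
  by rewrite -nx !(repM rz); ring.
by rewrite IH (repM rz) -mulrA -exprS.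
Qed.

Fixpoint poly_add (o : ring_code) (l m : seq o) : seq o :=
  match l, m with
  | [::], _ => m
  | _, [::] => l
  | x :: l, y :: m => code_add x y :: poly_add l m
  end.

Definition taylor_step (p : gauss_code) (l : seq gauss_code) (c : Z) : seq gauss_code :=
  poly_add (code_int gauss_code c :: l) (map (code_mul p) l).

Definition taylor (p : gauss_code) (a : seq Z) : seq gauss_code :=
  foldl (taylor_step p) [::] a.

Lemma horner_poly_add l m h :
  horner_asc (map gauss_val (poly_add l m)) h =
  horner_asc (map gauss_val l) h + horner_asc (map gauss_val m) h.
Proof.
elim: l m => [|x l IH] [|y m] /=; rewrite ?add0r ?addr0 // IH.
by rewrite (repD gauss_val_represents) mulrDr addrACA.
Qed.

Lemma horner_taylor p a h :
  horner_asc (map gauss_val (taylor p a)) h =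
  horner_desc (map (@intval C) a) (gauss_val p + h).
Proof.
have rg := gauss_val_represents.
have reduce_step l c : horner_asc (map gauss_val (taylor_step p l c)) h =
    horner_asc (map gauss_val l) h * (gauss_val p + h) + intval C c.
  rewrite /taylor_step horner_poly_add map_cons.
  have -> : horner_asc (map gauss_val (map (code_mul p) l)) h =
      gauss_val p * horner_asc (map gauss_val l) h.
    elim: l => [|x l IHl]; first by rewrite /= mulr0.
    by rewrite !map_cons !horner_asc_cons (repM rg) IHl; ring.
  by rewrite horner_asc_cons (rep_int rg) -/(intval C c); ring.
rewrite /taylor /horner_desc.
have -> : 0 = horner_asc (map gauss_val [::]) h by [].
move: [::]; elim: a => [|c a IH] l; first by [].
by have := IH (taylor_step p l c); rewrite reduce_step.
Qed.

Definition gauss_norm (c : gauss_code) : Z := if c is Some (a, b) then (Z.abs a + Z.abs b)%ZZ else 0%ZZ.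
Definition gauss_low (c : gauss_code) : Z := if c is Some (a, b) then Z.max (Z.abs a) (Z.abs b) else 0%ZZ.

Fixpoint size_bound (l : seq gauss_code) : Z :=
  if l is c :: l then (gauss_norm c + size_bound l)%ZZ else 0%ZZ.
Fixpoint lipschitz_bound (l : seq gauss_code) : Z :=
  if l is c :: l then (size_bound l + lipschitz_bound l)%ZZ else 0%ZZ.

(** After the substitution x -> x / n the disc of radius 1 / n around p / n becomes
   the unit disc around p. Write the polynomial there as c0 + c h + h^2 g(h); on
   the unit disc h^2 g(h) has a Lipschitz constant at most twice a bound of g plus
   a Lipschitz constant of g. If this is less than the norm of c, the
   polynomial is injective on the disc, hence has at most one root there. *)
Definition separated (n : Z) (p : gauss_code) (a : seq Z) : bool :=
  if taylor p (scale_desc n n a) is _ :: c :: l then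
    Z.ltb (2 * size_bound l + lipschitz_bound l)%ZZ (gauss_low c)
  else false.

Lemma intval_abs (F : numDomainType) z : `|intval F z| = intval F (Z.abs z).
Proof.
case: z => [|p|p]; rewrite /Z.abs.
- by rewrite -(intval_nat F 0) normr0.
- by rewrite ger0_norm //; apply: intval_ge0.
by rewrite (repN (integer_represents F) (Z.pos p)) normrN ger0_norm //; apply: intval_ge0.
Qed.

Lemma norm_i : `|'i : C| = 1.
Proof. by rewrite normc_def /= expr0n expr1n /= add0r sqrtr1. Qed.

Lemma gauss_norm_le c : `|gauss_val c| <= intval C (gauss_norm c).
Proof.
case: c => [[a b]|] /=; last by rewrite normr0 -(intval_nat C 0).
rewrite (repD (integer_represents C)) -!intval_abs.
by rewrite (le_trans (ler_normD _ _)) // lerD2l normrM norm_i mulr1.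
Qed.

Lemma gauss_low_le c : intval C (gauss_low c) <= `|gauss_val c|.
Proof.
case: c => [[a b]|] /=; last by rewrite normr0 -(intval_nat C 0).
rewrite !intval_real.
have -> : (intval R a)%:C + (intval R b)%:C * 'i = intval R a +i* intval R b.
  by simpc.
rewrite normc_def /= lecR.
have h x y : `|x| <= Num.sqrt (x ^+ 2 + y ^+ 2) :> R.
  by rewrite -sqrtr_sqr ler_wsqrtr // lerDl sqr_ge0.
have [->|->] : Z.max (Z.abs a) (Z.abs b) = Z.abs a \/ Z.max (Z.abs a) (Z.abs b) = Z.abs b by lia.
  by rewrite -intval_abs.
by rewrite -intval_abs addrC.
Qed.

Lemma horner_asc_bound l h : `|h| <= 1 ->
  `|horner_asc (map gauss_val l) h| <= intval C (size_bound l).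
Proof.
move=> h1; elim: l => [|c l IH] /=; first by rewrite normr0 -(intval_nat C 0).
rewrite (repD (integer_represents C)) (le_trans (ler_normD _ _)) //.
rewrite lerD ?gauss_norm_le // normrM (le_trans _ IH) // ler_piMl //.
Qed.

Lemma horner_asc_lipschitz l h k : `|h| <= 1 -> `|k| <= 1 ->
  `|horner_asc (map gauss_val l) h - horner_asc (map gauss_val l) k|
    <= intval C (lipschitz_bound l) * `|h - k|.
Proof.
move=> h1 k1; elim: l => [|c l IH] /=.
  by rewrite subrr normr0 -(intval_nat C 0) mul0r.
set P := horner_asc (map gauss_val l) in IH *.
have -> : gauss_val c + h * P h - (gauss_val c + k * P k) = (h - k) * P h + k * (P h - P k).
  ring.
rewrite (repD (integer_represents C)) [leRHS]mulrDl; apply: le_trans (ler_normD _ _) _.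
apply: lerD; rewrite normrM.
  by rewrite mulrC ler_wpM2r // horner_asc_bound.
by apply: le_trans IH; rewrite ler_piMl.
Qed.

Lemma separatedP n p a h k : separated n p a -> `|h| <= 1 -> `|k| <= 1 ->
  horner_desc (map (@intval C) (scale_desc n n a)) (gauss_val p + h) = 0 ->
  horner_desc (map (@intval C) (scale_desc n n a)) (gauss_val p + k) = 0 -> h = k.
Proof.
rewrite /separated -!horner_taylor; case: taylor => [|c0 [|c l]] // sep h1 k1 /= Ph Pk.
apply/eqP; rewrite -subr_eq0; apply/negPn/negP => hk.
have hk0 : 0 < `|h - k| by rewrite normr_gt0.
set P := horner_asc (map gauss_val l) in Ph Pk.
have E : (h - k) * gauss_val c = - ((h - k) * (h * P h) + k * ((gauss_val c + h * P h) - (gauss_val c + k * P k))).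
  apply/eqP; rewrite -subr_eq0 opprK; apply/eqP.
  transitivity ((gauss_val c0 + h * (gauss_val c + h * P h)) - (gauss_val c0 + k * (gauss_val c + k * P k))).
    ring.
  by rewrite Ph Pk subrr.
have L : `|h - k| * `|gauss_val c| <= `|h - k| * intval C (2 * size_bound l + lipschitz_bound l)%ZZ.
  rewrite -normrM E normrN; apply: le_trans (ler_normD _ _) _.
  have -> : (2 * size_bound l + lipschitz_bound l)%ZZ = (size_bound l + lipschitz_bound (c :: l))%ZZ.
    by rewrite /=; lia.
  rewrite (repD (integer_represents C)) [leRHS]mulrDr; apply: lerD; rewrite normrM.
    rewrite ler_wpM2l // normrM; apply: le_trans (horner_asc_bound l h1).
    by rewrite ler_piMl.
  rewrite mulrC [leRHS]mulrC.
  apply: le_trans (horner_asc_lipschitz (c :: l) h1 k1).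
  by rewrite ler_piMr.
rewrite ler_pM2l // in L.
have := le_trans (gauss_low_le c) L.
by rewrite (intval_ltNge _ sep).
Qed.

(** A root at distance at most 1 / n from z is the root closest to z as soon as the
   disc of radius 1 / n around z contains no other root. *)
Lemma lambda_root_eq (z x : C) (a : seq C) (n : Z) (p : gauss_code) (b : seq Z) :
  a = map (@intval C) b -> Z.ltb 0 n -> intval C n * z = gauss_val p ->
  separated n p b -> horner_desc a x = 0 -> `|intval C n * x - gauss_val p| <= 1 ->
  lambda_root z a = x.
Proof.
move=> -> n0 nz sep x0 xz; have n0' : 0 < intval C n.
  by have := intval_ltZ C n0; rewrite -(intval_nat C 0).
have nn : intval C n != 0 by rewrite gt_eqF.
have near y : (`|intval C n * y - gauss_val p| <= 1) = (`|y - z| <= (intval C n)^-1).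
  by rewrite -nz -mulrBr normrM (gtr0_norm n0') -ler_pdivlMl // mulr1.
have same y : horner_desc (map (@intval C) b) y = 0 -> `|intval C n * y - gauss_val p| <= 1 -> y = x.
  move=> y0 yz; apply: (mulfI nn); apply: (addIr (- gauss_val p)).
  apply: (separatedP sep yz xz).
    by apply/eqP; rewrite addrC subrK (horner_scale b nn (erefl _)) y0.
  by apply/eqP; rewrite addrC subrK (horner_scale b nn (erefl _)) x0.
apply: classical_sets.xget_unique.
  split; first by rewrite root_horner_desc x0.
  move=> y; rewrite root_horner_desc => /eqP y0.
  have [yx|] := real_leP (normr_real (x - z)) (normr_real (y - z)) => // yx.
  suff e : y = x by rewrite e ltxx in yx.
  by apply: same => //; rewrite near; apply: le_trans (ltW yx) _; rewrite -near.
move=> y [y0 ymin]; apply: same; first by apply/eqP; rewrite -root_horner_desc.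
rewrite near; apply: (le_trans (ymin x _)); last by rewrite -near.
by rewrite root_horner_desc x0.
Qed.
End LambdaRoots.

Section IntvalBinary.
Variable F : pzRingType.
Lemma intval_xO p : intval F (Z.pos (xO p)) = 2 * intval F (Z.pos p).
Proof. by rewrite (intval_nat F 2) -(repM (integer_represents F)). Qed.
Lemma intval_xI p : intval F (Z.pos (xI p)) = 2 * intval F (Z.pos p) + 1.
Proof.
rewrite (intval_nat F 2) -[X in _ + X]/(1%:R) (intval_nat F 1).
by rewrite -(repM (integer_represents F)) -(repD (integer_represents F)).
Qed.
Lemma intval_neg p : intval F (Z.neg p) = - intval F (Z.pos p).
Proof. exact: (repN (integer_represents F) (Z.pos p)). Qed.
Lemma intval_0 : intval F 0 = 0. Proof. by rewrite -(intval_nat F 0). Qed.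
Lemma intval_1 : intval F 1 = 1. Proof. by rewrite -(intval_nat F 1). Qed.
Definition intval_binary := (intval_neg, intval_xO, intval_xI, intval_1, intval_0).
End IntvalBinary.

Section Numbers.
Variable R : realType.
Local Notation C := R[i].
Local Open Scope complex_scope.
Local Notation s21 := (sqrt21 R).
Local Notation s3 := (s3 R).
Local Notation sbeta := (sbeta R).
Local Notation snu := (snu R).

Definition fval (x : fraction) : C := code_val R x.2 / intval C x.1.

Lemma fvalE x : fval x = code_val R x.2 / intval C x.1. Proof. by []. Qed.

Definition is_root (x : fraction) (b : seq Z) : bool :=
  ~~ Z.eqb x.1 0 &&
  is_zero (foldl (fun s c => kadd (kmul s x.2) (kz c)) k0 (scale_desc x.1 x.1 b)).

Lemma intval_neq0 (F : numDomainType) n : ~~ Z.eqb n 0 -> intval F n != 0.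
Proof.
move=> n0; have [h|h] : Z.ltb 0 n \/ Z.ltb n 0 by lia.
  by rewrite gt_eqF //; have := intval_ltZ F h; rewrite -(intval_nat F 0).
by rewrite lt_eqF //; have := intval_ltZ F h; rewrite -(intval_nat F 0).
Qed.

Lemma is_rootP x b : is_root x b -> horner_desc (map (@intval C) b : seq C) (fval x) = 0.
Proof.
case: x => n x /andP[n0 h]; have rv := val_represents R.
have nn : intval C n != 0 by exact: intval_neq0.
have e : intval C n * fval (n, x) = code_val R x by rewrite /fval mulrC divfK.
apply/eqP; rewrite -(horner_scale b nn e) -(rep_zero rv h) /horner_desc.
apply/eqP; rewrite -[X in foldl _ X](rep0 rv).
have -> : k0 = code0 KC by [].
elim: (scale_desc _ _ _) (code0 KC) => [|c l IH] s; first by [].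
have E : code_val R (kadd (kmul s x) (kz c)) = code_val R s * code_val R x + intval C c.
  by rewrite (repD rv) (repM rv) (rep_int rv).
by have := IH (kadd (kmul s x) (kz c)); rewrite E.
Qed.

Lemma complex_form (x y : R) : x%:C + y%:C * 'i = x +i* y.
Proof. by simpc. Qed.

Lemma val_cx a b c d a' b' c' d' :
  code_val R (cx (f4 a b c d) (f4 a' b' c' d')) =
  (intval R a + intval R b * s21 + (intval R c + intval R d * s21) * sbeta)
  +i* ((intval R a' + intval R b' * s21 + (intval R c' + intval R d' * s21) * sbeta) * s3).
Proof.
have r21 := val21_represents R; have rb := valbeta_represents R.
have r3 := val3_represents R; have rn := valnu_represents R.
have rc := represents_comp (real_complex R) rn.
have f4E x y z t : valbeta R (f4 x y z t) = intval R x + intval R y * s21 + (intval R z + intval R t * s21) * sbeta.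
  by rewrite /valbeta /f4 quad_pair_val // /val21 !quad_pair_val //; exact: integer_represents.
rewrite /code_val /cx quad_pair_val // /= /re_ /s3_ /valnu !quad_pair_val // /val3.
rewrite !quad_pair_val // !(rep0 rb, rep0 r3) !mul0r !addr0 add0r !f4E.
exact: complex_form.
Qed.

Lemma val_xc a b c d a' b' c' d' :
  code_val R (xc (f4 a b c d) (f4 a' b' c' d')) =
  ((intval R a + intval R b * s21 + (intval R c + intval R d * s21) * sbeta) * s3)
  +i* (intval R a' + intval R b' * s21 + (intval R c' + intval R d' * s21) * sbeta).
Proof.
have r21 := val21_represents R; have rb := valbeta_represents R.
have r3 := val3_represents R; have rn := valnu_represents R.
have rc := represents_comp (real_complex R) rn.
have f4E x y z t : valbeta R (f4 x y z t) = intval R x + intval R y * s21 + (intval R z + intval R t * s21) * sbeta.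
  by rewrite /valbeta /f4 quad_pair_val // /val21 !quad_pair_val //; exact: integer_represents.
rewrite /code_val /xc quad_pair_val // /= /re_ /s3_ /valnu !quad_pair_val // /val3.
rewrite !quad_pair_val // !(rep0 rb, rep0 r3) !mul0r !addr0 add0r !f4E.
exact: complex_form.
Qed.

Lemma val_nu : code_val R nu = snu%:C.
Proof.
have rb := valbeta_represents R.
have r3 := val3_represents R; have rn := valnu_represents R.
have rc := represents_comp (real_complex R) rn.
rewrite /code_val /nu quad_pair_val // (rep0 rc) mul0r addr0 /=.
by rewrite -(intval_nat R 1) -(intval_nat R 0) !mul0r !addr0 add0r mul1r.
Qed.

Lemma mul_bounds (a b c d x y : R) : 0 <= a -> 0 <= c -> a <= x <= b -> c <= y <= d ->
  a * c <= x * y <= b * d.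
Proof.
move=> a0 c0 /andP[ax xb] /andP[cy yd].
have x0 := le_trans a0 ax; have y0 := le_trans c0 cy.
by apply/andP; split; apply: ler_pM.
Qed.

Lemma sbeta_bounds : 308146948%:R / 100000000%:R <= sbeta <= 308146952%:R / 100000000%:R.
Proof.
have h := s21_bounds R; have e := sqr_sbeta R.
apply/andP; split; apply: le_of_sqr; [exact: sqrtr_ge0|lra|lra|lra].
Qed.

Lemma s3_bounds : 173205080%:R / 100000000%:R <= s3 <= 173205081%:R / 100000000%:R.
Proof.
have e := sqr_s3 R.
apply/andP; split; apply: le_of_sqr; [exact: sqrtr_ge0|lra|lra|lra].
Qed.

Lemma snu_bounds : 1967713%:R / 100000%:R <= snu <= 1967715%:R / 100000%:R.
Proof.
have h := s21_bounds R; have e := sqr_snu R.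
apply/andP; split; apply: le_of_sqr; [exact: sqrtr_ge0|lra|lra|lra].
Qed.

Lemma fval_form x y n e : code_val R e = x +i* y -> fval (n, e) = (x / intval R n) +i* (y / intval R n).
Proof.
move=> h; rewrite /fval /= h intval_real.
have -> : ((intval R n)%:C)^-1 = ((intval R n)^-1)%:C by rewrite fmorphV.
by simpc.
Qed.

Lemma gauss_val_form a b : gauss_val R (Some (a, b)) = intval R a +i* intval R b.
Proof. by rewrite /= !intval_real complex_form. Qed.

(** The distance is bounded through the real and imaginary parts: 7 / 10 is
   small enough because 2 (7 / 10)^2 <= 1. *)
Lemma lambda_root_fval (z : C) (x y x' y' : R) (a : seq C) (n p1 p2 : Z) (b : seq Z) (d : Z) (e : KC) :
  a = map (@intval C) b -> Z.ltb 0 n -> z = x' +i* y' ->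
  intval R n * x' = intval R p1 -> intval R n * y' = intval R p2 ->
  separated n (Some (p1, p2)) b -> is_root (d, e) b -> code_val R e = x +i* y ->
  Z.ltb 0 d ->
  `|intval R n * x - intval R p1 * intval R d| <= 7%:R / 10%:R * intval R d ->
  `|intval R n * y - intval R p2 * intval R d| <= 7%:R / 10%:R * intval R d ->
  lambda_root z a = fval (d, e).
Proof.
move=> ha n0 hz h1 h2 sep hr he hd.
have d0 : 0 < intval R d by have := intval_ltZ R hd; rewrite intval_0.
have close t p : `|intval R n * t - intval R p * intval R d| <= 7%:R / 10%:R * intval R d ->
    `|intval R n * (t / intval R d) - intval R p| <= 7%:R / 10%:R.
  have -> : intval R n * (t / intval R d) - intval R p = (intval R n * t - intval R p * intval R d) / intval R d.
    by rewrite mulrBl mulfK ?gt_eqF // mulrA.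
  by rewrite normrM normfV (gtr0_norm d0) ler_pdivrMr.
move=> /close hx /close hy.
have hz0 : horner_desc a (fval (d, e)) = 0 by rewrite ha; exact: is_rootP.
apply: (lambda_root_eq (p := Some (p1, p2)) ha n0 _ sep hz0).
  by rewrite hz gauss_val_form intval_real; simpc; rewrite h1 h2.
rewrite (fval_form _ he) gauss_val_form intval_real; simpc.
rewrite /= -[leRHS]sqrtr1 ler_wsqrtr //.
have sq t : `|t| <= 7%:R / 10%:R :> R -> t ^+ 2 <= 49%:R / 100%:R.
  rewrite ler_norml => /andP[l u]; have : 0 <= (7%:R / 10%:R - t) * (7%:R / 10%:R + t).
    by apply: mulr_ge0; lra.
  by rewrite expr2; lra.
have := sq _ hx; have := sq _ hy; lra.
Qed.

End Numbers.

(** * Closed forms of the constants *)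

Section Constants.
Variable R : realType.
Local Notation C := R[i].
Local Open Scope complex_scope.
Local Notation s21 := (sqrt21 R).
Local Notation s3 := (s3 R).
Local Notation sbeta := (sbeta R).
Local Notation snu := (snu R).
Local Notation fval := (fval R).

Lemma val_nu_mul x y e : code_val R e = x +i* y -> code_val R (kmul nu e) = (snu * x) +i* (snu * y).
Proof. by move=> he; rewrite (repM (val_represents R)) val_nu he; simpc. Qed.

Lemma bounds_all : [/\ 4582575694%:R / 1000000000%:R <= s21 <= 4582575695%:R / 1000000000%:R,
  308146948%:R / 100000000%:R <= sbeta <= 308146952%:R / 100000000%:R,
  173205080%:R / 100000000%:R <= s3 <= 173205081%:R / 100000000%:R &
  1967713%:R / 100000%:R <= snu <= 1967715%:R / 100000%:R].
Proof. by split; [exact: s21_bounds|exact: sbeta_bounds|exact: s3_bounds|exact: snu_bounds]. Qed.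

Lemma bounds_mul : [/\ 1412106%:R / 100000%:R <= s21 * sbeta <= 1412108%:R / 100000%:R,
  793725%:R / 100000%:R <= s21 * s3 <= 793726%:R / 100000%:R,
  533726%:R / 100000%:R <= sbeta * s3 <= 533727%:R / 100000%:R,
  2445839%:R / 100000%:R <= s21 * sbeta * s3 <= 2445844%:R / 100000%:R &
  [/\ 9017193%:R / 100000%:R <= snu * s21 <= 9017204%:R / 100000%:R,
      3408178%:R / 100000%:R <= snu * s3 <= 3408183%:R / 100000%:R &
      15618236%:R / 100000%:R <= snu * s21 * s3 <= 15618257%:R / 100000%:R]].
Proof.
have [h1 h2 h3 h4] := bounds_all.
have m12 : 1412106%:R / 100000%:R <= s21 * sbeta <= 1412108%:R / 100000%:R.
  by have := mul_bounds _ _ h1 h2; lra.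
have m41 : 9017193%:R / 100000%:R <= snu * s21 <= 9017204%:R / 100000%:R.
  by have := mul_bounds _ _ h4 h1; lra.
split; last split; [exact: m12| | | |exact: m41| |].
- by have := mul_bounds _ _ h1 h3; lra.
- by have := mul_bounds _ _ h2 h3; lra.
- by have := mul_bounds _ _ m12 h3; lra.
- by have := mul_bounds _ _ h4 h3; lra.
by have := mul_bounds _ _ m41 h3; lra.
Qed.

Lemma cons_eq (T : Type) (x y : T) (l m : seq T) : x = y -> l = m -> x :: l = y :: m.
Proof. by move=> -> ->. Qed.

Ltac literals :=
  cbn [map];
  repeat match goal with |- @eq _ (_ :: _) (_ :: _) => apply: cons_eq end;
  match goal with
  | |- @eq _ [::] _ => exact: erefl
  | _ => rewrite ?intval_neg ?intval_1 ?intval_0 ?intval_decimal ?intval_nat; reflexivity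
  end.
Ltac rational := rewrite ?intval_binary; lra.
Ltac close :=
  have [h1 h2 h3 h4] := bounds_all; have [m1 m2 m3 m4 [m5 m6 m7]] := bounds_mul;
  rewrite ?intval_binary ler_norml; lra.

Ltac lambda_side :=
  match goal with
  | |- @eq (seq _) _ _ => literals
  | |- is_true (Z.ltb _ _) => reflexivity
  | |- is_true (separated _ _ _) => vm_compute; reflexivity
  | |- is_true (is_root _ _) => vm_compute; reflexivity
  | |- is_true (_ <= _) => close
  | |- @eq _ (intval _ _ * _) _ => rational
  | |- _ => reflexivity
  end.

Lemma A112E : lambda_root ((5762%:R / 10 ^+ 4) -i* (5412%:R / 10 ^+ 4)) [:: 9; 9; 9; - 18; 21; - 12; 12; - 6; 1] = fval A112.
Proof.
apply: (@lambda_root_fval R _ _ _ (5762%:R / 10 ^+ 4) (- (5412%:R / 10 ^+ 4)) _ 10000 5762 (-5412) [:: 9; 9; 9; (-18); 21; (-12); 12; (-6); 1]%ZZ _ _ _ _ _ _ _ _ _ (val_cx _ _ _ _ _ _ _ _ _)); lambda_side.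
Qed.

Lemma A122E : lambda_root ((3194%:R / 10 ^+ 4) +i* (964 / 10 ^+ 4)) [:: 9; 9; 9; - 18; 21; - 12; 12; - 6; 1] = fval A122.
Proof.
apply: (@lambda_root_fval R _ _ _ (3194%:R / 10 ^+ 4) (964 / 10 ^+ 4) _ 10000 3194 964 [:: 9; 9; 9; (-18); 21; (-12); 12; (-6); 1]%ZZ _ _ _ _ _ _ _ _ _ (val_cx _ _ _ _ _ _ _ _ _)); lambda_side.
Qed.

Lemma A113E : lambda_root ((- 4208%:R / 10 ^+ 4) +i* (3953%:R / 10 ^+ 4)) [:: 81; 81; 54; - 27; - 27; - 9; 6; 3; 1] = fval A113.
Proof.
apply: (@lambda_root_fval R _ _ _ (- 4208%:R / 10 ^+ 4) (3953%:R / 10 ^+ 4) _ 10000 (-4208) 3953 [:: 81; 81; 54; (-27); (-27); (-9); 6; 3; 1]%ZZ _ _ _ _ _ _ _ _ _ (val_cx _ _ _ _ _ _ _ _ _)); lambda_side.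
Qed.

Lemma A123E : lambda_root ((- 6319%:R / 10 ^+ 4) -i* (10945%:R / 10 ^+ 4)) [:: 9; 9; 12; - 3; 1] = fval A123.
Proof.
apply: (@lambda_root_fval R _ _ _ (- 6319%:R / 10 ^+ 4) (- (10945%:R / 10 ^+ 4)) _ 10000 (-6319) (-10945) [:: 9; 9; 12; (-3); 1]%ZZ _ _ _ _ _ _ _ _ _ (val_cx _ _ _ _ _ _ _ _ _)); lambda_side.
Qed.

Lemma A132E : lambda_root ((- 11319%:R / 10 ^+ 4) +i* (5621%:R / 10 ^+ 4)) [:: 9; 27; 30; 12; 1] = fval A132.
Proof.
apply: (@lambda_root_fval R _ _ _ (- 11319%:R / 10 ^+ 4) (5621%:R / 10 ^+ 4) _ 10000 (-11319) 5621 [:: 9; 27; 30; 12; 1]%ZZ _ _ _ _ _ _ _ _ _ (val_cx _ _ _ _ _ _ _ _ _)); lambda_side.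
Qed.

Lemma B112E : lambda_root ((- 605 / 10 ^+ 4) -i* (1502%:R / 10 ^+ 4)) [:: 225; - 45; 288; - 45; 201; - 39; 36; 3; 1] = fval B112.
Proof.
apply: (@lambda_root_fval R _ _ _ (- 605 / 10 ^+ 4) (- (1502%:R / 10 ^+ 4)) _ 10000 (-605) (-1502) [:: 225; (-45); 288; (-45); 201; (-39); 36; 3; 1]%ZZ _ _ _ _ _ _ _ _ _ (val_cx _ _ _ _ _ _ _ _ _)); lambda_side.
Qed.

Lemma B122E : lambda_root ((3396%:R / 10 ^+ 4) +i* (8433%:R / 10 ^+ 4)) [:: 225; - 45; 288; - 45; 201; - 39; 36; 3; 1] = fval B122.
Proof.
apply: (@lambda_root_fval R _ _ _ (3396%:R / 10 ^+ 4) (8433%:R / 10 ^+ 4) _ 10000 3396 8433 [:: 225; (-45); 288; (-45); 201; (-39); 36; 3; 1]%ZZ _ _ _ _ _ _ _ _ _ (val_cx _ _ _ _ _ _ _ _ _)); lambda_side.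
Qed.

Lemma B113E : lambda_root ((- 3528%:R / 10 ^+ 4) -i* (8759%:R / 10 ^+ 4)) [:: 45; 36; 42; 3; - 1] = fval B113.
Proof.
apply: (@lambda_root_fval R _ _ _ (- 3528%:R / 10 ^+ 4) (- (8759%:R / 10 ^+ 4)) _ 10000 (-3528) (-8759) [:: 45; 36; 42; 3; (-1)]%ZZ _ _ _ _ _ _ _ _ _ (val_cx _ _ _ _ _ _ _ _ _)); lambda_side.
Qed.

Lemma B123E : lambda_root ((- 9110%:R / 10 ^+ 4) +i* (8759%:R / 10 ^+ 4)) [:: 45; 54; 24; - 39; 5] = fval B123.
Proof.
apply: (@lambda_root_fval R _ _ _ (- 9110%:R / 10 ^+ 4) (8759%:R / 10 ^+ 4) _ 10000 (-9110) 8759 [:: 45; 54; 24; (-39); 5]%ZZ _ _ _ _ _ _ _ _ _ (val_cx _ _ _ _ _ _ _ _ _)); lambda_side.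
Qed.

Lemma r12E : lambda_root ((34194%:R / 10 ^+ 6) +i* (63236%:R / 10 ^+ 6)) [:: 4228250625%:R; 0; 18810887175%:R; 0; 36065983311%:R; 0; 203997780%:R; 0; 960400%:R] = fval R12.
Proof.
apply: (@lambda_root_fval R _ _ _ (34194%:R / 10 ^+ 6) (63236%:R / 10 ^+ 6) _ 1000000 34194 63236 [:: 4228250625; 0; 18810887175; 0; 36065983311; 0; 203997780; 0; 960400]%ZZ _ _ _ _ _ _ _ _ _ (val_nu_mul (val_cx R _ _ _ _ _ _ _ _))); lambda_side.
Qed.

Lemma r13E : lambda_root ((34194%:R / 10 ^+ 6) -i* (63236%:R / 10 ^+ 6)) [:: 4228250625%:R; 0; 18810887175%:R; 0; 36065983311%:R; 0; 203997780%:R; 0; 960400%:R] = fval R13.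
Proof.
apply: (@lambda_root_fval R _ _ _ (34194%:R / 10 ^+ 6) (- (63236%:R / 10 ^+ 6)) _ 1000000 34194 (-63236) [:: 4228250625; 0; 18810887175; 0; 36065983311; 0; 203997780; 0; 960400]%ZZ _ _ _ _ _ _ _ _ _ (val_nu_mul (val_cx R _ _ _ _ _ _ _ _))); lambda_side.
Qed.

Lemma r22E : lambda_root ((- 1561%:R / 10 ^+ 4) +i* (1682%:R / 10 ^+ 4)) [:: 2601%:R; 4896%:R; 18981%:R; 5700%:R; 925] = fval R22.
Proof.
apply: (@lambda_root_fval R _ _ _ (- 1561%:R / 10 ^+ 4) (1682%:R / 10 ^+ 4) _ 10000 (-1561) 1682 [:: 2601; 4896; 18981; 5700; 925]%ZZ _ _ _ _ _ _ _ _ _ (val_cx _ _ _ _ _ _ _ _ _)); lambda_side.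
Qed.

Lemma r23E : lambda_root ((- 1561%:R / 10 ^+ 4) -i* (1682%:R / 10 ^+ 4)) [:: 2601%:R; 4896%:R; 18981%:R; 5700%:R; 925] = fval R23.
Proof.
apply: (@lambda_root_fval R _ _ _ (- 1561%:R / 10 ^+ 4) (- (1682%:R / 10 ^+ 4)) _ 10000 (-1561) (-1682) [:: 2601; 4896; 18981; 5700; 925]%ZZ _ _ _ _ _ _ _ _ _ (val_cx _ _ _ _ _ _ _ _ _)); lambda_side.
Qed.

Lemma real_form (x : R) : x%:C = x +i* 0. Proof. by []. Qed.

Lemma r21_lambda : lambda_root (3277%:R / 10 ^+ 4) [:: 2601%:R; 0; 885; 0; -125] = fval R21.
Proof.
apply: (@lambda_root_fval R _ _ _ (3277%:R / 10 ^+ 4) 0 _ 10000 3277 0 [:: 2601; 0; 885; 0; -125]%ZZ _ _ _ _ _ _ _ _ _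
   (val_nu_mul (val_cx R 163 33 0 0 0 0 0 0))); try lambda_side.
by rewrite -real_form rmorphM fmorphV rmorphXn !rmorph_nat.
Qed.

Lemma r24_lambda : lambda_root (- 7717%:R / 10 ^+ 5) [:: 65025%:R; 0; 1149168%:R; 0; - 6845%:R] = fval R24.
Proof.
have e : code_val R (kopp nu) = (- snu) +i* 0.
  by rewrite (repN (val_represents R)) val_nu; simpc.
apply: (@lambda_root_fval R _ _ _ (- 7717%:R / 10 ^+ 5) 0 _ 100000 (-7717) 0 [:: 65025; 0; 1149168; 0; -6845]%ZZ _ _ _ _ _ _ _ _ _ e); try lambda_side.
by rewrite -real_form rmorphM fmorphV rmorphXn rmorphN !rmorph_nat.
Qed.
End Constants.

Definition fmul (x y : fraction) : fraction := (Z.mul x.1 y.1, kmul x.2 y.2).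
Definition fint (n : Z) : fraction := (1%ZZ, kz n).
Definition feqb (x y : fraction) : bool :=
  [&& ~~ Z.eqb x.1 0, ~~ Z.eqb y.1 0 &
      is_zero (kadd (kmul (kz y.1) x.2) (kopp (kmul (kz x.1) y.2)))].
Definition omA : fraction := (2%ZZ, cx (f4 (-1) 0 0 0) (f4 1 0 0 0)).
Definition omA2 : fraction := (2%ZZ, cx (f4 (-1) 0 0 0) (f4 (-1) 0 0 0)).

Section Gammas.
Variable R : realType.
Local Notation C := R[i].
Local Open Scope complex_scope.
Local Notation s21 := (sqrt21 R).
Local Notation s3 := (s3 R).
Local Notation sbeta := (sbeta R).
Local Notation snu := (snu R).
Local Notation fval := (fval R).

Lemma fval_mul x y : fval (fmul x y) = fval x * fval y.
Proof.
by rewrite /fval /= (repM (val_represents R)) (repM (integer_represents C)) invfM mulrACA.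
Qed.

Lemma fval_int n : fval (fint n) = intval C n.
Proof. by rewrite /fval /= (rep_int (val_represents R)) intval_1 divr1. Qed.

Lemma feqP x y : feqb x y -> fval x = fval y.
Proof.
have rv := val_represents R; move=> /and3P[hx hy h].
have := rep_zero rv h; rewrite (repD rv) (repN rv) !(repM rv) !(rep_int rv) => /eqP.
rewrite -/(intval C x.1) -/(intval C y.1) subr_eq0 => /eqP E.
by apply/eqP; rewrite eqr_div ?intval_neq0 // mulrC E mulrC.
Qed.

Lemma sqrtc_Re_ge0 (z : C) : 0 <= complex.Re (sqrtc z).
Proof.
by case: z => a b; exact: sqrtr_ge0.
Qed.

Lemma sqrtc_eq (z t : C) : t ^+ 2 = z -> 0 < complex.Re t -> sqrtc z = t.
Proof.
move=> tz t0; have := sqr_sqrtc z; rewrite -{2}tz => /eqP; rewrite eqf_sqr.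
case/orP => /eqP // e; have := sqrtc_Re_ge0 z; rewrite e raddfN /=.
by rewrite oppr_ge0 leNgt t0.
Qed.

Lemma sqrtr_eq (x y : R) : 0 <= x -> x * x = y -> Num.sqrt y = x.
Proof. by move=> x0 <-; rewrite -expr2 sqrtr_sqr ger0_norm. Qed.

Lemma fval_cx d a b c e a' b' c' e' : fval (d, cx (f4 a b c e) (f4 a' b' c' e')) =
  ((intval R a + intval R b * s21 + (intval R c + intval R e * s21) * sbeta) / intval R d)
  +i* ((intval R a' + intval R b' * s21 + (intval R c' + intval R e' * s21) * sbeta) * s3 / intval R d).
Proof. exact: fval_form (val_cx _ _ _ _ _ _ _ _ _). Qed.

Lemma fval_xc d a b c e a' b' c' e' : fval (d, xc (f4 a b c e) (f4 a' b' c' e')) =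
  ((intval R a + intval R b * s21 + (intval R c + intval R e * s21) * sbeta) * s3 / intval R d)
  +i* ((intval R a' + intval R b' * s21 + (intval R c' + intval R e' * s21) * sbeta) / intval R d).
Proof. exact: fval_form (val_xc _ _ _ _ _ _ _ _ _). Qed.

Lemma gamma_A_fval : gamma_A R = fval gamA.
Proof.
have [h1 h2 h3 _] := bounds_all R.
have s0 : Num.sqrt (2 * (s21 - 3)) = sbeta * s3 / 3.
  apply: sqrtr_eq; first by apply: divr_ge0 => //; apply: mulr_ge0; exact: sqrtr_ge0.
  have -> : sbeta * s3 / 3 * (sbeta * s3 / 3) = (sbeta * sbeta) * (s3 * s3) / 9 by field.
  by rewrite sqr_sbeta sqr_s3; field.
have E : fval (fmul (fint 2) gamA) ^+ 2 = (1 - s21) -i* Num.sqrt (2 * (s21 - 3)).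
  rewrite s0 expr2 -fval_mul.
  rewrite (@feqP _ (3%ZZ, cx (f4 3 (-3) 0 0) (f4 0 0 (-1) 0))) //.
  rewrite fval_cx !intval_binary; congr (_ +i* _); by field.
rewrite /gamma_A (sqrtc_eq E).
  rewrite fval_mul fval_int mulrC mulKf ?intval_xO ?intval_1 ?mulr1 ?pnatr_eq0 //.
rewrite fval_mul fval_int intval_real fval_xc; simpc.
have -> : intval R 24 = 24%:R by rewrite (intval_nat R 24).
by rewrite /= !intval_binary; have := mul_bounds _ _ h1 h3; lra.
Qed.

Lemma gamma_B_fval : gamma_B R = fval gamB.
Proof.
have [h1 h2 h3 h4] := bounds_all R.
have s0 : Num.sqrt ((9 + 19 * s21) / 2) = sbeta * s3 * (11 + s21) / 12.
  apply: sqrtr_eq.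
    by apply: divr_ge0 => //; apply: mulr_ge0; [apply: mulr_ge0; exact: sqrtr_ge0|lra].
  have -> : sbeta * s3 * (11 + s21) / 12 * (sbeta * s3 * (11 + s21) / 12) =
    (sbeta * sbeta) * (s3 * s3) * (11 + s21) ^+ 2 / 144 by field.
  rewrite sqr_sbeta sqr_s3; apply/eqP; rewrite -subr_eq0.
  have -> : (6 * s21 - 18) * 3 * (11 + s21) ^+ 2 / 144 - (9 + 19 * s21) / 2 =
    (s21 * s21 - 21) * (s21 + 19) / 8 by field.
  by rewrite sqr_s21 subrr mul0r mul0r.
have E : fval gamB ^+ 2 = (- (19 / 20) + s21 / 20) -i* (Num.sqrt ((9 + 19 * s21) / 2) / 10).
  rewrite s0 expr2 -fval_mul.
  rewrite (@feqP _ (120%ZZ, cx (f4 (-114) 6 0 0) (f4 0 0 (-11) (-1)))) //.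
  by rewrite fval_cx !intval_binary; congr (_ +i* _); field.
rewrite /gamma_B; apply: (sqrtc_eq E).
have F := fval_form 188700 (val_nu_mul (val_xc R 1019 229 0 0 0 0 (-1457) (-312))).
rewrite [fval gamB]F.
have d0 : 0 < intval R 188700 by have := intval_ltZ R (erefl : Z.ltb 0 188700); rewrite intval_0.
have -> : forall x y : R, complex.Re (x +i* y) = x by [].
apply: divr_gt0 d0; rewrite !intval_binary.
have p3 : 0 < s3 by lra.
have p4 : 0 < snu by lra.
by apply: (mulr_gt0 p4); apply: mulr_gt0 p3; lra.
Qed.

Lemma B132_fval : ((3 + s21) / 6)%:C = fval B132.
Proof.
rewrite (@fval_cx 6 3 1 0 0 0 0 0 0) !intval_binary real_form.
by congr (_ +i* _); field.
Qed.

Lemma r11_fval : r11 R = fval R11.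
Proof.
rewrite (@fval_cx 51 33 (-8) 0 0 0 0 0 0) !intval_binary /r11 real_form.
by congr (_ +i* _); field.
Qed.

Lemma r14_fval : r14 R = fval R14.
Proof.
rewrite (@fval_cx 2550 (-2049) 659 0 0 0 0 0 0) /r14 real_form !intval_neg.
rewrite (_ : intval R 2550 = 2550%:R); last by rewrite (intval_nat R 2550).
rewrite (_ : intval R 2049 = 2049%:R); last by rewrite (intval_nat R 2049).
rewrite (_ : intval R 659 = 659%:R); last by rewrite (intval_nat R 659).
rewrite intval_0 !mul0r !addr0 !mul0r addr0; congr (_ / _ +i* _).
  by rewrite addrC.
by rewrite addr0 !mul0r.
Qed.

Definition value_table (a b c d e f : C) : seq (nat * nat * nat * C) :=
  [:: ((1, 1, 2)%N, a); ((1, 2, 2)%N, b); ((1, 1, 3)%N, c);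
      ((2, 2, 3)%N, d); ((1, 2, 3)%N, e); ((1, 3, 2)%N, f)].

Lemma value_table_eq a b c d e f a' b' c' d' e' f' :
  a = a' -> b = b' -> c = c' -> d = d' -> e = e' -> f = f' ->
  value_table a b c d e f = value_table a' b' c' d' e' f'.
Proof. by move=> -> -> -> -> -> ->. Qed.

Lemma A_values_fval : A_values R =
  value_table (fval A112) (fval A122) (fval A113) (fval A113) (fval A123) (fval A132).
Proof.
exact: (value_table_eq (A112E R) (A122E R) (A113E R) (A113E R) (A123E R) (A132E R)).
Qed.

Lemma B_values_fval : B_values R =
  value_table (fval B112) (fval B122) (fval B113) (fval B113) (fval B123) (fval B132).
Proof.
exact: (value_table_eq (B112E R) (B122E R) (B113E R) (B113E R) (B123E R) B132_fval).
Qed.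

Lemma cisD (a b : R) : cis a * cis b = cis (a + b).
Proof. by rewrite /cis cosD sinD; simpc; rewrite addrC [in X in _ +i* X]addrC. Qed.

Lemma omega_A_fval : omega_A R = fval omA.
Proof.
have w3 : omega_A R ^+ 3 = 1.
  rewrite !exprS expr0 mulr1 /omega_A !cisD.
  have -> : 2 * pi / 3 + (2 * pi / 3 + 2 * pi / 3) = pi + pi :> R by field.
  by rewrite -cisD /cis cospi sinpi; simpc; rewrite ?mulNr ?mul1r ?opprK.
have im0 : 0 < complex.Im (omega_A R).
  by apply: sin_gt0_pi; have := pi_gt0 R; lra.
have w1 : omega_A R != 1.
  by apply/negP => /eqP e; rewrite e /= ltxx in im0.
have : (omega_A R - 1) * (omega_A R * omega_A R + omega_A R + 1) = 0.
  have -> : forall w : C, (w - 1) * (w * w + w + 1) = w ^+ 3 - 1 by move=> w; ring.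
  by rewrite w3 subrr.
move=> /eqP; rewrite mulf_eq0 subr_eq0 (negbTE w1) orFb.
move: im0; case: (omega_A R) => x y /= y0; simpc => /eqP[e1 e2].
have x_val : x = - 1 / 2.
  have y1 : y != 0 by rewrite gt_eqF.
  by apply: (mulIf y1); lra.
have y_val : y = s3 / 2.
  have yy : (2 * y) * (2 * y) = 3 by rewrite x_val in e1; lra.
  have h : Num.sqrt 3 = 2 * y by apply: sqrtr_eq yy; lra.
  by rewrite -[s3]/(Num.sqrt 3) h; field.
rewrite (@fval_cx 2 (-1) 0 0 0 1 0 0 0) !intval_binary x_val y_val.
by congr (_ +i* _); field.
Qed.

Lemma sigma_A_fval : (sigma_A R)^-1 = fval omA.
Proof.
have e : sigma_A R = omega_A R * omega_A R.
  by rewrite cisD /sigma_A; congr cis; field.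
have w3 : fval (fmul omA (fmul omA omA)) = 1.
  by rewrite (@feqP _ (fint 1)) // fval_int intval_1.
have c0 : fval omA != 0.
  apply/eqP => z; have := w3; rewrite fval_mul z mul0r => /eqP.
  by rewrite eq_sym oner_eq0.
rewrite e omega_A_fval; apply: (mulIf c0); apply: (mulIf c0).
have c2 : fval omA * fval omA != 0 by exact: mulf_neq0.
by rewrite -mulrA (mulVf c2) -mulrA -!fval_mul w3.
Qed.

End Gammas.

Close Scope ring_scope.

(** * Harmonic functions on the walks of the graph 2221 *)

(** An enumerated copy of the vertices, on which walks are computed: the centre,
   the neighbours [VU0], ..., [VU3] of the centre and the ends of the long arms. *)
Inductive vtx := VC | VU0 | VU1 | VU2 | VU3 | VE0 | VE1 | VE2.

Definition veq (a b : vtx) : bool :=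
  match a, b with
  | VC, VC | VU0, VU0 | VU1, VU1 | VU2, VU2 | VU3, VU3 | VE0, VE0 | VE1, VE1 | VE2, VE2 => true
  | _, _ => false
  end.

Lemma veqP : Equality.axiom veq.
Proof. by do 2!case; constructor. Qed.
HB.instance Definition _ := hasDecEq.Build vtx veqP.

Definition all_vtx := [:: VC; VU0; VU1; VU2; VU3; VE0; VE1; VE2].

Definition nbrs (v : vtx) : seq vtx :=
  match v with
  | VC => [:: VU0; VU1; VU2; VU3]
  | VU0 => [:: VC; VE0] | VU1 => [:: VC; VE1] | VU2 => [:: VC; VE2] | VU3 => [:: VC]
  | VE0 => [:: VU0] | VE1 => [:: VU1] | VE2 => [:: VU2]
  end.

Definition adj (v w : vtx) : bool := has (veq w) (nbrs v).

Definition is_even (v : vtx) := match v with VC | VE0 | VE1 | VE2 => true | _ => false end.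

Lemma adj_sym : symmetric adj. Proof. by do 2!case. Qed.
Lemma adj_even v w : adj v w -> is_even w = ~~ is_even v. Proof. by case: v; case: w. Qed.
Lemma mem_nbrs v w : (w \in nbrs v) = adj v w. Proof. by case: v; case: w. Qed.

Fixpoint walks (n : nat) (v : vtx) : seq (seq vtx) :=
  if n is n.+1 then flatten [seq [seq v :: p | p <- walks n w] | w <- nbrs v]
  else [:: [:: v]].

(** The starting point is not repeated at the end. *)
Definition loops (n : nat) v := [seq p <- walks n.-1 v | adj (last v p) v].

(** How a vanishing sum over the neighbours x of w is used to eliminate a walk
   ... w v w ...: around u0, u1 and u2 the end of the arm is replaced by the
   centre, around the centre u0 is replaced by the three other neighbours, and the
   single term around u3 vanishes. The result is the sign-changed sum over the
   listed vertices. *)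
Definition local_rule (w v : vtx) : option (seq vtx) :=
  match w, v with
  | VU0, VE0 | VU1, VE1 | VU2, VE2 => Some [:: VC]
  | VC, VU0 => Some [:: VU1; VU2; VU3]
  | VU3, VC => Some [::]
  | _, _ => None
  end.

Lemma rw_adj w v L : local_rule w v = Some L -> all (adj w) L.
Proof. by case: w => //; case: v => // -[<-]. Qed.

Fixpoint reduce_step (p : seq vtx) : option (seq (seq vtx)) :=
  if p is x :: p1 then
    let rec := omap (map (cons x)) (reduce_step p1) in
    if p1 is y :: z :: r then
      if veq x z then
        if local_rule x y is Some L then Some [seq [:: x, v, z & r] | v <- L] else rec
      else rec
    else rec
  else None.

(** The booleans record signs. The reduction is sound for every depth [n]. *)
Fixpoint reduce (n : nat) (p : seq vtx) : seq (bool * seq vtx) :=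
  if n is n.+1 then
    if reduce_step p is Some L then
      flatten [seq [seq (~~ x.1, x.2) | x <- reduce n q] | q <- L]
    else [:: (false, p)]
  else [:: (false, p)].

Fixpoint seq_veq (p q : seq vtx) : bool :=
  match p, q with
  | [::], [::] => true
  | x :: p, y :: q => veq x y && seq_veq p q
  | _, _ => false
  end.

Lemma seq_veqP p q : seq_veq p q -> p = q.
Proof. by elim: p q => [|x p IH] [|y q] //= /andP[/veqP -> /IH ->]. Qed.

Section Harmonic.
Variable F : comNzRingType.
Local Open Scope ring_scope.

Definition is_walk (n : nat) (v : vtx) (p : seq vtx) : bool := [&& sorted adj p, size p == n & last v p == v].

(** The functions of walks ending at v that are killed by all caps, when the weights
   of the caps are 1. *)
Definition harmonic (n : nat) (v : vtx) (f : seq vtx -> F) : Prop := forall l w r,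
  is_walk n v (l ++ w :: r) -> \sum_(x <- nbrs w) f (l ++ [:: w, x, w & r]) = 0.

Lemma is_walk_ins n v l w x r :
  is_walk n v (l ++ w :: r) -> adj w x -> is_walk n.+2 v (l ++ [:: w, x, w & r]).
Proof.
rewrite /is_walk !last_cat !size_cat /= !addnS !eqSS => /and3P[s -> ->] wx.
case: l s => [|y l] /= s; first by rewrite wx adj_sym wx s.
by move: s; rewrite !cat_path /= wx [adj x w]adj_sym wx => /and3P[-> -> ->].
Qed.

Lemma is_walk_del n v l w x r :
  is_walk n.+2 v (l ++ [:: w, x, w & r]) -> is_walk n v (l ++ w :: r).
Proof.
rewrite /is_walk !last_cat !size_cat /= !addnS !eqSS => /and3P[s -> ->].
case: l s => [|y l] /=; first by case/and3P => _ _ ->.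
by rewrite !cat_path /= => /and5P[-> -> _ _ ->].
Qed.

Variables (n : nat) (v : vtx) (f : seq vtx -> F).
Hypothesis fh : harmonic n v f.

Lemma harmonic_rw l w x L r : local_rule w x = Some L -> is_walk n v (l ++ w :: r) ->
  f (l ++ [:: w, x, w & r]) = - \sum_(y <- L) f (l ++ [:: w, y, w & r]).
Proof.
move=> e h; have := fh h; move: e {h}.
by case: w => //; case: x => // -[<-]; rewrite !(big_cons, big_nil) ?addr0 => /eqP;
  rewrite ?addr_eq0 ?[_ == - f _]eq_sym ?eqr_oppLR => /eqP // ->; rewrite ?opprK ?oppr0.
Qed.

Lemma harmonic_step p L l : reduce_step p = Some L -> is_walk n.+2 v (l ++ p) ->
  f (l ++ p) = - \sum_(q <- L) f (l ++ q) /\ forall q, q \in L -> is_walk n.+2 v (l ++ q).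
Proof.
elim: p L l => [|x p IH] L l //=.
have rec L' : omap (map (cons x)) (reduce_step p) = Some L' -> is_walk n.+2 v (l ++ x :: p) ->
    f (l ++ x :: p) = - \sum_(q <- L') f (l ++ q) /\ forall q, q \in L' -> is_walk n.+2 v (l ++ q).
  case E : (reduce_step p) => [M|] //= [<-] h.
  have [|e1 e2] := IH _ (rcons l x) E; first by rewrite cat_rcons.
  split; first by rewrite -cat_rcons e1 big_map; congr (- _); apply: eq_bigr => q _; rewrite cat_rcons.
  by move=> _ /mapP[q qM ->]; rewrite -cat_rcons; exact: e2.
case: p rec {IH} => [|y [|z r]] rec; try exact: rec.
case: ifP => [/veqP xz|_]; last exact: rec.
case E : (local_rule x y) => [M|]; last exact: rec.
case=> <-; rewrite -xz => h; have h' := is_walk_del h; split.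
  by rewrite (harmonic_rw E h') big_map.
move=> _ /mapP[q qM ->]; apply: (is_walk_ins h').
exact: (allP (rw_adj E)).
Qed.

Definition signr (b : bool) (x : F) := if b then - x else x.

Lemma harmonic_red m p : is_walk n.+2 v p -> f p = \sum_(x <- reduce m p) signr x.1 (f x.2).
Proof.
elim: m p => [|m IH] p h /=; first by rewrite big_seq1.
case E : (reduce_step p) => [L|]; last by rewrite big_seq1.
have [-> hL] := @harmonic_step p L [::] E h.
rewrite big_flatten big_map /= -sumrN [RHS]big_seq big_seq; apply: eq_bigr => q /hL hq.
rewrite IH // big_map -sumrN; apply: eq_bigr => -[[] x] _ //=; by rewrite opprK.
Qed.

End Harmonic.

Section Rows.
Variable o : ring_code.
Definition formal_sum := seq (seq vtx * o).
Definition signed (b : bool) (x : o) := if b then code_opp x else x.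

Fixpoint fs_insert (p : seq vtx) (x : o) (r : formal_sum) : formal_sum :=
  if r is (q, y) :: r then
    if seq_veq p q then (q, code_add x y) :: r else (q, y) :: fs_insert p x r
  else [:: (p, x)].

Definition fs_addmul (x : o) (r r' : formal_sum) : formal_sum :=
  foldr (fun qy r' => fs_insert qy.1 (code_mul x qy.2) r') r' r.

Definition fs_insert_red (p : seq vtx) (x : o) (r : formal_sum) : formal_sum :=
  foldr (fun bq r => fs_insert bq.2 (signed bq.1 x) r) r (reduce 24 p).

Definition fs_clean (r : formal_sum) : formal_sum := [seq qy <- r | ~~ is_zero qy.2].

Fixpoint fs_get (p : seq vtx) (r : formal_sum) : o :=
  if r is (q, y) :: r then if seq_veq p q then y else fs_get p r else code0 o.

Local Open Scope ring_scope.
Variables (F : comNzRingType) (phi : o -> F) (f : seq vtx -> F).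
Hypothesis rp : represents phi.

Definition fs_val (r : formal_sum) : F := \sum_(qy <- r) phi qy.2 * f qy.1.

Lemma fs_val_insert p x r : fs_val (fs_insert p x r) = phi x * f p + fs_val r.
Proof.
rewrite /fs_val; elim: r => [|[q y] r IH] /=; first by rewrite big_seq1 big_nil addr0.
case: ifP => [/seq_veqP ->|_]; rewrite !big_cons /=.
  by rewrite (repD rp) mulrDl addrA.
by rewrite IH addrCA.
Qed.

Lemma fs_val_addmul x r r' : fs_val (fs_addmul x r r') = phi x * fs_val r + fs_val r'.
Proof.
elim: r => [|[q y] r IH]; first by rewrite /fs_val big_nil mulr0 add0r.
by rewrite /= fs_val_insert IH /fs_val big_cons /= (repM rp) mulrDr mulrA addrA.
Qed.

Lemma phi_signed b x : phi (signed b x) = signr b (phi x).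
Proof. by case: b => //=; rewrite (repN rp). Qed.

Lemma fs_val_insert_red n v p x r : harmonic n v f -> is_walk n.+2 v p ->
  fs_val (fs_insert_red p x r) = phi x * f p + fs_val r.
Proof.
move=> fh hp; rewrite (harmonic_red fh 24 hp) /fs_insert_red mulr_sumr.
elim: (reduce 24 p) => [|[b q] l IH] /=; first by rewrite big_nil add0r.
rewrite fs_val_insert IH big_cons /= addrA phi_signed; congr (_ + _ + _).
by case: b; rewrite /= ?mulrN ?mulNr.
Qed.

Lemma fs_val_clean r : fs_val (fs_clean r) = fs_val r.
Proof.
rewrite /fs_val big_filter [RHS](bigID (fun qy => is_zero qy.2)) /=.
by rewrite [X in _ = X + _]big1 ?add0r // => qy /(rep_zero rp) ->; rewrite mul0r.
Qed.

Lemma fs_val_zero (r : formal_sum) : all (fun qy => is_zero qy.2) r -> fs_val r = 0.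
Proof.
rewrite /fs_val; elim: r => [|qy r IH] /=; first by rewrite big_nil.
by case/andP => /(rep_zero rp) h /IH e; rewrite big_cons h mul0r add0r e.
Qed.

End Rows.

Definition is_end (v : vtx) := match v with VE0 | VE1 | VE2 => true | _ => false end.

Fixpoint has_spike (p : seq vtx) : bool :=
  if p is x :: p1 then
    (if p1 is y :: z :: _ then is_end x && veq x z else false) || has_spike p1
  else false.

(** A piece e u e at the end e of an arm makes a harmonic function vanish, because e
   has a single neighbour; but the normal form of such a walk need not be zero.
   These normal forms are the relations that the local rules leave out. *)
Definition spike_relations v : seq (formal_sum integer_code) :=
  [seq fs_clean (@fs_insert_red integer_code p 1%ZZ [::]) |
     p <- [seq rcons p v | p <- loops 8 v] & has_spike p].

(** The multiple - c x of the pivot row clears the entry c when the pivot x is 1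
   or -1. *)
Definition eliminate_in (p : seq vtx) (x : Z) (r r' : formal_sum integer_code) :=
  let c := fs_get p r' in
  if is_zero c then r' else fs_clean (fs_addmul (o := integer_code) (Z.opp (Z.mul c x)) r r').

Fixpoint gauss (n : nat) (rs : seq (formal_sum integer_code)) : seq (formal_sum integer_code) :=
  if n is n.+1 then
  match rs with
  | [::] => [::]
  | [::] :: rs => gauss n rs
  | ((p, x) :: _) as r :: rs => r :: gauss n [seq eliminate_in p x r r' | r' <- rs]
  end else [::].

Fixpoint eliminate (rs : seq (formal_sum integer_code)) (D : formal_sum KC) : formal_sum KC :=
  match rs with
  | [::] => D
  | r :: rs =>
    eliminate rs (match r with
     | [::] => D
     | (p, x) :: _ => let c := fs_get p D in if is_zero c then D else
         fs_addmul (kopp (kmul c (kz x))) [seq (qy.1, kz qy.2) | qy <- r] D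
    end)
  end.

Section Elimination.
Variables (R : realType) (f : seq vtx -> R[i]%C).
Local Open Scope ring_scope.
Local Notation C := R[i]%C.
Local Notation ival := (fs_val (o := integer_code) (@intval C) f).
Local Notation kval := (fs_val (o := KC) (@code_val R) f).

Definition vanish (rs : seq (formal_sum integer_code)) := {in rs, forall r, ival r = 0}.

Lemma vanish_gauss n rs : vanish rs -> vanish (gauss n rs).
Proof.
elim: n rs => [|n IH] // [|[|[p x] r] rs] //= h; first by apply: IH => q qrs; apply: h; rewrite inE qrs orbT.
set r1 := (p, x) :: r in h *.
have h1 : ival r1 = 0 by apply: h; rewrite inE eqxx.
move=> q; rewrite inE => /orP[/eqP -> //|]; apply: IH => _ /mapP[r' r'rs ->].
have h2 : ival r' = 0 by apply: h; rewrite inE r'rs orbT.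
rewrite /eliminate_in; case: ifP => // _.
by rewrite (fs_val_clean _ (integer_represents C)) (fs_val_addmul _ (integer_represents C)) h1 h2 mulr0 addr0.
Qed.

Lemma kval_int r : kval [seq (qy.1, kz qy.2) | qy <- r] = ival r.
Proof.
by rewrite /fs_val big_map; apply: eq_bigr => qy _; rewrite (rep_int (val_represents R)).
Qed.

Lemma fs_val_eliminate rs D : vanish rs -> kval (eliminate rs D) = kval D.
Proof.
elim: rs D => [|r rs IH] D h //=; rewrite IH; last by move=> q qrs; apply: h; rewrite inE qrs orbT.
case: r h => [|[p x] r] // h; case: ifP => // _.
have e := kval_int ((p, x) :: r).
rewrite (fs_val_addmul _ (val_represents R)) e h ?inE ?eqxx //.
by rewrite mulr0 add0r.
Qed.

Lemma spike_zero n v p l : harmonic n v f -> is_walk n.+2 v (l ++ p) -> has_spike p -> f (l ++ p) = 0.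
Proof.
move=> fh; elim: p l => [|x p IH] l // h /orP[|]; last by rewrite -cat_rcons; apply: IH; rewrite cat_rcons.
case: p h {IH} => [|y [|z r]] // h /andP[xe /veqP xz]; rewrite -xz in h *.
have h' := is_walk_del h; have := fh _ _ _ h'.
have xy : adj x y.
  by case/and3P: h => s _ _; move: s; case: (l) => [|w l'] /=; rewrite ?cat_path /= => /andP[] // _ /and3P[].
by move: xe xy; case: (x) => //; case: (y) => // _ _; rewrite big_seq1.
Qed.

Lemma vanish_spike_relations n v : harmonic n v f ->
  (forall p, p \in [seq rcons p v | p <- loops 8 v] -> is_walk n.+2 v p) -> vanish (spike_relations v).
Proof.
move=> fh hl r /mapP[p]; rewrite mem_filter => /andP[sp /hl hp] ->.
rewrite (fs_val_clean _ (integer_represents C)) (fs_val_insert_red (integer_represents C) _ _ fh hp).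
by rewrite (@spike_zero _ _ p [::] fh hp sp) mulr0 /fs_val big_nil addr0.
Qed.

End Elimination.

Open Scope Z_scope.
(** * The generators and the relations in coordinates *)

(** 6 times the dimensions, normalised by dim c = 1 *)
Definition dim6 (v : vtx) : KC :=
  match v with
  | VC => cx (f4 6 0 0 0) f0
  | VE0 | VE1 | VE2 => cx (f4 (-3) 1 0 0) f0
  | VU3 => xc (f4 (-3) 1 0 0) f0
  | _ => xc (f4 2 0 0 0) f0
  end.
(** The inverses of the dimensions, times 2 for even and 6 for odd vertices: the
   dimensions of the odd vertices are multiples of sqrt 3 by elements of Q(sqrt 21). *)
Definition inv_dim (v : vtx) : KC :=
  match v with
  | VC => cx (f4 2 0 0 0) f0
  | VE0 | VE1 | VE2 => cx (f4 3 1 0 0) f0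
  | VU3 => xc (f4 3 1 0 0) f0
  | _ => xc (f4 6 0 0 0) f0
  end.
Definition dimF (v : vtx) : fraction := (6, dim6 v).

(** [tab] gives the values on the words up to cyclic permutation, [rotF] and [rot2F]
   the eigenvalue of the rotation and its square, [rot_num] and [rot2_num] the
   doubles of these, which have integer coordinates, and [denom] a common
   denominator of the values on the words. *)
Record generator := Generator {
  tab : vtx -> vtx -> vtx -> option fraction;
  rotF : fraction;
  rot2F : fraction;
  rot_num : KC;
  rot2_num : KC;
  denom : Z }.

Definition A_tab (x y z : vtx) : option fraction :=
  match x, y, z with
  | VU1, VU1, VU2 => Some A112 | VU1, VU2, VU2 => Some A122
  | VU1, VU1, VU3 | VU2, VU2, VU3 => Some A113
  | VU1, VU2, VU3 => Some A123 | VU1, VU3, VU2 => Some A132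
  | _, _, _ => None
  end.
Definition B_tab (x y z : vtx) : option fraction :=
  match x, y, z with
  | VU1, VU1, VU2 => Some B112 | VU1, VU2, VU2 => Some B122
  | VU1, VU1, VU3 | VU2, VU2, VU3 => Some B113
  | VU1, VU2, VU3 => Some B123 | VU1, VU3, VU2 => Some B132
  | _, _, _ => None
  end.

Definition genA := Generator A_tab omA omA2 omA.2 omA2.2 144.
Definition genB := Generator B_tab (fint 1) (fint 1) (kz 2) (kz 2) 720.

(** The numerator of x over the denominator n, when the division is exact *)
Definition over (n : Z) (x : fraction) : KC := code_div (kmul (kz n) x.2) x.1.

Definition letters := [:: VU1; VU2; VU3].
Definition triples : seq (vtx * vtx * vtx) :=
  [seq (xy, z) | xy <- [seq (x, y) | x <- letters, y <- letters], z <- letters].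
Definition word (t : vtx * vtx * vtx) : seq vtx := [:: VC; t.1.1; VC; t.1.2; VC; t.2].

Section Table.
Variable X : generator.
(** The value on a word of the lowest weight vector in the gauge of [tilde]: the
   factors sqrt (d_{a3} / d_{a1}) of the definition become d_{a2} d_{a3}. *)
Definition cyc_value x y z : option fraction :=
  omap (fun t => fmul (fmul (dimF y) (dimF z)) t) (tab X x y z).
Definition word_value (t : vtx * vtx * vtx) : fraction :=
  let: (x, y, z) := t in
  if cyc_value x y z is Some t then t
  else if cyc_value z x y is Some t then fmul (rotF X) t
  else if cyc_value y z x is Some t then fmul (rot2F X) t
  else fint 0.
Definition words : formal_sum KC := [seq (rcons (word t) VC, over (denom X) (word_value t)) | t <- triples].
Definition words_ok : bool :=
  all (fun t => feqb (1, over (denom X) (word_value t)) (fmul (fint (denom X)) (word_value t))) triples.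
End Table.

Definition wordsA : formal_sum KC := Eval vm_compute in words genA.
Definition wordsB : formal_sum KC := Eval vm_compute in words genB.

Section Values.
Variables (X : generator) (wd : formal_sum KC).
(** A loop based at the centre reduces to words by harmonicity. *)
Definition center_value (g : seq vtx) : KC :=
  foldr (fun bq t => kadd (signed bq.1 (fs_get bq.2 wd)) t) k0 (reduce 24 (rcons g VC)).

(** Twice the value on a loop based at an even vertex. A rotation brings the centre
   to the first place; a loop that avoids the centre stays at the end of an arm,
   where the value vanishes. *)
Definition even_value (g : seq vtx) : KC :=
  if veq (nth VE0 g 0) VC then kmul (kz 2) (center_value g)
  else if veq (nth VE0 g 2) VC then kmul (rot2_num X) (center_value (rot 2 g))
  else if veq (nth VE0 g 4) VC then kmul (rot_num X) (center_value (rot 4 g))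
  else k0.

(** 4 times the value. The loops based at odd vertices carry the dual generator, a
   rotation by one step of the generator itself. *)
Definition loop_value (g : seq vtx) : KC :=
  if is_even (nth VE0 g 0) then kmul (kz 2) (even_value g)
  else kmul (rot_num X) (even_value (rot 1 g)).

Definition inv_dims (g : seq vtx) (x : KC) : KC := foldr (fun v t => kmul (inv_dim v) t) x g.
Definition hat_value (g : seq vtx) : KC := inv_dims g (loop_value g).
End Values.

Definition center_ok (wd : formal_sum KC) : bool :=
  all (fun g => all (fun bq => has (fun kx => seq_veq bq.2 kx.1) wd) (reduce 24 (rcons g VC))) (loops 6 VC).

Definition generator_ok (X : generator) (wd : formal_sum KC) : bool :=
  [&& feqb (2, rot_num X) (rotF X), feqb (2, rot2_num X) (rot2F X),
      feqb (fmul (rotF X) (rot2F X)) (fint 1), feqb (fmul (rotF X) (rotF X)) (rot2F X),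
      words_ok X & center_ok wd].

Record equation := Equation { eJ : fraction; eaa : fraction; eab : fraction; eba : fraction; ebb : fraction }.
Definition equation_A :=
  Equation gamA (fmul R11 (fmul gamA gamA)) (fmul R12 (fmul gamA gamB))
    (fmul R13 (fmul gamA gamB)) (fmul R14 (fmul gamB gamB)).
Definition equation_B :=
  Equation gamB (fmul R21 (fmul gamA gamA)) (fmul R22 (fmul gamA gamB))
    (fmul R23 (fmul gamA gamB)) (fmul R24 (fmul gamB gamB)).

(** With N hat A and 5 N hat B in place of A and B, where N is [num_scale], the
   factors 25, 5, 5 and 1 give all terms of the right-hand side the common factor
   25 N^2, and sJ does the same for the left-hand side. The factor m, conj gamma_A
   or nu, simplifies the coefficients. *)
Definition scaled (m : fraction) (sJ : Z) (q : equation) : equation :=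
  Equation (fmul m (fmul (fint sJ) (eJ q))) (fmul m (fmul (fint 25) (eaa q)))
    (fmul m (fmul (fint 5) (eab q))) (fmul m (fmul (fint 5) (eba q))) (fmul m (ebb q)).

Record cleared := Cleared { cJ : KC; caa : KC; cab : KC; cba : KC; cbb : KC }.
Definition clear (M : Z) (q : equation) : cleared :=
  Cleared (over M (eJ q)) (over M (eaa q)) (over M (eab q)) (over M (eba q)) (over M (ebb q)).
Definition clear_ok (M : Z) (q : equation) (c : cleared) : bool :=
  [&& feqb (1, cJ c) (fmul (fint M) (eJ q)), feqb (1, caa c) (fmul (fint M) (eaa q)),
      feqb (1, cab c) (fmul (fint M) (eab q)), feqb (1, cba c) (fmul (fint M) (eba q)) &
      feqb (1, cbb c) (fmul (fint M) (ebb q))].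
Definition conjF (x : fraction) : fraction := (x.1, conjK x.2).
Definition nuF : fraction := (1, nu).
Definition num_scale : Z := 144 * 4 * 1728.
Definition scaledA := scaled (conjF gamA) (25 * num_scale) equation_A.
Definition scaledB := scaled nuF (5 * num_scale) equation_B.
Definition clearedA := Eval vm_compute in clear 61200 scaledA.
Definition clearedB := Eval vm_compute in clear 1040400 scaledB.
Section Check.
Variables (v0 : vtx).
Definition hA := hat_value genA wordsA.
Definition hB := hat_value genB wordsB.
Definition halfs := walks 4 v0.
Definition mids (l : seq vtx) := [seq a <- nbrs v0 | adj a (nth VC l 4)].
(** In the state sum of S o T the two boxes share the vertices v0, a and the middle
   vertex of the bottom walk, whose two halves are l and the reverse of r. *)
Definition left_loop (l : seq vtx) a := [:: v0; a; nth VC l 4; nth VC l 3; nth VC l 2; nth VC l 1].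
Definition right_loop (l : seq vtx) a := [:: v0; nth VC l 1; nth VC l 2; nth VC l 3; nth VC l 4; a].
Definition left_table : seq (seq vtx * seq (KC * KC)) :=
  [seq (l, [seq (hA (left_loop l a), hB (left_loop l a)) | a <- mids l]) | l <- halfs].
Definition right_table : seq (seq vtx * seq (KC * KC * KC)) :=
  [seq (l, [seq (hA (right_loop l a), hB (right_loop l a), dim6 a) | a <- mids l]) | l <- halfs].
Section Q.
Variables (c : cleared) (h : seq vtx -> KC).
Definition apply_matrix (x : KC * KC * KC) : KC * KC :=
  let: (a, b, d) := x in
  (kmul d (kadd (kmul (caa c) a) (kmul (cab c) b)), kmul d (kadd (kmul (cba c) a) (kmul (cbb c) b))).
Definition right_applied (tb : seq (seq vtx * seq (KC * KC * KC))) :=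
  [seq (lx.1, map apply_matrix lx.2) | lx <- tb].
Definition dot (s u : seq (KC * KC)) : KC :=
  foldr (fun x t => kadd (kmul x.1.1 x.2.1) (kadd (kmul x.1.2 x.2.2) t)) k0 (zip s u).
Definition join (l r : seq vtx) := l ++ behead (rev r).
Definition circ_term (s u : seq vtx * seq (KC * KC)) (D : formal_sum KC) : formal_sum KC :=
  if veq (nth VC s.1 4) (nth VC u.1 4) then
    let x := dot s.2 u.2 in if is_zero x then D else fs_insert_red (join s.1 u.1) (kopp x) D
  else D.
Definition circ_part (ts tu : seq (seq vtx * seq (KC * KC))) (D : formal_sum KC) : formal_sum KC :=
  foldr (fun s D => foldr (fun u D => circ_term s u D) D tu) D ts.
(** The bottom walk of j(S): the loop of S read backwards, surrounded by the arc. *)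
Definition jpath (g : seq vtx) :=
  [:: v0; nth VC g 0; nth VC g 5; nth VC g 4; nth VC g 3; nth VC g 2; nth VC g 1; nth VC g 0; v0].
Definition jcoef (g : seq vtx) : KC :=
  kmul (kmul (cJ c) (kmul (kz (if is_even (nth VC g 0) then 3 else 1)) (inv_dim (nth VC g 0)))) (h g).
Definition jloops := flatten [seq loops 6 v | v <- nbrs v0].
Definition j_part : formal_sum KC :=
  foldr (fun g D => fs_insert_red (jpath g) (jcoef g) D) [::] jloops.
(** The difference of the two sides of a relation, a formal sum of walks, reduces to
   zero modulo the local rules and the spikes. *)
Definition check_equation : bool :=
  all (fun kx => is_zero kx.2) (eliminate (gauss 100 (spike_relations v0))
    (circ_part left_table (right_applied right_table) j_part)).
End Q.
End Check.

Definition rev_loop (g : seq vtx) : seq vtx := if g is x :: g then x :: rev g else [::].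
Definition trace_num : KC :=
  foldr (fun g t => kadd (kmul (inv_dims g (loop_value genA wordsA g)) (loop_value genA wordsA (rev_loop g))) t) k0 (loops 6 VE0).
Close Scope Z_scope.

(** * Soundness of the computation *)

Lemma wordsAE : wordsA = words genA. Proof. by vm_compute. Qed.
Lemma wordsBE : wordsB = words genB. Proof. by vm_compute. Qed.
Lemma genA_ok : generator_ok genA wordsA. Proof. by vm_compute. Qed.
Lemma genB_ok : generator_ok genB wordsB. Proof. by vm_compute. Qed.
Lemma clearedA_ok : clear_ok 61200 scaledA clearedA. Proof. by vm_compute. Qed.
Lemma clearedB_ok : clear_ok 1040400 scaledB clearedB. Proof. by vm_compute. Qed.
Lemma check_A v : check_equation v clearedA hA. Proof. by case: v; vm_compute. Qed.
Lemma check_B v : check_equation v clearedB hB. Proof. by case: v; vm_compute. Qed.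
Lemma trace_ok : feqb (fmul (fmul gamA gamA)
    ((4 * 1728 * 576 * 576)%ZZ, kmul (kmul (inv_dim VE0) (inv_dim VE0)) trace_num))
  (1%ZZ, xc (f4 9 2 0 0) f0).
Proof. by vm_compute. Qed.

#[local] Opaque feqb fmul words kmul kadd kopp code_int reduce.

Lemma mem_walks n v p : p \in walks n v ->
  exists q, [/\ p = v :: q, size q = n & path adj v q].
Proof.
elim: n v p => [|n IH] v p /=; first by rewrite inE => /eqP ->; exists [::].
move=> /flattenP[L /mapP[w vw ->] /mapP[q /IH[r [-> sr pr]] ->]].
by exists (w :: r); rewrite /= sr pr -mem_nbrs vw.
Qed.

Lemma walks_mem v q : path adj v q -> v :: q \in walks (size q) v.
Proof.
elim: q v => [|w q IH] v /=; first by rewrite inE.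
case/andP => vw /IH h; apply/flattenP; exists [seq v :: p | p <- walks (size q) w].
  by apply/mapP; exists w; rewrite ?mem_nbrs.
by apply/mapP; exists (w :: q).
Qed.

Definition is_loop (g : seq vtx) := (size g == 6) && cycle adj g.

Lemma mem_loops v g : g \in loops 6 v -> is_loop g /\ nth VE0 g 0 = v.
Proof.
rewrite mem_filter => /andP[h /mem_walks[q [e s p]]]; rewrite e in h *.
by rewrite /is_loop /= s rcons_path p.
Qed.

Lemma loop6 g : is_loop g -> exists a0 a1 a2 a3 a4 a5, g = [:: a0; a1; a2; a3; a4; a5].
Proof.
case: g => [|a0 [|a1 [|a2 [|a3 [|a4 [|a5 [|a6 g]]]]]]] //=.
by exists a0, a1, a2, a3, a4, a5.
Qed.

Lemma is_loop_rot k g : is_loop g -> is_loop (rot k g).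
Proof. by rewrite /is_loop size_rot rot_cycle. Qed.

Lemma loop_mem g : is_loop g -> g \in loops 6 (nth VE0 g 0).
Proof.
move=> h; have [a0 [a1 [a2 [a3 [a4 [a5 e]]]]]] := loop6 h; move: h; rewrite e.
rewrite /is_loop mem_filter => /= /and5P[h1 h2 h3 h4 /and3P[h5 -> _]].
by rewrite (@walks_mem a0 [:: a1; a2; a3; a4; a5]) //= h1 h2 h3 h4 h5.
Qed.

(** An even loop that avoids the centre oscillates between an end of an arm and its
   neighbour. *)
Lemma loop_no_center g : is_loop g -> is_even (nth VE0 g 0) ->
  [|| veq (nth VE0 g 0) VC, veq (nth VE0 g 2) VC, veq (nth VE0 g 4) VC |
      (nth VE0 g 2 == nth VE0 g 0) && (nbrs (nth VE0 g 0) == [:: nth VE0 g 1])].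
Proof.
move=> /loop_mem; move: (nth VE0 g 0) => v gv ev.
suff : all (fun v => all (fun g => is_even v ==> 
    [|| veq v VC, veq (nth VE0 g 2) VC, veq (nth VE0 g 4) VC |
      (nth VE0 g 2 == v) && (nbrs v == [:: nth VE0 g 1])]) (loops 6 v)) all_vtx.
  have vv : v \in all_vtx by case: (v).
  by move=> /allP/(_ _ vv)/allP/(_ _ gv); rewrite ev.
by vm_compute.
Qed.

Section Soundness.
Variable R : realType.
Local Open Scope ring_scope.
Local Open Scope complex_scope.
Local Notation C := R[i].
Local Notation fval := (fval R).
Local Notation code_val := (code_val R).
Local Notation rv := (val_represents R).

Lemma valD x y : code_val (kadd x y) = code_val x + code_val y. Proof. exact: (repD rv). Qed.
Lemma valM x y : code_val (kmul x y) = code_val x * code_val y. Proof. exact: (repM rv). Qed.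
Lemma valN x : code_val (kopp x) = - code_val x. Proof. exact: (repN rv). Qed.
Lemma val_kz n : code_val (kz n) = intval C n. Proof. exact: (rep_int rv). Qed.
Lemma val0 : code_val k0 = 0. Proof. exact: (rep0 rv). Qed.
Lemma fval_1 x : fval (1%ZZ, x) = code_val x. Proof. by rewrite /fval /= intval_1 divr1. Qed.
Lemma fval_div n x : n != 0%ZZ -> code_val x = intval C n * fval (n, x).
Proof. by move=> n0; rewrite /fval /= mulrC divfK // intval_neq0 //; apply/negP => /Z.eqb_eq e; rewrite e in n0. Qed.

Lemma feq_num x n y : feqb (1%ZZ, x) (fmul (fint n) y) -> code_val x = intval C n * fval y.
Proof. by move/(feqP R); rewrite fval_1 fval_mul fval_int. Qed.

Lemma val_foldr (I : Type) (G : I -> KC) (s : seq I) :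
  code_val (foldr (fun x t => kadd (G x) t) k0 s) = \sum_(x <- s) code_val (G x).
Proof.
elim: s => [|x s IH]; first by rewrite big_nil; exact: val0.
by rewrite big_cons -IH; exact: valD.
Qed.

Section Generator.
Variables (X : generator) (T : seq vtx -> C) (kappa : C).

(** What the definition of a generator says about the function T of loops that it
   defines in the gauge of [tilde]: caps kill it, the rotation by two steps is a scalar
   on the loops with even base point, the loops with odd base point carry the dual
   generator, and the values on the words are given. *)
Record lowest_weight : Prop := LowestWeight {
  lw_null1 : forall w a3 a4 a5, is_even w -> is_loop [:: w; a5; w; a3; a4; a5] ->
    \sum_(x <- nbrs w) T [:: w; x; w; a3; a4; a5] = 0;
  lw_null2 : forall v w a4 a5, is_even v -> is_loop [:: v; w; v; w; a4; a5] ->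
    \sum_(x <- nbrs w) T [:: v; w; x; w; a4; a5] = 0;
  lw_rot : forall g, is_loop g -> is_even (nth VE0 g 0) -> T (rot 2 g) = fval (rotF X) * T g;
  lw_odd : forall g, is_loop g -> ~~ is_even (nth VE0 g 0) -> T g = fval (rotF X) * T (rot 1 g);
  lw_word : forall t, t \in triples -> T (word t) = kappa * fval (word_value X t) }.

Hypothesis Tlw : lowest_weight.
Hypothesis ok : generator_ok X (words X).

Lemma rot_unit : fval (rotF X) * fval (rot2F X) = 1.
Proof.
case/and5P: ok => _ _ /(feqP R) h _ _; move: h.
by rewrite fval_mul fval_int intval_1.
Qed.

Lemma rot_sqr : fval (rotF X) * fval (rotF X) = fval (rot2F X).
Proof. by case/and5P: ok => _ _ _ /(feqP R) h _; rewrite -fval_mul h. Qed.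

Lemma rot_numE : code_val (rot_num X) = 2 * fval (rotF X).
Proof.
by case/and5P: ok => /(feqP R) <- _ _ _ _; rewrite (fval_div (n := 2%ZZ)) // -(intval_nat C 2).
Qed.

Lemma rot2_numE : code_val (rot2_num X) = 2 * fval (rot2F X).
Proof.
by case/and5P: ok => _ /(feqP R) <- _ _ _; rewrite (fval_div (n := 2%ZZ)) // -(intval_nat C 2).
Qed.

Lemma lw_rot' g : is_loop g -> is_even (nth VE0 g 0) -> T g = fval (rot2F X) * T (rot 2 g).
Proof. by move=> h1 h2; rewrite (lw_rot Tlw) // mulrA [_ * fval (rotF X)]mulrC rot_unit mul1r. Qed.

Lemma even_rot2 g : is_loop g -> is_even (nth VE0 (rot 2 g) 0) = is_even (nth VE0 g 0).
Proof.
move=> h; have [a0 [a1 [a2 [a3 [a4 [a5 e]]]]]] := loop6 h; move: h; rewrite e /is_loop /=.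
by case/and3P => h1 h2 _; rewrite (adj_even h2) (adj_even h1) negbK.
Qed.

Lemma lw_rot4 g : is_loop g -> is_even (nth VE0 g 0) -> T g = fval (rotF X) * T (rot 4 g).
Proof.
move=> h1 h2; have r4 : rot 4 g = rot 2 (rot 2 g).
  by have [a0 [a1 [a2 [a3 [a4 [a5 ->]]]]]] := loop6 h1.
rewrite r4 (lw_rot Tlw) ?is_loop_rot ?even_rot2 // (lw_rot Tlw) //.
by rewrite mulrA mulrA rot_sqr [fval (rot2F X) * _]mulrC rot_unit mul1r.
Qed.

Definition based (p : seq vtx) : C := if nth VE0 p 0 == VC then T (take 6 p) else 0.

(** The two cap relations concern the first two places; the rotations carry them to
   every place of the walk. *)
Lemma based_harmonic : harmonic 5 VC based.
Proof.
move=> l w r; rewrite /is_walk => /and3P[s /eqP sz /eqP la].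
have [hd|hd] := boolP (nth VE0 (l ++ w :: r) 0 == VC); last first.
  by apply: big1_seq => x _; rewrite /based; move: hd; case: (l) => [|y l'] /= /negbTE ->.
have E x : based (l ++ [:: w, x, w & r]) = T (take 6 (l ++ [:: w, x, w & r])).
  by rewrite /based; move: hd; case: (l) => [|y l'] /= ->.
under eq_bigr do rewrite E; move: s sz la hd {E}.
have rot2 a0 a1 a2 a3 a4 a5 : is_even a0 -> is_loop [:: a0; a1; a2; a3; a4; a5] ->
    T [:: a0; a1; a2; a3; a4; a5] = fval (rot2F X) * T [:: a2; a3; a4; a5; a0; a1].
  by move=> h1 h2; rewrite (lw_rot' h2).
have rot4 a0 a1 a2 a3 a4 a5 : is_even a0 -> is_loop [:: a0; a1; a2; a3; a4; a5] ->
    T [:: a0; a1; a2; a3; a4; a5] = fval (rotF X) * T [:: a4; a5; a0; a1; a2; a3].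
  by move=> h1 h2; rewrite (lw_rot4 h2).
case: l => [|a0 [|a1 [|a2 [|a3 [|a4 l]]]]]; last by rewrite /= size_cat /= !addnS.
- case: r => [|b1 [|b2 [|b3 [|b4 [|b5 r]]]]] //= s _ e' /eqP e; rewrite e e' in s *.
  apply: (lw_null1 Tlw) => //; move: s => /and5P[h1 h2 h3 h4 _].
  by rewrite /is_loop /= h1 h2 h3 h4 [adj VC b3]adj_sym h4.
- case: r => [|b2 [|b3 [|b4 [|b5 r]]]] //= s _ e' /eqP e; rewrite e e' in s *.
  apply: (lw_null2 Tlw) => //; move: s => /and5P[h1 h2 h3 h4 _].
  by rewrite /is_loop /= h1 h2 h3 h4 [adj w VC]adj_sym h1.
- case: r => [|b3 [|b4 [|b5 r]]] //= s _ e' /eqP e; rewrite e e' in s *.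
  move: s => /and5P[h1 h2 h3 h4 _].
  rewrite big_seq (eq_bigr (fun x => fval (rot2F X) * T [:: w; x; w; b3; VC; a1])) => [|x]; last first.
    rewrite mem_nbrs => wx; rewrite rot2 // /is_loop /= h1 h2 wx h3 h4.
    by rewrite [adj x w]adj_sym wx.
  rewrite -big_seq -mulr_sumr (lw_null1 Tlw) ?mulr0 //.
    by rewrite (adj_even h2) (adj_even h1).
  by rewrite /is_loop /= h3 h4 h1 h2 [adj w a1]adj_sym h2.
- case: r => [|b4 [|b5 r]] //= s _ e' /eqP e; rewrite e e' in s *.
  move: s => /and5P[h1 h2 h3 h4 _].
  rewrite big_seq (eq_bigr (fun x => fval (rot2F X) * T [:: a2; w; x; w; VC; a1])) => [|x]; last first.
    rewrite mem_nbrs => wx; rewrite rot2 // /is_loop /= h1 h2 wx h3 h4.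
    by rewrite [adj x w]adj_sym wx.
  rewrite -big_seq -mulr_sumr (lw_null2 Tlw) ?mulr0 //.
    by rewrite (adj_even h2) (adj_even h1).
  by rewrite /is_loop /= h3 h4 h1 h2 [adj w a2]adj_sym h3.
case: r => [|b5 r] //= s _ e' /eqP e; rewrite e e' in s *.
move: s => /and5P[h1 h2 h3 h4 _].
rewrite big_seq (eq_bigr (fun x => fval (rotF X) * T [:: VC; x; VC; a1; a2; a3])) => [|x]; last first.
  rewrite mem_nbrs => wx; rewrite rot4 // /is_loop /= h1 h2 wx h3 h4.
  by rewrite [adj x VC]adj_sym wx.
rewrite -big_seq -mulr_sumr (lw_null1 Tlw) ?mulr0 //.
by rewrite /is_loop /= h3 h4 h1 h2 adj_sym h4.
Qed.

Lemma fs_getP (p : seq vtx) (key : vtx * vtx * vtx -> seq vtx) (value : vtx * vtx * vtx -> KC) ks :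
  has (fun kx => seq_veq p kx.1) [seq (key k, value k) | k <- ks] ->
  exists k, [/\ k \in ks, p = key k & fs_get p [seq (key k, value k) | k <- ks] = value k].
Proof.
elim: ks => [|k ks IH] //=; case: ifP => [/seq_veqP e _|_ /= /IH[j [jks e ->]]].
  by exists k; rewrite inE eqxx.
by exists j; rewrite inE jks orbT.
Qed.

Lemma center_valueE g : is_loop g -> nth VE0 g 0 = VC ->
  kappa * code_val (center_value (words X) g) = intval C (denom X) * T g.
Proof.
move=> h g0; have hw : is_walk 7 VC (rcons g VC).
  have [a0 [a1 [a2 [a3 [a4 [a5 e]]]]]] := loop6 h; move: h; rewrite /is_loop /is_walk.
  by rewrite e /= in g0 *; rewrite -g0 => -> /=.
have -> : T g = based (rcons g VC).
  have [a0 [a1 [a2 [a3 [a4 [a5 e]]]]]] := loop6 h.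
  by move: g0; rewrite e /based /= => ->.
rewrite (harmonic_red based_harmonic 24 hw).
have gl : g \in loops 6 VC by rewrite -g0 loop_mem.
case/and5P: ok => _ _ _ _ /andP[wok /allP/(_ _ gl)].
rewrite /center_value val_foldr !mulr_sumr; move: (reduce 24 _) => L hL.
rewrite big_seq [RHS]big_seq; apply: eq_bigr => -[b q] /(allP hL) hq.
have [t [tt eq ->]] := fs_getP hq; move/allP: wok => /(_ _ tt)/feq_num e /=.
rewrite (phi_signed rv) e [q]eq /based.
have -> : nth VE0 (rcons (word t) VC) 0 == VC by [].
have -> : take 6 (rcons (word t) VC) = word t by [].
by rewrite (lw_word Tlw tt) /signr; case: (b); ring.
Qed.

Lemma even_valueE g : is_loop g -> is_even (nth VE0 g 0) ->
  kappa * code_val (even_value X (words X) g) = 2 * intval C (denom X) * T g.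
Proof.
move=> h ev; have [a0 [a1 [a2 [a3 [a4 [a5 e]]]]]] := loop6 h.
rewrite /even_value; case: ifP => [/veqP g0|n0].
  by rewrite valM val_kz -(intval_nat C 2) mulrCA center_valueE // mulrA.
case: ifP => [/veqP g2|n2].
  rewrite valM rot2_numE mulrCA center_valueE ?is_loop_rot //; last by move: g2; rewrite e.
  by rewrite (lw_rot' h ev); ring.
case: ifP => [/veqP g4|n4].
  rewrite valM rot_numE mulrCA center_valueE ?is_loop_rot //; last by move: g4; rewrite e.
  by rewrite (lw_rot4 h ev); ring.
have := loop_no_center h ev; rewrite n0 n2 n4 /= => /andP[/eqP e2 /eqP en].
rewrite mulr0; move: e2 en h ev; rewrite e /= => -> en h ev.
have h' : is_loop [:: a0; a5; a0; a3; a4; a5].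
  by move: h; rewrite /is_loop /= => /and5P[h1 h2 h3 h4 /and3P[h5 h6 _]]; rewrite h3 h4 h5 h6 adj_sym h6.
by have := lw_null1 Tlw ev h'; rewrite en big_seq1 => ->; rewrite mulr0.
Qed.

Lemma loop_valueE g : is_loop g ->
  kappa * code_val (loop_value X (words X) g) = 4 * intval C (denom X) * T g.
Proof.
move=> h; rewrite /loop_value; case: ifP => ev; rewrite valM mulrCA.
  by rewrite even_valueE // val_kz -(intval_nat C 2) !mulrA -natrM.
have [a0 [a1 [a2 [a3 [a4 [a5 e]]]]]] := loop6 h.
rewrite even_valueE ?is_loop_rot //; last first.
  move: h ev; rewrite e /is_loop /= => /andP[h1 _] ev.
  by rewrite (adj_even h1) ev.
rewrite (lw_odd Tlw h) ?ev // rot_numE.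
by rewrite -[4]/(2 * 2)%:R natrM; ring.
Qed.

End Generator.

(** The dimensions, normalised by dim c = 1 *)
Definition ndim (v : vtx) : R :=
  match v with
  | VC => 1
  | VE0 | VE1 | VE2 => (sqrt21 R - 3) / 6
  | VU3 => s3 R * (sqrt21 R - 3) / 6
  | _ => s3 R / 3
  end.

Lemma ndim_gt0 v : 0 < ndim v.
Proof.
have [h1 _ h3 _] := bounds_all R; case: v => /=; try lra.
by have := mul_bounds _ _ h1 h3; lra.
Qed.

Lemma val_cx' a b a' b' : code_val (cx (f4 a b 0 0) (f4 a' b' 0 0)) =
  (intval R a + intval R b * sqrt21 R) +i* ((intval R a' + intval R b' * sqrt21 R) * s3 R).
Proof. by rewrite val_cx intval_0 !mul0r !addr0 !mul0r !addr0. Qed.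

Lemma val_xc' a b a' b' : code_val (xc (f4 a b 0 0) (f4 a' b' 0 0)) =
  ((intval R a + intval R b * sqrt21 R) * s3 R) +i* (intval R a' + intval R b' * sqrt21 R).
Proof. by rewrite val_xc intval_0 !mul0r !addr0 !mul0r !addr0. Qed.

Lemma complex_real (x y : R) : x = y -> (x +i* 0)%C = y%:C.
Proof. by move=> ->. Qed.

Lemma val_dim6 v : code_val (dim6 v) = 6 * (ndim v)%:C.
Proof.
have -> : 6 * (ndim v)%:C = (6 * ndim v)%:C by rewrite rmorphM rmorph_nat.
case: v; rewrite /dim6; first [rewrite (val_cx' _ _ 0 0)|rewrite (val_xc' _ _ 0 0)];
  rewrite !intval_binary !mul0r !addr0 ?mul0r; apply: complex_real; by rewrite /ndim; field.
Qed.

Lemma fval_dimF v : fval (dimF v) = (ndim v)%:C.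
Proof.
by rewrite fvalE [_.2]/(dim6 v) val_dim6 -(intval_nat C 6) mulrC mulKf ?pnatr_eq0.
Qed.

Definition dim_factor (v : vtx) : R := if is_even v then 2 else 6.

Lemma val_inv_dim v : code_val (inv_dim v) = (dim_factor v / ndim v)%:C.
Proof.
have e21 := sqr_s21 R; have e3 := sqr_s3 R; have d0 := ndim_gt0 v.
suff h : exists2 x, code_val (inv_dim v) = x%:C & x * ndim v = dim_factor v.
  by case: h => x -> <-; rewrite mulfK // gt_eqF.
have ? : sqrt21 R * sqrt21 R = 21 by [].
case: v {d0}; rewrite /inv_dim; first [rewrite (val_cx' _ _ 0 0)|rewrite (val_xc' _ _ 0 0)];
  rewrite !intval_binary !mul0r !addr0 ?mul0r; (eexists; first exact: complex_real erefl);
  rewrite /ndim /dim_factor /=; nra.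
Qed.

(** T divided by all the dimensions: the coefficient with which a box enters the
   sums below, see [hat_tilde]. *)
Definition hat (T : seq vtx -> C) (g : seq vtx) : C := T g / \prod_(x <- g) (ndim x)%:C.

Lemma val_inv_dims g x : code_val (inv_dims g x) = (\prod_(v <- g) (dim_factor v / ndim v)%:C) * code_val x.
Proof.
elim: g => [|v g IH]; first by rewrite big_nil mul1r.
by rewrite big_cons -mulrA -IH -val_inv_dim; exact: valM.
Qed.

Lemma prod_dim_factor g : is_loop g ->
  \prod_(v <- g) (dim_factor v / ndim v)%:C = 1728%:R / \prod_(v <- g) (ndim v)%:C.
Proof.
move=> h; have -> : \prod_(v <- g) (dim_factor v / ndim v)%:C =
    (\prod_(v <- g) (dim_factor v)%:C) / \prod_(v <- g) (ndim v)%:C.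
  by rewrite -prodf_div; apply: eq_bigr => v _; rewrite rmorphM /= fmorphV.
congr (_ / _); have [a0 [a1 [a2 [a3 [a4 [a5 e]]]]]] := loop6 h.
move: h; rewrite e /is_loop /= => /and5P[h1 h2 h3 h4 /andP[h5 _]].
rewrite !big_cons big_nil /dim_factor (adj_even h5) (adj_even h4) (adj_even h3) (adj_even h2) (adj_even h1).
have -> : 1728%:R = (2 * (6 * (2 * (6 * (2 * 6)))))%:C :> C.
  by rewrite -!natrM rmorph_nat.
by case: (is_even a0); rewrite /= !rmorphM /=; ring.
Qed.

Lemma hat_valueE X T kappa g : lowest_weight X T kappa -> generator_ok X (words X) -> is_loop g ->
  kappa * code_val (hat_value X (words X) g) = intval C (4 * denom X * 1728) * hat T g.
Proof.
move=> Tlw ok h; rewrite /hat_value val_inv_dims prod_dim_factor // mulrCA (loop_valueE Tlw) //.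
rewrite !(repM (integer_represents C)) -(intval_nat C 4) -(intval_nat C 1728) /hat; ring.
Qed.

Lemma intvalM (F : pzRingType) x y : intval F (Z.mul x y) = intval F x * intval F y.
Proof. exact: (repM (integer_represents F)). Qed.

Section Identity.
Variables (v0 : vtx) (f : seq vtx -> C).
Hypothesis fh : harmonic 7 v0 f.
Local Notation fs_valK := (fs_val (o := KC) code_val f).

(** S o T applied to a harmonic function f, up to a factor that depends on v0 only;
   see [circ_sum_gauged]. *)
Definition circ_sum (T U : seq vtx -> C) : C :=
  \sum_(l <- walks 4 v0) \sum_(r <- walks 4 v0 | nth VC l 4 == nth VC r 4)
    (\sum_(a <- mids v0 l) (ndim a)%:C * (hat T (left_loop v0 l a) * hat U (right_loop v0 r a)))
      * f (join l r).

(** j(T) applied to a harmonic function f, up to the same factor; see [jdiag_sum]. *)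
Definition j_sum (T : seq vtx -> C) : C :=
  \sum_(g <- jloops v0) (ndim (nth VC g 0))^-1%:C * hat T g * f (jpath v0 g).

Lemma walk4 l : l \in walks 4 v0 ->
  exists a b c d, l = [:: v0; a; b; c; d] /\ [&& adj v0 a, adj a b, adj b c & adj c d].
Proof.
case/mem_walks => -[|a [|b [|c [|d [|? ?]]]]] [-> //= _ h]; exists a, b, c, d.
by move: h; rewrite andbT.
Qed.

Lemma is_walk_join l r : l \in walks 4 v0 -> r \in walks 4 v0 -> nth VC l 4 = nth VC r 4 ->
  is_walk 9 v0 (join l r).
Proof.
case/walk4 => [a [b [c [d [-> /and4P[h1 h2 h3 h4]]]]]].
case/walk4 => [a' [b' [c' [d' [-> /and4P[h1' h2' h3' h4']]]]]] /= e.
rewrite e in h4 *; rewrite adj_sym in h1'; rewrite adj_sym in h2'; rewrite adj_sym in h3'.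
rewrite adj_sym in h4'.
by rewrite /is_walk /join /rev /= h1 h2 h3 h4 h4' h3' h2' h1' eqxx.
Qed.

Lemma is_walk_jpath g : g \in jloops v0 -> is_loop g /\ is_walk 9 v0 (jpath v0 g).
Proof.
case/flattenP => _ /mapP[v vv0 ->] /mem_loops[h gv]; split=> //.
have [a0 [a1 [a2 [a3 [a4 [a5 e]]]]]] := loop6 h; move: h gv; rewrite e /is_loop /= => h gv.
rewrite mem_nbrs -gv in vv0; move: h => /and5P[h1 h2 h3 h4 /and3P[h5 h6 _]].
rewrite adj_sym in h1; rewrite adj_sym in h2; rewrite adj_sym in h3.
rewrite adj_sym in h4; rewrite adj_sym in h5; rewrite adj_sym in h6.
have v0a : adj a0 v0 by rewrite adj_sym.
by rewrite /is_walk /jpath /= vv0 h6 h5 h4 h3 h2 h1 v0a eqxx.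
Qed.

Lemma fs_val_circ_term l r s u D : l \in walks 4 v0 -> r \in walks 4 v0 ->
  fs_valK (circ_term (l, s) (r, u) D) =
  fs_valK D - (if nth VC l 4 == nth VC r 4 then code_val (dot s u) * f (join l r) else 0).
Proof.
move=> hl hr; rewrite /circ_term /=; case: eqP => [e|/eqP/negbTE h].
  rewrite e (introT (veqP _ _) erefl); case: ifP => [/(rep_zero rv) z|_].
    by rewrite z mul0r subr0.
  rewrite (fs_val_insert_red rv _ _ fh (is_walk_join hl hr e)).
  by rewrite [X in X * _]valN mulNr addrC.
by rewrite ifN ?subr0 // -[veq _ _]/(_ == _) h.
Qed.

Lemma fs_val_circ_terms l s U D rs : l \in walks 4 v0 -> {subset rs <= walks 4 v0} ->
  fs_valK (foldr (fun u D => circ_term (l, s) u D) D [seq (r, U r) | r <- rs]) =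
  fs_valK D - \sum_(r <- rs | nth VC l 4 == nth VC r 4) code_val (dot s (U r)) * f (join l r).
Proof.
move=> hl; elim: rs => [|r rs IH] h; first by rewrite big_nil subr0.
have hr : r \in walks 4 v0 by apply: h; rewrite inE eqxx.
rewrite [foldr _ _ _]/(circ_term (l, s) (r, U r) _) fs_val_circ_term // IH; last first.
  by move=> q qs; apply: h; rewrite inE qs orbT.
by rewrite big_cons; case: ifP => _; ring.
Qed.

Lemma fs_val_circ_part S U D ls rs : {subset ls <= walks 4 v0} -> {subset rs <= walks 4 v0} ->
  fs_valK (circ_part [seq (l, S l) | l <- ls] [seq (r, U r) | r <- rs] D) =
  fs_valK D - \sum_(l <- ls) \sum_(r <- rs | nth VC l 4 == nth VC r 4)
     code_val (dot (S l) (U r)) * f (join l r).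
Proof.
move=> hl hr; elim: ls hl => [|l ls IH] h; first by rewrite big_nil subr0.
have hl : l \in walks 4 v0 by apply: h; rewrite inE eqxx.
rewrite [circ_part _ _ _]/(foldr (fun u D => circ_term (l, S l) u D) (circ_part _ _ _) _).
rewrite fs_val_circ_terms // IH; last by move=> q qs; apply: h; rewrite inE qs orbT.
by rewrite big_cons; ring.
Qed.

Lemma fs_val_j_part c h :
  fs_valK (j_part v0 c h) = \sum_(g <- jloops v0) code_val (jcoef c h g) * f (jpath v0 g).
Proof.
rewrite /j_part; have : {subset jloops v0 <= jloops v0} by [].
elim: {1 3 4}(jloops v0) => [|g gs IH] hs; first by rewrite /fs_val !big_nil.
have hg : g \in jloops v0 by apply: hs; rewrite inE eqxx.
have [_ hw] := is_walk_jpath hg.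
rewrite big_cons -IH; last by move=> q qs; apply: hs; rewrite inE qs orbT.
exact: (fs_val_insert_red rv _ _ fh hw).
Qed.

Variables (TA TB : seq vtx -> C).
Hypothesis lwA : lowest_weight genA TA 1.
Hypothesis lwB : lowest_weight genB TB 1.
Local Notation N := (intval C num_scale).

Lemma mul1_trans (a b n m : C) : 1 * a = n * b -> n = m -> a = m * b.
Proof. by rewrite mul1r => -> ->. Qed.

Lemma intval5M n : intval C (Z.mul 5 n) = 5 * intval C n.
Proof. by rewrite intvalM -(intval_nat C 5). Qed.

Lemma val_hA g : is_loop g -> code_val (hA g) = N * hat TA g.
Proof.
have ok : generator_ok genA (words genA) by rewrite -wordsAE genA_ok.
move=> h; rewrite /hA wordsAE; exact: (mul1_trans (hat_valueE lwA ok h)).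
Qed.

Lemma val_hB g : is_loop g -> code_val (hB g) = 5 * N * hat TB g.
Proof.
have ok : generator_ok genB (words genB) by rewrite -wordsBE genB_ok.
have e : Z.mul (Z.mul 4 (denom genB)) 1728 = Z.mul 5 num_scale by [].
move=> h; rewrite /hB wordsBE; apply: (mul1_trans (hat_valueE lwB ok h)).
by rewrite e; exact: intval5M.
Qed.

#[local] Opaque hA hB dim6 num_scale hat ndim.

Lemma is_loop_mids l r a : l \in walks 4 v0 -> r \in walks 4 v0 -> nth VC l 4 = nth VC r 4 ->
  a \in mids v0 l -> is_loop (left_loop v0 l a) /\ is_loop (right_loop v0 r a).
Proof.
case/walk4 => [a0 [b [c [d [-> /and4P[h1 h2 h3 h4]]]]]].
case/walk4 => [a' [b' [c' [d' [-> /and4P[h1' h2' h3' h4']]]]]] /= e.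
rewrite mem_filter mem_nbrs /= => /andP[ad va].
rewrite e in ad h4 *; rewrite /is_loop /= h1' h2' h3' h4' ad va [adj a v0]adj_sym va.
rewrite [adj d' a]adj_sym ad adj_sym h4 adj_sym h3 adj_sym h2 adj_sym h1.
by [].
Qed.

Local Notation left_pairs l :=
  [seq (hA (left_loop v0 l a), hB (left_loop v0 l a)) | a <- mids v0 l].
Local Notation right_pairs c l :=
  (map (apply_matrix c) [seq (hA (right_loop v0 l a), hB (right_loop v0 l a), dim6 a) | a <- mids v0 l]).

Lemma val_dot_sum s t :
  code_val (dot s t) = \sum_(x <- zip s t) (code_val x.1.1 * code_val x.2.1 + code_val x.1.2 * code_val x.2.2).
Proof.
rewrite /dot; elim: (zip s t) => [|x l IH]; first by rewrite big_nil; exact: val0.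
by rewrite big_cons -IH -addrA -!valM -!valD.
Qed.

Lemma dot_term (d n a b a' b' aa ab ba bb : C) :
  n * a * (6 * d * (aa * (n * a') + ab * (5 * n * b'))) + 5 * n * b * (6 * d * (ba * (n * a') + bb * (5 * n * b'))) =
  6 * (n * n) * (d * (a * (aa * a' + 5 * ab * b') + 5 * b * (ba * a' + 5 * bb * b'))).
Proof. by ring. Qed.

Lemma dot_map c (s : seq vtx) (a1 b1 a2 b2 : vtx -> KC) :
  code_val (dot [seq (a1 x, b1 x) | x <- s] (map (apply_matrix c) [seq (a2 x, b2 x, dim6 x) | x <- s])) =
  \sum_(x <- s)
    (code_val (a1 x) * (code_val (dim6 x) * (code_val (caa c) * code_val (a2 x) + code_val (cab c) * code_val (b2 x))) +
     code_val (b1 x) * (code_val (dim6 x) * (code_val (cba c) * code_val (a2 x) + code_val (cbb c) * code_val (b2 x)))).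
Proof.
rewrite -map_comp val_dot_sum zip_map big_map; apply: eq_bigr => x _ /=.
by rewrite !(valM, valD).
Qed.

Lemma sum_terms (s : seq vtx) (n aa ab ba bb : C) (d a b a' b' : vtx -> C) :
  \sum_(x <- s) (n * a x * (6 * d x * (aa * (n * a' x) + ab * (5 * n * b' x))) +
     5 * n * b x * (6 * d x * (ba * (n * a' x) + bb * (5 * n * b' x)))) =
  6 * (n * n) * \sum_(x <- s) d x * (a x * (aa * a' x + 5 * ab * b' x) + 5 * b x * (ba * a' x + 5 * bb * b' x)).
Proof. by rewrite mulr_sumr; apply: eq_bigr => x _; exact: dot_term. Qed.

Lemma val_dot c l r : l \in walks 4 v0 -> r \in walks 4 v0 -> nth VC l 4 = nth VC r 4 ->
  code_val (dot (left_pairs l)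
           (right_pairs c r))
  = 6 * (N * N) * \sum_(a <- mids v0 l) (ndim a)%:C * 
     (hat TA (left_loop v0 l a) * (code_val (caa c) * hat TA (right_loop v0 r a) + 5 * code_val (cab c) * hat TB (right_loop v0 r a))
     + 5 * hat TB (left_loop v0 l a) * (code_val (cba c) * hat TA (right_loop v0 r a) + 5 * code_val (cbb c) * hat TB (right_loop v0 r a))).
Proof.
move=> hl hr e; have -> : mids v0 r = mids v0 l by rewrite /mids e.
rewrite -sum_terms (dot_map c (mids v0 l) (fun a => hA (left_loop v0 l a)) (fun a => hB (left_loop v0 l a))
  (fun a => hA (right_loop v0 r a)) (fun a => hB (right_loop v0 r a))).
apply: eq_big_seq => a am; have [ll lr] := is_loop_mids hl hr e am.
have term_eq (p q p' q' d u v u' v' w aa ab ba bb : C) :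
    p = u -> q = v -> p' = u' -> q' = v' -> d = w ->
    p * (d * (aa * p' + ab * q')) + q * (d * (ba * p' + bb * q')) =
    u * (w * (aa * u' + ab * v')) + v * (w * (ba * u' + bb * v')).
  by move=> -> -> -> -> ->.
exact: (term_eq _ _ _ _ _ _ _ _ _ _ _ _ _ _ (val_hA ll) (val_hB ll) (val_hA lr) (val_hB lr) (val_dim6 a)).
Qed.

Lemma circ_sum_lin (aa ab ba bb : C) :
  \sum_(l <- walks 4 v0) \sum_(r <- walks 4 v0 | nth VC l 4 == nth VC r 4)
   (\sum_(a <- mids v0 l) (ndim a)%:C *
     (hat TA (left_loop v0 l a) * (aa * hat TA (right_loop v0 r a) + 5 * ab * hat TB (right_loop v0 r a))
     + 5 * hat TB (left_loop v0 l a) * (ba * hat TA (right_loop v0 r a) + 5 * bb * hat TB (right_loop v0 r a))))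
   * f (join l r) =
  aa * circ_sum TA TA + 5 * ab * circ_sum TA TB + 5 * ba * circ_sum TB TA + 25 * bb * circ_sum TB TB.
Proof.
rewrite /circ_sum !mulr_sumr -!big_split; apply: eq_bigr => l _.
rewrite !mulr_sumr -!big_split; apply: eq_bigr => r _.
rewrite [in RHS]/= !mulr_suml !mulr_sumr -!big_split; apply: eq_bigr => a _ /=.
move: (hat TA _) (hat TB _) (hat TA _) (hat TB _) (f _) ((ndim a)%:C) => x y x' y' z d.
by ring.
Qed.

Lemma pull_const (ls rs : seq (seq vtx)) (P : seq vtx -> seq vtx -> bool) (n : C)
    (F h : seq vtx -> seq vtx -> C) :
  \sum_(l <- ls) \sum_(r <- rs | P l r) (n * F l r) * h l r =
  n * \sum_(l <- ls) \sum_(r <- rs | P l r) F l r * h l r.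
Proof.
rewrite mulr_sumr; apply: eq_bigr => l _; rewrite mulr_sumr; apply: eq_bigr => r _.
by rewrite mulrA.
Qed.

Lemma circ_total c :
  \sum_(l <- walks 4 v0) \sum_(r <- walks 4 v0 | nth VC l 4 == nth VC r 4)
    code_val (dot (left_pairs l)
           (right_pairs c r))
    * f (join l r) =
  6 * (N * N) * (code_val (caa c) * circ_sum TA TA + 5 * code_val (cab c) * circ_sum TA TB
    + 5 * code_val (cba c) * circ_sum TB TA + 25 * code_val (cbb c) * circ_sum TB TB).
Proof.
rewrite -circ_sum_lin -pull_const.
apply: eq_big_seq => l hl; rewrite big_seq_cond [RHS]big_seq_cond.
apply: eq_bigr => r /andP[hr /eqP e]; exact: (congr1 ( *%R^~ _) (val_dot c hl hr e)).
Qed.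

Lemma val_jcoef c h g : code_val (jcoef c h g) = code_val (cJ c) * (6 * (ndim (nth VC g 0))^-1%:C) * code_val (h g).
Proof.
rewrite /jcoef !valM val_kz val_inv_dim rmorphM /=; congr (_ * _ * _).
rewrite mulrA; congr (_ * _); rewrite /dim_factor; case: ifP => _.
  by rewrite -(intval_nat C 3) rmorph_nat -natrM.
by rewrite intval_1 mul1r rmorph_nat.
Qed.

Lemma vanish_spikes : vanish f (gauss 100 (spike_relations v0)).
Proof.
apply: vanish_gauss; apply: (vanish_spike_relations fh) => p /mapP[w].
rewrite mem_filter => /andP[hl /mem_walks[r [e s pr]]] ->; rewrite e in hl *.
rewrite /is_walk last_rcons size_rcons /= s eqxx rcons_path pr.
by move: hl => /= ->.
Qed.

Lemma check_equationP c h T k :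
  check_equation v0 c h ->
  (forall g, is_loop g -> code_val (h g) = k * hat T g) ->
  6 * k * code_val (cJ c) * j_sum T =
  6 * (N * N) * (code_val (caa c) * circ_sum TA TA + 5 * code_val (cab c) * circ_sum TA TB
    + 5 * code_val (cba c) * circ_sum TB TA + 25 * code_val (cbb c) * circ_sum TB TB).
Proof.
rewrite /check_equation => h0 hT; have := fs_val_zero f rv h0; rewrite (fs_val_eliminate _ vanish_spikes) {h0}.
rewrite /left_table /right_table /right_applied -map_comp /halfs.
have sub : {subset walks 4 v0 <= walks 4 v0} by [].
rewrite (fs_val_circ_part (fun l => (left_pairs l))
   (fun l => right_pairs c l) _ sub sub).
rewrite (fs_val_j_part c h) (circ_total c) => E; apply: etrans (subr0_eq E) => {E}.
rewrite /j_sum mulr_sumr big_seq [RHS]big_seq; apply: eq_bigr => g /is_walk_jpath[lg _].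
rewrite val_jcoef (hT _ lg).
by move: (code_val (cJ c)) (hat T g) (f _) (_^-1%:C) => x y z t; ring.
Qed.

Lemma cancel_scale (k n m s M j x y z t a b c d e : C) : s * k = 25 * (n * n) ->
  M != 0 -> m != 0 -> n != 0 ->
  6 * k * (M * (m * (s * j))) * x = 6 * (n * n) * (M * (m * (25 * a)) * y + 5 * (M * (m * (5 * b))) * z
    + 5 * (M * (m * (5 * c))) * t + 25 * (M * (m * d)) * e) ->
  j * x = a * y + b * z + c * t + d * e.
Proof.
move=> sk M0 m0 n0 h; apply: (mulfI (_ : 150%:R * (n * n) * M * m != 0)).
  by rewrite !mulf_neq0 // pnatr_eq0.
transitivity (6 * k * (M * (m * (s * j))) * x).
  have -> : 6 * k * (M * (m * (s * j))) * x = 6 * (s * k) * M * m * (j * x) by ring.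
  by rewrite sk; ring.
by rewrite h; ring.
Qed.

Lemma equation_holds q c m M sJ h T k :
  clear_ok M (scaled m sJ q) c -> (forall g, is_loop g -> code_val (h g) = k * hat T g) ->
  intval C sJ * k = 25 * (N * N) -> intval C M != 0 -> fval m != 0 -> N != 0 ->
  check_equation v0 c h ->
  fval (eJ q) * j_sum T = fval (eaa q) * circ_sum TA TA + fval (eab q) * circ_sum TA TB +
    fval (eba q) * circ_sum TB TA + fval (ebb q) * circ_sum TB TB.
Proof.
move=> /and5P[/feq_num cj /feq_num ca /feq_num cb /feq_num cd /feq_num ce] hT hk M0 m0 N0 h0.
have := check_equationP h0 hT; rewrite cj ca cb cd ce => E.
apply: (cancel_scale hk M0 m0 N0); move: E.
rewrite !fval_mul !fval_int -(intval_nat C 25) -(intval_nat C 5); exact.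
Qed.

End Identity.

Lemma scale25 n : intval C (Z.mul 25 n) * intval C n = 25 * (intval C n * intval C n).
Proof. by rewrite intvalM -(intval_nat C 25) mulrA. Qed.

Lemma scale5 n : intval C (Z.mul 5 n) * (5 * intval C n) = 25 * (intval C n * intval C n).
Proof. by rewrite intval5M; ring. Qed.

Lemma num_scale_neq0 : intval C num_scale != 0.
Proof. exact: intval_neq0. Qed.

Lemma gamA_unit : fval (conjF gamA) != 0.
Proof.
have /(feqP R) : feqb (fmul (conjF gamA) gamA) (fint 1) by vm_compute.
rewrite fval_mul fval_int intval_1 => e; apply/negP => /eqP z; move: e; rewrite z mul0r.
by move/eqP; rewrite eq_sym oner_eq0.
Qed.

Lemma nuF_neq0 : fval nuF != 0.
Proof.
have [_ _ _ h4] := bounds_all R.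
have p : 0 < snu R by lra.
by rewrite fval_1 val_nu fmorph_eq0 gt_eqF.
Qed.

Section Equations.
Variables (v0 : vtx) (f : seq vtx -> C).
Hypothesis fh : harmonic 7 v0 f.
Variables (TA TB : seq vtx -> C).
Hypothesis lwA : lowest_weight genA TA 1.
Hypothesis lwB : lowest_weight genB TB 1.
Local Notation csum := (circ_sum v0 f).
Local Notation jsum := (j_sum v0 f).

Lemma equation_A_holds : fval gamA * jsum TA =
  fval (eaa equation_A) * csum TA TA + fval (eab equation_A) * csum TA TB +
  fval (eba equation_A) * csum TB TA + fval (ebb equation_A) * csum TB TB.
Proof.
have e : intval C (Z.mul 25 num_scale) * intval C num_scale = 25 * (intval C num_scale * intval C num_scale).
  exact: scale25.
exact: (equation_holds fh lwA lwB clearedA_ok (val_hA lwA) e (intval_neq0 C (n := 61200) isT) gamA_unit num_scale_neq0 (check_A v0)).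
Qed.

Lemma equation_B_holds : fval gamB * jsum TB =
  fval (eaa equation_B) * csum TA TA + fval (eab equation_B) * csum TA TB +
  fval (eba equation_B) * csum TB TA + fval (ebb equation_B) * csum TB TB.
Proof.
have e : intval C (Z.mul 5 num_scale) * (5 * intval C num_scale) = 25 * (intval C num_scale * intval C num_scale).
  exact: scale5.
exact: (equation_holds fh lwA lwB clearedB_ok (val_hB lwB) e (intval_neq0 C (n := 1040400) isT) nuF_neq0 num_scale_neq0 (check_B v0)).
Qed.

End Equations.

Lemma is_loop_rev g : is_loop g -> is_loop (rev_loop g).
Proof.
move=> h; have [a0 [a1 [a2 [a3 [a4 [a5 e]]]]]] := loop6 h; move: h; rewrite e /is_loop /=.
move=> /and5P[h1 h2 h3 h4 /and3P[h5 h6 _]].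
by rewrite adj_sym h6 adj_sym h5 adj_sym h4 adj_sym h3 adj_sym h2 adj_sym h1.
Qed.

Lemma trace_term (k n m u x y x' y' d : C) : d != 0 -> k * x = 4 * n * x' -> k * y = 4 * n * y' ->
  k * k * (2 / u * (2 / u) * (m / d * x * y)) = (4 * m * (4 * n) * (4 * n)) * (x' * y' / (d * (u * u))).
Proof.
move=> d0 ex ey.
have -> : k * k * (2 / u * (2 / u) * (m / d * x * y)) = 4 * m * (k * x) * (k * y) * d^-1 * (u^-1 * u^-1) by ring.
by rewrite ex ey !invfM; ring.
Qed.

Definition trace_scale : Z := (4 * 1728 * (4 * 144) * (4 * 144))%ZZ.

Lemma val_foldr_mul (I : Type) (G H : I -> KC) (s : seq I) :
  code_val (foldr (fun x t => kadd (kmul (G x) (H x)) t) k0 s) = \sum_(x <- s) code_val (G x) * code_val (H x).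
Proof. by rewrite val_foldr; apply: eq_bigr => x _; rewrite valM. Qed.

Lemma val_square_mul x y : code_val (kmul (kmul x x) y) = code_val x * code_val x * code_val y.
Proof. by rewrite !valM. Qed.

Lemma trace_scaleE : intval C trace_scale = 4 * 1728%:R * (4 * intval C 144) * (4 * intval C 144).
Proof.
have e : forall a b c : Z, intval C (a * b * (a * c) * (a * c))%ZZ =
    intval C a * intval C b * (intval C a * intval C c) * (intval C a * intval C c).
  by move=> a b c; rewrite !intvalM.
rewrite (e 4%ZZ 1728%ZZ 144%ZZ) -(intval_nat C 4).
by rewrite (intval_nat C 1728).
Qed.

Lemma sum_scale (I : eqType) (k u n : C) (s : seq I) (F G : I -> C) :
  {in s, forall x, k * (u * F x) = n * G x} -> k * (u * \sum_(x <- s) F x) = n * \sum_(x <- s) G x.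
Proof. by move=> h; rewrite !mulr_sumr; exact: eq_big_seq. Qed.

#[local] Opaque loop_value inv_dims loops inv_dim.

Lemma prod_ndim_neq0 g : \prod_(v <- g) (ndim v)%:C != 0.
Proof.
rewrite prodf_seq_neq0; apply/allP => v _; rewrite implyTb fmorph_eq0.
exact: lt0r_neq0 (ndim_gt0 v).
Qed.

Lemma val_trace_num T kappa : lowest_weight genA T kappa ->
  kappa * kappa * code_val (kmul (kmul (inv_dim VE0) (inv_dim VE0)) trace_num) =
  intval C trace_scale * \sum_(g <- loops 6 VE0) (T g * T (rev_loop g) /
    (\prod_(v <- g) (ndim v)%:C * ((ndim VE0)%:C * (ndim VE0)%:C))).
Proof.
move=> Tlw; have ok : generator_ok genA (words genA) by rewrite -wordsAE genA_ok.
rewrite (val_square_mul _ trace_num).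
rewrite (val_foldr_mul (fun g => inv_dims g (loop_value genA wordsA g))
  (fun g => loop_value genA wordsA (rev_loop g)) (loops 6 VE0)).
have -> : code_val (inv_dim VE0) = 2 / (ndim VE0)%:C.
  by rewrite val_inv_dim /dim_factor rmorphM fmorphV; congr (_ / _); exact: rmorph_nat.
rewrite trace_scaleE; apply: sum_scale => g /mem_loops[hg _].
rewrite val_inv_dims (prod_dim_factor hg).
have e1 := loop_valueE Tlw ok hg; have e2 := loop_valueE Tlw ok (is_loop_rev hg).
rewrite -wordsAE in e1 e2.
exact: (trace_term _ _ (prod_ndim_neq0 g) e1 e2).
Qed.

Lemma trace_arith (g t n s x k : C) : n != 0 -> k * t = n * s -> g * (t / n) = x -> g * s = k * x.
Proof.
move=> n0 e1 <-; apply: (mulfI n0); rewrite mulrCA -e1 [n * _]mulrC -mulrA.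
by rewrite -[g * (t / n) * n]mulrA divfK // mulrCA.
Qed.

(** The sum is the trace of A0^2 at the root of the graph, see [tilde_trace]. *)
Lemma trace_value T kappa : lowest_weight genA T kappa ->
  fval gamA * fval gamA * \sum_(g <- loops 6 VE0) (T g * T (rev_loop g) /
    (\prod_(v <- g) (ndim v)%:C * ((ndim VE0)%:C * (ndim VE0)%:C))) =
  kappa * kappa * ((9 + 2 * sqrt21 R) * s3 R)%:C.
Proof.
move=> Tlw; apply: (trace_arith _ (val_trace_num Tlw)); first exact: (intval_neq0 C (n := trace_scale) isT).
have := feqP R trace_ok; rewrite !fval_mul fval_1 (val_xc' 9 2 0 0) => ->.
by rewrite !intval_binary mul0r addr0; congr (_ +i* 0); ring.
Qed.

End Soundness.

(** * The graph 2221 and its dimensions *)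

Definition enc (v : vtx) : V2221 :=
  match v with
  | VC => None
  | VU0 => Some (inl (@Ordinal 4 0 isT)) | VU1 => Some (inl (@Ordinal 4 1 isT))
  | VU2 => Some (inl (@Ordinal 4 2 isT)) | VU3 => Some (inl (@Ordinal 4 3 isT))
  | VE0 => Some (inr (@Ordinal 3 0 isT)) | VE1 => Some (inr (@Ordinal 3 1 isT))
  | VE2 => Some (inr (@Ordinal 3 2 isT))
  end.

Definition dec (x : V2221) : vtx :=
  match x with
  | None => VC
  | Some (inl j) => match nat_of_ord j with 0 => VU0 | 1 => VU1 | 2 => VU2 | _ => VU3 end
  | Some (inr j) => match nat_of_ord j with 0 => VE0 | 1 => VE1 | _ => VE2 end
  end%N.

Lemma encK : cancel enc dec. Proof. by case. Qed.
Lemma decK : cancel dec enc.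
Proof.
case=> [[[m lt]|[m lt]]|] //.
  by case: m lt => [|[|[|[|m]]]] lt //; congr (Some (inl _)); apply: val_inj.
by case: m lt => [|[|[|m]]] lt //; congr (Some (inr _)); apply: val_inj.
Qed.
Lemma enc_inj : injective enc. Proof. exact: can_inj encK. Qed.

Lemma e2221_enc v w : e2221 (enc v) (enc w) = adj v w.
Proof. by case: v; case: w. Qed.

Lemma e2221_sym : symmetric e2221.
Proof. by move=> x y; rewrite -(decK x) -(decK y) !e2221_enc adj_sym. Qed.

Lemma u_enc : [/\ u 1 = enc VU1, u 2 = enc VU2 & u 3 = enc VU3].
Proof. by split; congr (Some (inl _)); apply: val_inj; rewrite /= inordK. Qed.

Section Sums.
Local Open Scope ring_scope.
Variable F : nmodType.

Lemma sum_V (P : pred V2221) (f : V2221 -> F) :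
  \sum_(x | P x) f x = \sum_(v <- all_vtx | P (enc v)) f (enc v).
Proof.
rewrite -(big_map enc P f); apply: perm_big; apply: uniq_perm.
- exact: index_enum_uniq.
- by rewrite (map_inj_uniq enc_inj).
- move=> x; rewrite mem_index_enum -(decK x) mem_map; last exact: enc_inj.
  by case: (dec x).
Qed.

Lemma sum_adj w (f : vtx -> F) : \sum_(v <- all_vtx | adj w v) f v = \sum_(v <- nbrs w) f v.
Proof. by case: w; rewrite !(big_cons, big_nil). Qed.

Lemma sum_nbrs w (f : V2221 -> F) :
  \sum_(x | e2221 (enc w) x) f x = \sum_(v <- nbrs w) f (enc v).
Proof.
by rewrite sum_V -(sum_adj w (f \o enc)); apply: eq_bigl => v; rewrite e2221_enc.
Qed.

Lemma sum_all w (f : vtx -> F) : (forall v, ~~ adj w v -> f v = 0) ->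
  \sum_(v <- all_vtx) f v = \sum_(v <- nbrs w) f v.
Proof.
move=> h; rewrite -sum_adj [RHS]big_mkcond; apply: eq_bigr => v _.
by case: ifPn => // /h.
Qed.

Lemma sum_pick w (f : vtx -> F) : \sum_(v <- all_vtx) (if v == w then f v else 0) = f w.
Proof. by case: w; rewrite !(big_cons, big_nil) /= ?add0r ?addr0. Qed.

Lemma sum_pair (f : 2.-tuple V2221 -> F) :
  \sum_(w : 2.-tuple V2221) f w =
  \sum_(x <- all_vtx) \sum_(y <- all_vtx) f [tuple enc x; enc y].
Proof.
rewrite (reindex (fun p : V2221 * V2221 => [tuple p.1; p.2])) /=; last first.
  exists (fun w : 2.-tuple V2221 => (tnth w ord0, tnth w (lift ord0 ord0))) => [[x y] //|w _].
  case: w => -[|x [|y [|z s]]] // h; exact: val_inj.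
rewrite -(pair_bigA _ (fun x y => f [tuple x; y])) /= sum_V; apply: eq_bigr => x _.
by rewrite sum_V.
Qed.

End Sums.

(** The distance to the root *)
Definition depth (v : vtx) : nat :=
  match v with VE0 => 0 | VU0 => 1 | VC => 2 | VU1 | VU2 | VU3 => 3 | _ => 4 end.

Lemma mem_ball k v : (enc v \in ball e2221 root2221 k) = (depth v <= k)%N.
Proof.
elim: k v => [|k IH] v.
  by rewrite inE -[root2221]/(Some (inr ord0)) (_ : Some (inr ord0) = enc VE0) ?(inj_eq enc_inj);
    [case: v|congr (Some (inr _)); apply: val_inj].
rewrite /ball iterS -/(ball e2221 root2221 k) !inE IH.
have -> : [exists x in ball e2221 root2221 k, e2221 x (enc v)] =
    has (fun u => (depth u <= k)%N && adj u v) all_vtx.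
  apply/existsP/hasP => [[x]|[w _ h]]; last first.
    by exists (enc w); rewrite e2221_enc IH.
  rewrite -(decK x) e2221_enc IH => h; exists (dec x) => //.
  by case: (dec x).
by case: v => /=; rewrite ?(andbT, andbF, orbF, orFb); lia.
Qed.

Lemma even_vertex_enc v : even_vertex e2221 root2221 (enc v) = is_even v.
Proof.
rewrite /even_vertex /dist (eq_find (a2 := fun k => (depth v <= k)%N)); last by move=> k; exact: mem_ball.
rewrite card_option card_sum !card_ord; by case: v.
Qed.

Section Dimensions.
Variable R : realType.
Local Open Scope ring_scope.
Local Open Scope complex_scope.
Local Notation C := R[i].
Local Notation ndim := (ndim R).

(** With D = delta^2 the eigenvector equations reduce to D^2 - 5 D + 1 = 0, and the
   positivity of the eigenvector gives D > 1, which selects the larger root. *)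
Lemma pf_solve (s delta c a0 a1 a2 b0 b1 b2 b3 : R) : s * s = 21 -> 4 < s ->
  0 < c -> 0 < a0 -> 0 < a1 -> 0 < a2 -> 0 < b0 ->
  b0 = delta * a0 -> b1 = delta * a1 -> b2 = delta * a2 ->
  c + a0 = delta * b0 -> c + a1 = delta * b1 -> c + a2 = delta * b2 ->
  c = delta * b3 -> b0 + (b1 + (b2 + b3)) = delta * c ->
  [/\ 0 < delta, delta * delta = (5 + s) / 2, a1 = a0 & a2 = a0].
Proof.
move=> ss s4 c0 p0 p1 p2 q0 e0 e1 e2 f0 f1 f2 f3 g.
have d0 : 0 < delta by rewrite -(pmulr_lgt0 _ p0) -e0.
set D := delta * delta.
have k0 : (D - 1) * a0 = c by rewrite mulrBl mul1r -mulrA -e0 -f0; ring.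
have k1 : (D - 1) * a1 = c by rewrite mulrBl mul1r -mulrA -e1 -f1; ring.
have k2 : (D - 1) * a2 = c by rewrite mulrBl mul1r -mulrA -e2 -f2; ring.
have D1 : 0 < D - 1 by rewrite -(pmulr_lgt0 _ p0) k0.
have n1 : D - 1 != 0 by rewrite gt_eqF.
have a10 : a1 = a0 by apply: (mulfI n1); rewrite k1 k0.
have a20 : a2 = a0 by apply: (mulfI n1); rewrite k2 k0.
have E : D * c = 4 * c + 3 * a0.
  have -> : D * c = delta * (b0 + (b1 + (b2 + b3))) by rewrite g mulrA.
  by rewrite !mulrDr -f0 -f1 -f2 -f3 a10 a20; ring.
have E2 : D * D - 5 * D + 1 = 0.
  apply: (mulIf (lt0r_neq0 p0)); rewrite mul0r.
  have -> : (D * D - 5 * D + 1) * a0 = D * ((D - 1) * a0) - (4 * ((D - 1) * a0) + 3 * a0) by ring.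
  by rewrite k0 E subrr.
split=> //; have : (2 * D - 5 - s) * (2 * D - 5 + s) = 0.
  have -> : (2 * D - 5 - s) * (2 * D - 5 + s) = 4 * (D * D - 5 * D + 1) + (21 - s * s) by ring.
  by rewrite E2 ss; ring.
move/eqP; rewrite mulf_eq0 => /orP[] /eqP h; first by lra.
by exfalso; lra.
Qed.

Variables (dim : V2221 -> R) (delta : R).
Hypothesis hdim : perron_frobenius e2221 dim delta.

Lemma pf_nbrs v : \sum_(w <- nbrs v) dim (enc w) = delta * dim (enc v).
Proof. by case: hdim => _ /(_ (enc v)); rewrite sum_nbrs. Qed.

Lemma pf_dim : delta = s3 R * (3 + sqrt21 R) / 6 /\
  forall v, dim (enc v) = dim center * ndim v.
Proof.
have [pos _] := hdim; have [hs _ h3 _] := bounds_all R.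
have e0 := pf_nbrs VE0; have e1 := pf_nbrs VE1; have e2 := pf_nbrs VE2.
have u0 := pf_nbrs VU0; have u1 := pf_nbrs VU1; have u2 := pf_nbrs VU2; have u3 := pf_nbrs VU3.
have c := pf_nbrs VC.
rewrite !(big_cons, big_nil) !addr0 in e0 e1 e2 u0 u1 u2 u3 c.
have s4 : 4 < sqrt21 R by lra.
have ss := sqr_s21 R; have s33 := sqr_s3 R.
have [d0 dd a1 a2] := pf_solve ss s4 (pos _) (pos _) (pos _) (pos _) (pos _) e0 e1 e2 u0 u1 u2 u3 c.
have dE : delta = s3 R * (3 + sqrt21 R) / 6.
  have h : 0 < s3 R * (3 + sqrt21 R) / 6.
    by rewrite divr_gt0 // mulr_gt0; lra.
  apply/eqP; rewrite -(@eqrXn2 _ 2 _ _ isT (ltW d0) (ltW h)) !expr2 dd; apply/eqP.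
  have -> : s3 R * (3 + sqrt21 R) / 6 * (s3 R * (3 + sqrt21 R) / 6) =
    (s3 R * s3 R) * (9 + 6 * sqrt21 R + sqrt21 R * sqrt21 R) / 36 by field.
  by rewrite s33 ss; field.
split=> //.
have aE : dim (enc VE0) = dim center * ((sqrt21 R - 3) / 6).
  have k : (delta * delta - 1) * dim (enc VE0) = dim center by rewrite mulrBl mul1r -mulrA -e0 -u0; ring.
  rewrite -k dd.
  have -> : ((5 + sqrt21 R) / 2 - 1) * dim (enc VE0) * ((sqrt21 R - 3) / 6) =
    (sqrt21 R * sqrt21 R - 9) / 12 * dim (enc VE0) by field.
  by rewrite ss; field.
have bE : delta * ((sqrt21 R - 3) / 6) = s3 R / 3.
  rewrite dE; have -> : s3 R * (3 + sqrt21 R) / 6 * ((sqrt21 R - 3) / 6) =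
    s3 R * (sqrt21 R * sqrt21 R - 9) / 36 by field.
  by rewrite ss; field.
have b3 : dim (enc VU3) = dim center * (s3 R * (sqrt21 R - 3) / 6).
  rewrite -[dim center]/(dim (enc VC)) u3 dE.
  have -> : s3 R * (3 + sqrt21 R) / 6 * dim (enc VU3) * (s3 R * (sqrt21 R - 3) / 6) =
    (s3 R * s3 R) * (sqrt21 R * sqrt21 R - 9) / 36 * dim (enc VU3) by field.
  by rewrite s33 ss; field.
case=> //; rewrite ?mulr1 // ?e0 ?e1 ?e2 ?a1 ?a2 ?aE //= -bE; ring.
Qed.

Lemma delta_ge2 : 2 <= delta.
Proof.
have [-> _] := pf_dim; have [h1 _ h3 _] := bounds_all R.
by have := mul_bounds _ _ h1 h3; lra.
Qed.

(** The weight of a turn is a quotient of two gauges, so that the weights of a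
   diagram telescope. *)
Definition gauge (v : vtx) : C := (Num.sqrt (ndim v))%:C.

Lemma gauge2 v : gauge v * gauge v = (ndim v)%:C.
Proof. by rewrite /gauge -rmorphM /= -expr2 sqr_sqrtr // ltW // ndim_gt0. Qed.

Lemma gauge_neq0 v : gauge v != 0.
Proof. by rewrite fmorph_eq0 gt_eqF // sqrtr_gt0 ndim_gt0. Qed.

Lemma dim_ratio v w : dim (enc v) / dim (enc w) = ndim v / ndim w.
Proof.
have [pos _] := hdim; have [_ h] := pf_dim; rewrite !h.
have c0 : dim center != 0 by rewrite gt_eqF.
by rewrite invfM mulrACA divff // mul1r.
Qed.

Lemma turn_enc v w : turn dim (enc v) (enc w) = gauge v / gauge w.
Proof.
rewrite /turn dim_ratio sqrtrM ?ltW ?ndim_gt0 // sqrtrV ?ltW ?ndim_gt0 //.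
by rewrite rmorphM fmorphV.
Qed.

End Dimensions.

#[local] Opaque ndim code_val.

(** * Diagrams as sums over walks *)

Section PlanarAlgebra.
Variable R : realType.
Local Open Scope ring_scope.
Local Open Scope complex_scope.
Local Notation C := R[i].
Local Notation ndim := (ndim R).
Local Notation gauge := (gauge R).
Variables (dim : V2221 -> R) (delta : R).
Hypothesis hdim : perron_frobenius e2221 dim delta.
Local Notation gpa3 s := (gpa R e2221 root2221 3 s).
Local Notation cap := (cap e2221 root2221 dim).
Local Notation cup := (cup root2221 dim).
Local Notation E p := (map enc p).

Lemma cycle_enc g : cycle e2221 (E g) = cycle adj g.
Proof. by case: g => //= x g; rewrite -map_rcons path_map; apply: eq_path => a b; exact: e2221_enc. Qed.

Lemma sorted_enc g : sorted e2221 (E g) = sorted adj g.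
Proof. by case: g => //= x g; rewrite path_map; apply: eq_path => a b; exact: e2221_enc. Qed.

Lemma gpa_at_loop s g : is_loop g -> is_even (nth VE0 g 0) = s ->
  exists l : loop e2221 root2221 3 s, \val (\val l) = E g /\
    forall x : gpa3 s, gpa_at x (E g) = x l.
Proof.
move=> h ev; have sz : size (E g) == 3.*2 by rewrite size_map; case/andP: h.
have ok : cycle e2221 (Tuple sz) && (even_vertex e2221 root2221 (head root2221 (Tuple sz)) == s).
  rewrite /= cycle_enc; move: ev; have [a0 [a1 [a2 [a3 [a4 [a5 e]]]]]] := loop6 h.
  by case/andP: h => _ ->; rewrite e /= even_vertex_enc => ->; rewrite eqxx.
exists (exist _ (Tuple sz) ok); split=> // x.
by rewrite /gpa_at insubT /= insubT.
Qed.

Lemma gpa_at_out s (x : gpa3 s) g :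
  ~~ (is_loop g && (is_even (nth VE0 g 0) == s)) -> gpa_at x (E g) = 0.
Proof.
move=> h; rewrite /gpa_at; case: insubP => //= t _ et.
have {}et : tval t = E g by exact: et.
case: insubP => //= l; rewrite et => /andP[cy ev] _; case/negP: h.
have sz : size g = 6 by rewrite -(size_map enc g) -et size_tuple.
have ev' : is_even (nth VE0 g 0) == s.
  move: ev; case: (g) sz => [|a g'] //= _.
  by rewrite even_vertex_enc.
by rewrite /is_loop sz ev' -cycle_enc cy.
Qed.

Lemma gpa_at_scale s (c : C) (x : gpa3 s) g : gpa_at (c *: x) g = c * gpa_at x g.
Proof.
rewrite /gpa_at; case: (insub g) => [t|] /=; last by rewrite mulr0.
by case: (insub t) => [l|] /=; rewrite ?mulr0 // ffunE.
Qed.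

Lemma cap_pull i phi l w r L : size l = i ->
  cap i phi (E (l ++ w :: r) ++ L) =
  \sum_(x <- nbrs w) gauge x / gauge w * phi (E (l ++ [:: w, x, w & r]) ++ L).
Proof.
move=> sl; rewrite map_cat /= -catA (capE _ _ _ _ _ _ (l := E l)) ?size_map //.
rewrite sum_nbrs; apply: eq_bigr => x _.
by rewrite (turn_enc hdim) map_cat /= -catA.
Qed.

Lemma caps3 i phi l w r L : size l = i ->
  caps e2221 root2221 dim i 3 phi (E (l ++ w :: r) ++ L) =
  \sum_(a <- nbrs w) \sum_(b <- nbrs a) \sum_(c <- nbrs b)
    gauge c / gauge w * phi (E (l ++ [:: w, a, b, c, b, a, w & r]) ++ L).
Proof.
move=> sl; rewrite /caps /= cap_pull //; apply: eq_bigr => a _.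
rewrite -cat_rcons cap_pull ?size_rcons ?sl // mulr_sumr; apply: eq_bigr => b _.
rewrite -cat_rcons cap_pull ?size_rcons ?sl // !mulr_sumr; apply: eq_bigr => c _.
rewrite !cat_rcons mulrA mulrA; congr (_ * _).
by field; rewrite !gauge_neq0.
Qed.

Lemma box_pull s (S : gpa3 s) i psi l a b c d r L : size l = i ->
  box S i psi (E (l ++ [:: a, b, c, d & r]) ++ L) =
  \sum_(x <- all_vtx) \sum_(y <- all_vtx)
    gpa_at S (E [:: a; b; c; d; x; y]) * psi (E (l ++ [:: a, y, x, d & r]) ++ L).
Proof.
move=> sl; rewrite /box sum_pair; apply: eq_bigr => x _; apply: eq_bigr => y _.
rewrite map_cat -catA; set l' := E l; have sl' : size l' = i by rewrite size_map.
congr (gpa_at _ _ * psi _).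
  by rewrite drop_cat sl' ltnn subnn /= take0.
have -> : take i.+1 (l' ++ E [:: a, b, c, d & r] ++ L) = l' ++ [:: enc a].
  by rewrite take_cat sl' ltnNge leqnSn /= subSnn.
have -> : drop (i + 3) (l' ++ E [:: a, b, c, d & r] ++ L) = enc d :: E r ++ L.
  by rewrite drop_cat sl' ltnNge leq_addr /= addnC addnK.
by rewrite map_cat -!catA.
Qed.

Lemma cup_pull i phi l x y z r L : size l = i ->
  cup i phi (E (l ++ [:: x, y, z & r]) ++ L) =
  if x == z then gauge y / gauge x * phi (E (l ++ x :: r) ++ L) else 0.
Proof.
move=> sl; rewrite !map_cat -!catA cupE ?size_map //= (inj_eq enc_inj).
by rewrite (turn_enc hdim).
Qed.

End PlanarAlgebra.

Section WalkSums.
Local Open Scope ring_scope.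
Variable F : nmodType.

Lemma sum_walks n v (f : seq vtx -> F) :
  \sum_(p <- walks n.+1 v) f p = \sum_(w <- nbrs v) \sum_(p <- walks n w) f (v :: p).
Proof. by rewrite /= big_flatten big_map; apply: eq_bigr => w _; rewrite big_map. Qed.

Lemma sum_walks0 v (f : seq vtx -> F) : \sum_(p <- walks 0 v) f p = f [:: v].
Proof. by rewrite big_seq1. Qed.

Lemma sum_walks3 v (f : seq vtx -> F) : \sum_(p <- walks 3 v) f p =
  \sum_(a <- nbrs v) \sum_(b <- nbrs a) \sum_(c <- nbrs b) f [:: v; a; b; c].
Proof.
rewrite sum_walks; apply: eq_bigr => a _; rewrite sum_walks; apply: eq_bigr => b _.
by rewrite sum_walks; apply: eq_bigr => c _; rewrite sum_walks0.
Qed.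

Lemma sum_walks4 v (f : seq vtx -> F) : \sum_(p <- walks 4 v) f p =
  \sum_(a <- nbrs v) \sum_(b <- nbrs a) \sum_(c <- nbrs b) \sum_(d <- nbrs c) f [:: v; a; b; c; d].
Proof.
rewrite sum_walks; apply: eq_bigr => a _; rewrite sum_walks; apply: eq_bigr => b _.
rewrite sum_walks; apply: eq_bigr => c _; rewrite sum_walks; apply: eq_bigr => d _.
by rewrite sum_walks0.
Qed.

Lemma sum_loops v (f : seq vtx -> F) : (forall g, ~~ is_loop g -> f g = 0) ->
  \sum_(g <- loops 6 v) f g =
  \sum_(a <- nbrs v) \sum_(b <- nbrs a) \sum_(c <- nbrs b)
    \sum_(x <- all_vtx) \sum_(y <- all_vtx) f [:: v; a; b; c; x; y].
Proof.
move=> f0; have f0' a0 a1 a2 a3 a4 a5 : ~~ cycle adj [:: a0; a1; a2; a3; a4; a5] -> f [:: a0; a1; a2; a3; a4; a5] = 0.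
  by move=> h; apply: f0.
rewrite /loops big_filter big_mkcond (eq_big_seq f); last first.
  move=> p /mem_walks[q [-> _ _]]; case: ifPn => // h; rewrite f0 // /is_loop negb_and /=.
  by rewrite rcons_path (negbTE h) andbF orbT.
rewrite sum_walks; apply: eq_bigr => a _; rewrite sum_walks; apply: eq_bigr => b _.
rewrite sum_walks; apply: eq_bigr => c _; rewrite (@sum_all _ c) => [|x h]; last first.
  by apply: big1 => y _; apply: f0'; rewrite /= (negbTE h) !andbF.
rewrite sum_walks; apply: eq_bigr => x _; rewrite (@sum_all _ x) => [|y h]; last first.
  by apply: f0'; rewrite /= (negbTE h) !andbF.
by rewrite sum_walks; apply: eq_bigr => y _; rewrite sum_walks0.
Qed.

Section Exchange.
Variables (I J : Type) (s : seq I) (t : seq J).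
Local Notation "\S_ a F" := (\sum_(a <- s) F) (at level 41, a name, F at level 41).
Local Notation "\T_ a F" := (\sum_(a <- t) F) (at level 41, a name, F at level 41).

(** The order of the state sum of S o T, in which the vertices around S come first
   and the walk q around T follows, is changed to the order in which the left half
   y, x, c, b of the bottom walk comes first. *)
Lemma exchange6 (f : I -> I -> I -> J -> I -> I -> F) :
  \S_a \S_b \S_c \T_q \S_x \S_y f a b c q x y = \S_y \S_x \S_c \S_b \T_q \S_a f a b c q x y.
Proof.
have m1 (A B : Type) (u : seq A) (v : seq B) (h : A -> B -> F) :
    \sum_(a <- u) \sum_(b <- v) h a b = \sum_(b <- v) \sum_(a <- u) h a b by exact: exchange_big.
transitivity (\S_y \S_a \S_b \S_c \T_q \S_x f a b c q x y).
  rewrite [RHS]m1; apply: eq_bigr => a _; rewrite [RHS]m1; apply: eq_bigr => b _.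
  rewrite [RHS]m1; apply: eq_bigr => c _; rewrite [RHS]m1; apply: eq_bigr => q _.
  exact: m1.
apply: eq_bigr => y _; transitivity (\S_x \S_a \S_b \S_c \T_q f a b c q x y).
  rewrite [RHS]m1; apply: eq_bigr => a _; rewrite [RHS]m1; apply: eq_bigr => b _.
  by rewrite [RHS]m1; apply: eq_bigr => c _; rewrite [RHS]m1.
apply: eq_bigr => x _; transitivity (\S_c \S_a \S_b \T_q f a b c q x y).
  by rewrite [RHS]m1; apply: eq_bigr => a _; rewrite [RHS]m1.
apply: eq_bigr => c _; rewrite m1; apply: eq_bigr => b _; exact: m1.
Qed.

End Exchange.
End WalkSums.

Section Expansions.
Variable R : realType.
Local Open Scope ring_scope.
Local Open Scope complex_scope.
Local Notation C := R[i].
Local Notation ndim := (ndim R).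
Local Notation gauge := (gauge R).
Variables (dim : V2221 -> R) (delta : R).
Hypothesis hdim : perron_frobenius e2221 dim delta.
Local Notation gpa3 s := (gpa R e2221 root2221 3 s).
Local Notation E p := (map enc p).
Local Notation G g k := (gauge (nth VC g k)).

(** In this gauge a cap becomes a sum with all coefficients 1, and the Fourier
   transform becomes the rotation by one step. *)
Definition tilde s (S : gpa3 s) (g : seq vtx) : C :=
  gpa_at S (E g) * (G g 1 * G g 2 * G g 4 * G g 5 * (G g 0 * G g 0) * (G g 3 * G g 3)).

Lemma hat_tilde s (S : gpa3 s) a0 a1 a2 a3 a4 a5 :
  hat (tilde S) [:: a0; a1; a2; a3; a4; a5] =
  gpa_at S (E [:: a0; a1; a2; a3; a4; a5]) / (gauge a1 * gauge a2 * gauge a4 * gauge a5).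
Proof.
rewrite /hat /tilde !big_cons big_nil mulr1 -!gauge2 /=.
by field; rewrite !gauge_neq0.
Qed.

Lemma tilde_out s (S : gpa3 s) g : ~~ is_loop g -> tilde S g = 0.
Proof. by move=> h; rewrite /tilde gpa_at_out ?mul0r // (negbTE h). Qed.

Lemma hat_out s (S : gpa3 s) g : ~~ is_loop g -> hat (tilde S) g = 0.
Proof. by move=> h; rewrite /hat tilde_out // mul0r. Qed.

Definition gauged (psi : seq V2221 -> C) (L : seq V2221) (p : seq vtx) : C :=
  psi (E p ++ L) * \prod_(v <- p) gauge v.

(** The three nested caps and the outer arc contribute the gauge of the middle vertex
   c of S divided by that of v0; with the gauges of S and of the bottom walk this
   leaves 1 / dim v for the base point v of S and the inverse cube of the gauge of
   v0. *)
Lemma jdiag_sum s (S : gpa3 s) psi v0 L :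
  jdiag dim S psi (enc v0 :: L) = (gauge v0)^-1 ^+ 3 * j_sum v0 (gauged psi L) (tilde S).
Proof.
rewrite /jdiag /= -[enc v0 :: L]/(E ([::] ++ v0 :: [::]) ++ L) (cap_pull hdim) //=.
rewrite /j_sum /jloops big_flatten big_map mulr_sumr; apply: eq_bigr => v _.
rewrite sum_loops => [|g /hat_out ->]; last by rewrite mulr0 mul0r.
rewrite -[[:: enc v0, enc v, enc v0 & L]]/(E ([:: v0] ++ v :: [:: v0]) ++ L) (caps3 hdim) //.
rewrite !mulr_sumr; apply: eq_bigr => a _; rewrite !mulr_sumr; apply: eq_bigr => b _.
rewrite !mulr_sumr; apply: eq_bigr => c _; rewrite (box_pull _ _ _ _ _ _ (l := [:: v0])) //.
rewrite !mulr_sumr; apply: eq_bigr => x _; rewrite !mulr_sumr; apply: eq_bigr => y _.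
rewrite hat_tilde /gauged /jpath /= !big_cons big_nil rmorphV ?unitfE ?gt_eqF ?ndim_gt0 //= -gauge2.
move: (gpa_at _ _) (psi _) => z t.
by field; rewrite !gauge_neq0.
Qed.

(** The two minima identify the last two vertices of T with two vertices of S, and
   the gauges combine to the dimension of the vertex a shared by the joining
   strings. *)
Lemma circ_sum_gauged s (S T : gpa3 s) psi v0 L :
  circ dim S T psi (enc v0 :: L) = (gauge v0)^-1 ^+ 3 * circ_sum v0 (gauged psi L) (tilde S) (tilde T).
Proof.
pose K a1 a2 a3 q x y : C := (ndim a1)%:C * (hat (tilde S) [:: v0; a1; a2; a3; x; y] *
  hat (tilde T) [:: v0; nth VC q 1; nth VC q 2; nth VC q 3; a2; a1]) *
  gauged psi L [:: v0; y; x; a3; a2; nth VC q 3; nth VC q 2; nth VC q 1; v0].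
have K0 a1 a2 a3 q x y : ~~ cycle adj [:: v0; a1; a2; a3; x; y] -> K a1 a2 a3 q x y = 0.
  by move=> h; rewrite /K hat_out // mul0r mulr0 mul0r.
have K1 a1 a2 a3 q x y : ~~ cycle adj [:: v0; nth VC q 1; nth VC q 2; nth VC q 3; a2; a1] -> K a1 a2 a3 q x y = 0.
  by move=> h; rewrite /K (@hat_out _ T) // !mulr0 mul0r.
transitivity ((gauge v0)^-1 ^+ 3 * \sum_(a1 <- all_vtx) \sum_(a2 <- all_vtx) \sum_(a3 <- all_vtx)
    \sum_(q <- walks 3 v0) \sum_(x <- all_vtx) \sum_(y <- all_vtx) K a1 a2 a3 q x y); last first.
  rewrite exchange6; congr (_ * _).
  rewrite /circ_sum sum_walks4; rewrite (@sum_all _ v0) => [|y h]; last first.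
    rewrite big1 // => x _; rewrite big1 // => a3 _; rewrite big1 // => a2 _; rewrite big1 // => q _.
    by rewrite big1 // => a1 _; apply: K0; rewrite /= [adj y v0]adj_sym (negbTE h) !andbF.
  apply: eq_bigr => y _; rewrite (@sum_all _ y) => [|x h]; last first.
    rewrite big1 // => a3 _; rewrite big1 // => a2 _; rewrite big1 // => q _.
    by rewrite big1 // => a1 _; apply: K0; rewrite /= [adj x y]adj_sym (negbTE h) !andbF.
  apply: eq_bigr => x _; rewrite (@sum_all _ x) => [|a3 h]; last first.
    rewrite big1 // => a2 _; rewrite big1 // => q _.
    by rewrite big1 // => a1 _; apply: K0; rewrite /= [adj a3 x]adj_sym (negbTE h) !andbF.
  apply: eq_bigr => a3 _; rewrite (@sum_all _ a3) => [|a2 h]; last first.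
    rewrite big1 // => q _.
    by rewrite big1 // => a1 _; apply: K0; rewrite /= [adj a2 a3]adj_sym (negbTE h) !andbF.
  apply: eq_bigr => a2 _; rewrite [RHS]big_mkcond [RHS]sum_walks4 sum_walks3.
  apply: eq_bigr => b1 _; apply: eq_bigr => b2 _; apply: eq_bigr => b3 _ /=.
  transitivity (\sum_(d <- nbrs b3) if d == a2 then \sum_(a1 <- all_vtx) K a1 d a3 [:: v0; b1; b2; b3] x y else 0).
    rewrite -(@sum_all _ b3) => [|d h]; last first.
      case: ifP => // _; rewrite big1 // => a1 _; apply: K1.
      by rewrite /= (negbTE h) !andbF.
    by rewrite sum_pick.
  apply: eq_bigr => d _; rewrite eq_sym; case: eqP => // <-.
  rewrite mulr_suml (@sum_all _ v0) => [|a1 h]; last by apply: K0; rewrite /= (negbTE h).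
  rewrite /mids big_filter [RHS]big_mkcond; apply: eq_bigr => a1 _ /=.
  by case: ifPn => // h; rewrite K0 // /= (negbTE h) !andbF.
rewrite /circ -[enc v0 :: L]/(E ([::] ++ v0 :: [::]) ++ L) [LHS](caps3 hdim) //.
rewrite (@sum_all _ v0) => [|a1 h]; last first.
  rewrite big1 // => a2 _; rewrite big1 // => a3 _; rewrite big1 // => q _; rewrite big1 // => x _.
  by rewrite big1 // => y _; apply: K0; rewrite /= (negbTE h).
rewrite mulr_sumr; apply: eq_bigr => a1 _; rewrite (@sum_all _ a1) => [|a2 h]; last first.
  rewrite big1 // => a3 _; rewrite big1 // => q _; rewrite big1 // => x _.
  by rewrite big1 // => y _; apply: K0; rewrite /= (negbTE h) !andbF.
rewrite mulr_sumr; apply: eq_bigr => a2 _; rewrite (@sum_all _ a2) => [|a3 h]; last first.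
  rewrite big1 // => q _; rewrite big1 // => x _.
  by rewrite big1 // => y _; apply: K0; rewrite /= (negbTE h) !andbF.
rewrite mulr_sumr; apply: eq_bigr => a3 _.
rewrite -[E _ ++ L]/(E ([:: v0; a1; a2; a3; a2; a1] ++ v0 :: [::]) ++ L) (caps3 hdim) // sum_walks3.
rewrite !mulr_sumr; apply: eq_bigr => b1 _; rewrite !mulr_sumr; apply: eq_bigr => b2 _.
rewrite !mulr_sumr; apply: eq_bigr => b3 _.
rewrite (box_pull _ _ _ _ _ _ (l := [::])) //.
rewrite !mulr_sumr; apply: eq_bigr => x _; rewrite !mulr_sumr; apply: eq_bigr => y _.
rewrite -[E _ ++ L]/(E ([:: v0; y; x; a3; a2; a1] ++ [:: v0, b1, b2, b3 & [:: b2; b1; v0]]) ++ L).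
rewrite (box_pull _ _ _ _ _ _ (l := [:: v0; y; x; a3; a2; a1])) //.
transitivity (gauge a3 / gauge v0 * (gauge b3 / gauge v0 * (gpa_at S (E [:: v0; a1; a2; a3; x; y]) *
   \sum_(z <- all_vtx) if z == a2 then \sum_(t <- all_vtx) if t == a1 then
     gpa_at T (E [:: v0; b1; b2; b3; z; t]) * (gauge v0 / gauge a1 * (gauge a1 / gauge a2 *
       psi (E [:: v0; y; x; a3; a2; b3; b2; b1; v0] ++ L))) else 0 else 0))).
  congr (_ * (_ * (_ * _))); apply: eq_bigr => z _.
  transitivity (\sum_(t <- all_vtx) if t == a1 then if z == a2 then
     gpa_at T (E [:: v0; b1; b2; b3; z; t]) * (gauge v0 / gauge a1 * (gauge a1 / gauge a2 *
       psi (E [:: v0; y; x; a3; a2; b3; b2; b1; v0] ++ L))) else 0 else 0); last first.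
    by case: eqP => // _; rewrite big1 // => t _; case: ifP.
  apply: eq_bigr => t _.
  rewrite -[cups _ _ _ _ _]/(cup root2221 dim 5 (cup root2221 dim 4 psi)).
  rewrite -[E _ ++ L]/(E ([:: v0; y; x; a3; a2] ++ [:: a1, v0, t & [:: z; b3; b2; b1; v0]]) ++ L).
  rewrite (cup_pull hdim _ _ _ _ _ (l := [:: v0; y; x; a3; a2])) // eq_sym; case: eqP => [->|_]; last by rewrite mulr0.
  rewrite -[E _ ++ L]/(E ([:: v0; y; x; a3] ++ [:: a2, a1, z & [:: b3; b2; b1; v0]]) ++ L).
  by rewrite (cup_pull hdim _ _ _ _ _ (l := [:: v0; y; x; a3])) // eq_sym; case: eqP => [->|_]; rewrite ?mulr0.
rewrite !sum_pick /K /= !hat_tilde /gauged !big_cons big_nil -gauge2.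
move: (gpa_at _ _) (gpa_at _ _) (psi _) => z w t.
by field; rewrite !gauge_neq0.
Qed.

End Expansions.

(** * The generators as harmonic functions *)

Section LowestWeight.
Variable R : realType.
Local Open Scope ring_scope.
Local Open Scope complex_scope.
Local Notation C := R[i].
Local Notation ndim := (ndim R).
Local Notation gauge := (gauge R).
Variables (dim : V2221 -> R) (delta : R).
Hypothesis hdim : perron_frobenius e2221 dim delta.
Local Notation gpa3 s := (gpa R e2221 root2221 3 s).
Local Notation E p := (map enc p).
Local Notation jw := (jones_wenzl e2221 root2221 dim delta).

Lemma gauged_harmonic psi v0 t : path adj v0 t ->
  (forall i, (i < 7)%N -> eq_on e2221 (7 + size t) (cap e2221 root2221 dim i psi) (fun=> 0)) ->
  harmonic 7 v0 (gauged psi (E t)).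
Proof.
move=> pt null l w r /and3P[s /eqP sz /eqP la].
have il : (size l < 7)%N by rewrite -sz size_cat /= addnS ltnS leq_addr.
have srt : sorted e2221 (E (l ++ w :: r) ++ E t).
  rewrite -map_cat sorted_enc; move: s la (sz); case: (l ++ w :: r) => //= a q pq e _.
  by rewrite cat_path pq e.
have sz' : size (E (l ++ w :: r) ++ E t) = (7 + size t)%N by rewrite size_cat !size_map sz.
have := null _ il _ sz' srt; rewrite (cap_pull hdim) // => h.
rewrite (eq_bigr (fun x => gauge w * (gauge w * \prod_(v <- l ++ w :: r) gauge v) *
   (gauge x / gauge w * psi (E (l ++ [:: w, x, w & r]) ++ E t)))).
  by rewrite -mulr_sumr h mulr0.
move=> x _; rewrite /gauged !big_cat /= !big_cons.
move: (psi _) (\prod_(v <- l) _) (\prod_(v <- r) _) => a b c.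
by field; rewrite gauge_neq0.
Qed.

Lemma jw_harmonic chi v0 t : path adj v0 t -> harmonic 7 v0 (gauged (jw 8 chi) (E t)).
Proof.
move=> pt; apply: gauged_harmonic => // i i7.
by apply: (cap_jw root2221 hdim e2221_sym (delta_ge2 hdim)); lia.
Qed.

Lemma tilde_scale s (c : C) (S : gpa3 s) g : tilde (c *: S) g = c * tilde S g.
Proof. by rewrite /tilde gpa_at_scale [RHS]mulrA. Qed.

Lemma fourier_weight a b c d :
  (Num.sqrt ((dim (enc a) * dim (enc b)) / (dim (enc c) * dim (enc d))))%:C =
  gauge a / gauge c * (gauge b / gauge d).
Proof.
have [pos _] := hdim; rewrite invfM mulrACA sqrtrM ?divr_ge0 ?ltW // rmorphM /=.
by congr (_ * _); exact: (turn_enc hdim).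
Qed.

Lemma tilde_fourier s (S : gpa3 s) g : is_loop g -> is_even (nth VE0 g 0) = ~~ s ->
  tilde (fourier dim S) g = tilde S (rot 1 g).
Proof.
move=> h ev; have [l [el hl]] := gpa_at_loop R h ev.
rewrite /tilde hl ffunE el.
have [a0 [a1 [a2 [a3 [a4 [a5 e]]]]]] := loop6 h; rewrite e /= fourier_weight.
move: (gpa_at _ _) => z; by field; rewrite !gauge_neq0.
Qed.

Lemma box_ind s (S : gpa3 s) w a b d x0 y0 :
  box S 0 (fun q => (q == E [:: w; y0; x0; d])%:R) (E [:: w; a; b; d]) =
  gpa_at S (E [:: w; a; b; d; x0; y0]).
Proof.
have := box_pull S (fun q => (q == E [:: w; y0; x0; d])%:R) w a b d [::] [::] (erefl (size ([::] : seq vtx))).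
rewrite cats0 => ->; rewrite -[RHS](sum_pick x0 (fun x => gpa_at S (E [:: w; a; b; d; x; y0]))).
apply: eq_bigr => x _.
rewrite -[in RHS](sum_pick y0 (fun y => gpa_at S (E [:: w; a; b; d; x; y]))).
case: eqP => [->|h]; last first.
  rewrite big1 // => y _; rewrite cats0 (inj_eq (inj_map enc_inj)) !eqseq_cons.
  by have /eqP/negbTE -> := h; rewrite !andbF mulr0.
apply: eq_bigr => y _; rewrite cats0 (inj_eq (inj_map enc_inj)) !eqseq_cons !eqxx !andbT /=.
by case: eqP => _; rewrite ?mulr1 ?mulr0.
Qed.

(** The generator x on the even loops and its dual on the odd ones: the equations to
   check are then the same for both parities of the base point. *)
Definition weight_map (sigma : C) (x : gpa3 true) (g : seq vtx) : C :=
  if is_even (nth VE0 g 0) then tilde x g else tilde (check dim sigma x) g.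

Definition letter_index (v : vtx) : nat := match v with VU1 => 1 | VU2 => 2 | _ => 3 end.

(** The words that no rotation brings into the table are those on which the
    generators vanish by definition. *)
Definition lists_values (X : generator) (values : seq (nat * nat * nat * C)) : Prop :=
  {in letters & &, forall a b c,
  if tab X a b c is Some t then (letter_index a, letter_index b, letter_index c, fval R t) \in values
  else [|| (tab X c a b : bool), (tab X b c a : bool), (a == b) && (b == c) |
     (a == VU3) && (b == VU3) || (b == VU3) && (c == VU3) || (c == VU3) && (a == VU3)]}.

Lemma u_letter v : v \in letters -> u (letter_index v) = enc v /\ letter_index v \in [:: 1; 2; 3]%N.
Proof. by have [h1 h2 h3] := u_enc; rewrite !inE => /or3P[]/eqP ->. Qed.

Section Generator.
Variables (X : generator) (kappa : R) (omega sigma : C) (values : seq (nat * nat * nat * C)).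
Variable x : gpa3 true.
Hypothesis spec : generator_spec dim kappa omega values x.
Hypothesis omegaE : omega = fval R (rotF X).
Hypothesis sigmaE : sigma^-1 = fval R (rotF X).
Hypothesis rotE : fval R (rotF X) * fval R (rotF X) = fval R (rot2F X).
Hypothesis tabE : lists_values X (values).

Local Notation T := (weight_map sigma x).

Lemma weight_null1 w a3 a4 a5 : is_even w ->
  \sum_(v <- nbrs w) T [:: w; v; w; a3; a4; a5] = 0.
Proof.
move=> ev; case: spec => -[/(_ 0%N isT) null _ _ _] _ _ _ _.
have := null (fun q => (q == E [:: w; a5; a4; a3])%:R) (E ([::] ++ w :: [:: a3]) ++ [::]).
rewrite /comp (cap_pull hdim) // => h.
rewrite (eq_bigr (fun v => (gauge w * gauge w * gauge a4 * gauge a5 * gauge w * gauge w * gauge a3 * gauge a3) *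
   (gauge v / gauge w * box x 0 (fun q => (q == E [:: w; a5; a4; a3])%:R)
      (E ([::] ++ [:: w, v, w & [:: a3]]) ++ [::])))).
  by rewrite -mulr_sumr h mulr0.
move=> v _; rewrite cats0 box_ind /weight_map /= ev /tilde /=.
move: (gpa_at _ _) => z; by field; rewrite !gauge_neq0.
Qed.

Lemma weight_null2 v w a4 a5 : is_even v ->
  \sum_(y <- nbrs w) T [:: v; w; y; w; a4; a5] = 0.
Proof.
move=> ev; case: spec => -[/(_ 1%N isT) null _ _ _] _ _ _ _.
have := null (fun q => (q == E [:: v; a5; a4; w])%:R) (E ([:: v] ++ w :: [::]) ++ [::]).
rewrite /comp (cap_pull hdim) // => h.
rewrite (eq_bigr (fun y => (gauge w * gauge a4 * gauge a5 * gauge v * gauge v * gauge w * gauge w * gauge w) *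
   (gauge y / gauge w * box x 0 (fun q => (q == E [:: v; a5; a4; w])%:R)
      (E ([:: v] ++ [:: w, y, w & [::]]) ++ [::])))).
  by rewrite -mulr_sumr h mulr0.
move=> y _; rewrite cats0 box_ind /weight_map /= ev /tilde /=.
move: (gpa_at _ _) => z; by field; rewrite !gauge_neq0.
Qed.

Lemma even_rot1 g : is_loop g -> is_even (nth VE0 (rot 1 g) 0) = ~~ is_even (nth VE0 g 0).
Proof.
move=> h; have [a0 [a1 [a2 [a3 [a4 [a5 e]]]]]] := loop6 h; move: h; rewrite e /is_loop /=.
by case/andP => h1 _; rewrite (adj_even h1).
Qed.

Lemma weight_rot g : is_loop g -> is_even (nth VE0 g 0) -> T (rot 2 g) = fval R (rotF X) * T g.
Proof.
move=> h ev; case: spec => _ hr _ _ _; rewrite /weight_map even_rot2 // ev -omegaE -tilde_scale -hr.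
have h1 : tilde (rho dim x) g = tilde (fourier dim x) (rot 1 g).
  exact: (@tilde_fourier (~~ true) (fourier dim x) g h ev).
have h2 : is_even (nth VE0 (rot 1 g) 0) = ~~ true by rewrite even_rot1 // ev.
rewrite [RHS]h1 (tilde_fourier _ (is_loop_rot 1 h) h2).
by congr (tilde x _); have [a0 [a1 [a2 [a3 [a4 [a5 ->]]]]]] := loop6 h.
Qed.

Lemma weight_odd g : is_loop g -> ~~ is_even (nth VE0 g 0) -> T g = fval R (rotF X) * T (rot 1 g).
Proof.
move=> h ev; rewrite /weight_map even_rot1 // (negbTE ev) /check tilde_scale sigmaE.
have ev' : is_even (nth VE0 g 0) = ~~ true by rewrite (negbTE ev).
by congr (_ * _); exact: (@tilde_fourier true x g h ev').
Qed.

Lemma weight_word a b c (z : C) :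
  gpa_at x (E (word (a, b, c))) = (kappa * Num.sqrt (dim (enc c) / dim (enc a)))%:C * z ->
  T (word (a, b, c)) = kappa%:C * (fval R (dimF b) * fval R (dimF c) * z).
Proof.
rewrite /weight_map /tilde /= !fval_dimF => ->; rewrite rmorphM /= -[(Num.sqrt _)%:C]/(turn dim _ _).
rewrite (turn_enc hdim) -!gauge2.
have g1 : gauge VC * gauge VC = 1 by rewrite gauge2.
have -> : forall k, k * (gauge c / gauge a) * z *
    (gauge a * gauge VC * gauge VC * gauge c * (gauge VC * gauge VC) * (gauge b * gauge b)) =
    k * (gauge b * gauge b * (gauge c * gauge c) * z) * (gauge VC * gauge VC) * (gauge VC * gauge VC).
  by move=> k; field; rewrite gauge_neq0.
by rewrite g1 !mulr1.
Qed.

Lemma weight_zero a b c : gpa_at x (E (word (a, b, c))) = 0 -> T (word (a, b, c)) = 0.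
Proof. by rewrite /weight_map /tilde /= => ->; rewrite mul0r. Qed.

Lemma ell_word a b c : a \in letters -> b \in letters -> c \in letters ->
  E (word (a, b, c)) = ell (letter_index a) (letter_index b) (letter_index c).
Proof.
by move=> /u_letter[ea _] /u_letter[eb _] /u_letter[ec _]; rewrite /ell ea eb ec.
Qed.

Lemma weight_triple a b c : a \in letters -> b \in letters -> c \in letters ->
  if tab X a b c is Some t then T (word (a, b, c)) = kappa%:C * (fval R (dimF b) * fval R (dimF c) * fval R t)
  else [|| tab X c a b : bool, tab X b c a : bool | T (word (a, b, c)) == 0].
Proof.
move=> ha hb hc; have := tabE ha hb hc; have ew := ell_word ha hb hc.
have [ea ia] := u_letter ha; have [eb ib] := u_letter hb; have [ec ic] := u_letter hc.
case: spec => _ _ [z1 z2] z3 sv; case: (tab X a b c) => [t|].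
  by move=> tv; apply: weight_word; rewrite ew (sv _ _ _ _ tv) ea ec.
case: (tab X c a b : bool) => //; case: (tab X b c a : bool) => //= h.
apply/eqP; apply: weight_zero; rewrite ew.
have z3' := z3 _ _ _ ia ib ic; move: h ha z3' => {ew ia ib ic ea eb ec hb hc}.
case: a => //; case: b => //; case: c => //= _ _ h; by [exact: z1|exact: z2|exact: h].
Qed.

Lemma word_rot a b c : a \in letters -> b \in letters -> c \in letters ->
  T (word (a, b, c)) = fval R (rotF X) * T (word (c, a, b)).
Proof.
move=> ha hb hc; rewrite -weight_rot //.
by move: ha hb hc; rewrite !inE => /or3P[]/eqP-> /or3P[]/eqP-> /or3P[]/eqP->.
Qed.

Lemma generator_weight : lowest_weight X T kappa%:C.
Proof.
split.
- by move=> w a3 a4 a5 ev _; exact: weight_null1.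
- by move=> v w a4 a5 ev _; exact: weight_null2.
- exact: weight_rot.
- exact: weight_odd.
case=> -[a b] c tt.
have [ha hb hc] : [/\ a \in letters, b \in letters & c \in letters].
  by move: tt; case: a; case: b; case: c.
have r1 := word_rot ha hb hc; have r2 := word_rot hc ha hb.
have := weight_triple ha hb hc; have := weight_triple hc ha hb; have := weight_triple hb hc ha.
rewrite /word_value /cyc_value.
case: (tab X a b c) => [t|] /=; first by move=> _ _ ->; rewrite !fval_mul.
case: (tab X c a b) => [t|] /=; first by move=> _ e _; rewrite r1 e !fval_mul; ring.
case: (tab X b c a) => [t|] /=; first by move=> e _ _; rewrite r1 r2 e !fval_mul -rotE; ring.
by move=> _ _ /eqP ->; rewrite fval_int intval_0 mulr0.
Qed.

End Generator.

End LowestWeight.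

(** * The trace and the normalisation of the generators *)

Section Trace.
Variable R : realType.
Local Open Scope ring_scope.
Local Open Scope complex_scope.
Local Notation C := R[i].
Local Notation ndim := (ndim R).
Local Notation gauge := (gauge R).
Variables (dim : V2221 -> R) (delta : R).
Hypothesis hdim : perron_frobenius e2221 dim delta.
Local Notation gpa3 s := (gpa R e2221 root2221 3 s).
Local Notation E p := (map enc p).

Lemma gpa_mul_at s (x y : gpa3 s) a0 a1 a2 a3 b1 b2 :
  is_loop [:: a0; a1; a2; a3; b1; b2] -> is_even a0 = s ->
  gpa_at (gpa_mul x y) (E [:: a0; a1; a2; a3; b1; b2]) =
  \sum_(z <- all_vtx) \sum_(t <- all_vtx)
    gpa_at x (E [:: a0; a1; a2; a3; z; t]) * gpa_at y (E [:: a0; t; z; a3; b1; b2]).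
Proof.
move=> h ev; have [l [el hl]] := gpa_at_loop R h ev.
rewrite hl /gpa_mul /to_gpa ffunE el.
have -> : top_labels 3 (E [:: a0; a1; a2; a3; b1; b2]) = E ([::] ++ [:: a0, a1, a2, a3 & [::]]) ++ [::] by [].
rewrite /comp (box_pull _ _ _ _ _ _ (l := [::])) //; apply: eq_bigr => z _; apply: eq_bigr => t _.
congr (_ * _); exact: box_ind.
Qed.

Lemma gpa_tr_mul s (x y : gpa3 s) v : is_even v = s ->
  gpa_tr dim (gpa_mul x y) (enc v) =
  \sum_(g <- loops 6 v) (ndim (nth VC g 3) / ndim v)%:C * (gpa_at x (E g) * gpa_at y (E (rev_loop g))).
Proof.
move=> ev; rewrite sum_loops => [|g h]; last by rewrite gpa_at_out ?mul0r ?mulr0 // (negbTE h).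
rewrite /gpa_tr; set ind := (fun q => _); rewrite -[[:: enc v]]/(E ([::] ++ v :: [::]) ++ [::]) /comp (caps3 hdim) //.
rewrite big_seq [RHS]big_seq; apply: eq_bigr => a; rewrite mem_nbrs => va.
rewrite big_seq [RHS]big_seq; apply: eq_bigr => b; rewrite mem_nbrs => ab.
rewrite big_seq [RHS]big_seq; apply: eq_bigr => c; rewrite mem_nbrs => bc.
have lp : is_loop [:: v; a; b; c; b; a].
  by rewrite /is_loop /= va ab bc [adj c b]adj_sym bc [adj b a]adj_sym ab [adj a v]adj_sym va.
transitivity ((ndim c / ndim v)%:C * gpa_at (gpa_mul x y) (E [:: v; a; b; c; b; a])); last first.
  rewrite gpa_mul_at // mulr_sumr; apply: eq_bigr => z _.
  by rewrite mulr_sumr; apply: eq_bigr => t _.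
rewrite -[E _ ++ _]/(E ([::] ++ [:: v, a, b, c & [:: b; a; v]]) ++ [::]) (box_pull _ _ _ _ _ _ (l := [::])) //.
transitivity (gauge c / gauge v * \sum_(z <- all_vtx) if z == b then \sum_(t <- all_vtx)
  if t == a then gpa_at (gpa_mul x y) (E [:: v; a; b; c; z; t]) *
    (gauge c / gauge b * (gauge b / gauge a * (gauge a / gauge v))) else 0 else 0); last first.
  rewrite !sum_pick rmorphM fmorphV /= -!gauge2.
  by move: (gpa_at _ _) => k; field; rewrite !gauge_neq0.
congr (_ * _); apply: eq_bigr => z _.
transitivity (\sum_(t <- all_vtx) if t == a then if z == b then gpa_at (gpa_mul x y) (E [:: v; a; b; c; z; t]) *
    (gauge c / gauge b * (gauge b / gauge a * (gauge a / gauge v))) else 0 else 0); last first.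
  by case: eqP => // _; rewrite big1 // => t _; case: ifP.
apply: eq_bigr => t _.
rewrite -[cups _ _ _ _ _]/(cup root2221 dim 2 (cup root2221 dim 1 (cup root2221 dim 0 ind))).
rewrite -[E _ ++ [::]]/(E ([:: v; t] ++ [:: z, c, b & [:: a; v]]) ++ [::]).
rewrite (cup_pull hdim _ _ _ _ _ (l := [:: v; t])) //; case: eqP => [->|_]; last by rewrite mulr0; case: ifP.
rewrite -[E _ ++ [::]]/(E ([:: v] ++ [:: t, b, a & [:: v]]) ++ [::]).
rewrite (cup_pull hdim _ _ _ _ _ (l := [:: v])) //; case: eqP => [->|_]; last by rewrite !mulr0.
rewrite -[E _ ++ [::]]/(E ([::] ++ [:: v, a, v & [::]]) ++ [::]).
rewrite (cup_pull hdim _ _ _ _ _ (l := [::])) // eqxx.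
by rewrite /ind cats0 eqxx mulr1.
Qed.

Lemma tilde_trace s (x y : gpa3 s) g : is_loop g ->
  tilde x g * tilde y (rev_loop g) /
    (\prod_(v <- g) (ndim v)%:C * ((ndim (nth VC g 0))%:C * (ndim (nth VC g 0))%:C)) =
  (ndim (nth VC g 3) / ndim (nth VC g 0))%:C * (gpa_at x (E g) * gpa_at y (E (rev_loop g))).
Proof.
move=> h; have [a0 [a1 [a2 [a3 [a4 [a5 ->]]]]]] := loop6 h.
rewrite /tilde !big_cons big_nil rmorphM fmorphV /= -!gauge2.
move: (gpa_at _ _) (gpa_at _ _) => z t.
by field; rewrite !gauge_neq0.
Qed.

Lemma trace_norm : 3 * Num.sqrt (55 + 12 * sqrt21 R) = (9 + 2 * sqrt21 R) * s3 R.
Proof.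
have [h1 _ h3 _] := bounds_all R; have ss := sqr_s21 R; have s33 := sqr_s3 R.
have -> : 55 + 12 * sqrt21 R = ((9 + 2 * sqrt21 R) * s3 R / 3) ^+ 2.
  have -> : ((9 + 2 * sqrt21 R) * s3 R / 3) ^+ 2 =
    (81 + 36 * sqrt21 R + 4 * (sqrt21 R * sqrt21 R)) * (s3 R * s3 R) / 9 by field.
  by rewrite ss s33; field.
rewrite sqrtr_sqr ger0_norm; first by field.
by rewrite divr_ge0 // mulr_ge0 //; lra.
Qed.

Lemma sqr_cancel (k q a c : C) : c != 0 -> q * q * a = k * k * c -> q * q * a = c -> k * k = 1.
Proof. by move=> c0 -> /(canRL (mulfK c0)) ->; rewrite divff. Qed.

(** The trace of A^2 is kappa^2 times its value for kappa = 1, which is the prescribed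
   one. *)
Lemma kappa_eq1 (kappa : R) (x : gpa3 true) (sigma : C) : 0 < kappa ->
  lowest_weight genA (weight_map dim sigma x) kappa%:C ->
  gpa_tr dim (gpa_mul (gamma_A R *: x) (gamma_A R *: x)) (enc VE0) =
    (3 * Num.sqrt (55 + 12 * sqrt21 R))%:C ->
  kappa = 1.
Proof.
move=> k0 lw; rewrite trace_norm (@gpa_tr_mul true) // gamma_A_fval => tr.
have tv := trace_value lw.
have k2 : kappa%:C * kappa%:C = 1.
  apply: (sqr_cancel _ tv).
    have [h1 _ h3 _] := bounds_all R.
    by rewrite fmorph_eq0 gt_eqF // mulr_gt0; lra.
  rewrite -[RHS]tr mulr_sumr; apply: eq_big_seq => g /mem_loops[lg g0].
  have ev : is_even (nth VE0 g 0) by rewrite g0.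
  have g0' : nth VC g 0 = VE0 by rewrite -g0; have [a0 [a1 [a2 [a3 [a4 [a5 ->]]]]]] := loop6 lg.
  have g1 : nth VE0 (rev_loop g) 0 = VE0 by rewrite -g0; have [a0 [a1 [a2 [a3 [a4 [a5 ->]]]]]] := loop6 lg.
  rewrite /weight_map ev g1 /= -g0' tilde_trace // !gpa_at_scale.
  move: (fval _ _) (gpa_at _ _) (gpa_at _ _) (_%:C) => a b c d; ring.
move: k2; rewrite -rmorphM => /complexI kk.
apply/eqP; rewrite -(@eqrXn2 _ 2 _ _ isT (ltW k0) ler01) expr2 kk expr1n //.
Qed.

End Trace.

(** * The jellyfish relations *)

Section Relations.
Variable R : realType.
Local Open Scope ring_scope.
Local Open Scope complex_scope.
Local Notation C := R[i].
Local Notation ndim := (ndim R).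
Local Notation gauge := (gauge R).
Variables (dim : V2221 -> R) (delta : R).
Hypothesis hdim : perron_frobenius e2221 dim delta.
Local Notation gpa3 s := (gpa R e2221 root2221 3 s).
Local Notation E p := (map enc p).

(** Every diagram is evaluated on the same function chi, the indicator of the bottom
   labels bent upwards, and at the same walk v0 :: t. *)
Lemma bottom_at s (gamma : loop e2221 root2221 4 s) : exists v0 t (chi : seq V2221 -> C),
  [/\ path adj v0 t, is_even v0 = s &
      forall D : diagram R V2221, @to_gpa_bottom R V2221 e2221 root2221 dim 4 s D gamma = D chi (enc v0 :: E t)].
Proof.
have /andP[cy ev] := svalP gamma.
have [g eg sz] : exists2 g, \val (\val gamma) = E g & size g = 8.
  exists (map dec (\val (\val gamma))); first by rewrite (mapK decK).
  by rewrite size_map size_tuple.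
rewrite -[tval _]/(\val (\val gamma)) eg in cy ev.
case: g sz eg cy ev => // v0 h _ eg cy ev.
exists v0, (take 4 h), (cups root2221 dim 4 4 (fun q => (q == bottom_labels root2221 4 (E (v0 :: h)))%:R)).
split.
- rewrite cycle_enc /= in cy; apply: take_path; move: cy.
  by rewrite rcons_path => /andP[].
- by move: ev; rewrite /= even_vertex_enc => /eqP.
by move=> D; rewrite /to_gpa_bottom /to_gpa ffunE eg /top_labels /= map_take.
Qed.

Lemma hat_ext (T U : seq vtx -> C) c g : T g = c * U g -> hat T g = c * hat U g.
Proof. by move=> h; rewrite /hat h mulrA. Qed.

Lemma j_sum_ext v0 f (T U : seq vtx -> C) c :
  (forall g, is_loop g -> is_even (nth VE0 g 0) = ~~ is_even v0 -> T g = c * U g) ->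
  j_sum v0 f T = c * j_sum v0 f U.
Proof.
move=> h; rewrite /j_sum mulr_sumr; apply: eq_big_seq => g /flattenP[_ /mapP[v vv0 ->]] /mem_loops[lg g0].
rewrite (hat_ext (h g lg _)); last by rewrite g0 (@adj_even v0) -?mem_nbrs.
by move: (_^-1%:C) (hat _ _) (f _) => a b d; ring.
Qed.

Lemma circ_sum_ext v0 f (T U T' U' : seq vtx -> C) c c' :
  (forall g, is_loop g -> is_even (nth VE0 g 0) = is_even v0 -> T g = c * U g) ->
  (forall g, is_loop g -> is_even (nth VE0 g 0) = is_even v0 -> T' g = c' * U' g) ->
  circ_sum v0 f T T' = c * c' * circ_sum v0 f U U'.
Proof.
move=> h h'; rewrite /circ_sum mulr_sumr; apply: eq_big_seq => l hl; rewrite mulr_sumr.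
rewrite big_seq_cond [RHS]big_seq_cond; apply: eq_bigr => r /andP[hr /eqP e].
rewrite mulrA mulr_sumr; congr (_ * _); apply: eq_big_seq => a am.
have [ll lr] := is_loop_mids hl hr e am.
rewrite (hat_ext (h _ ll erefl)) (hat_ext (h' _ lr erefl)).
by move: (_%:C) (hat _ _) (hat _ _) => x y z; ring.
Qed.

Lemma jellyfish s (S : gpa3 (~~ s)) (A B : gpa3 s) (c a b r1 r2 r3 r4 : C)
    (TS TA TB : seq vtx -> C) v0 psi L : is_even v0 = s ->
  (forall g, is_loop g -> is_even (nth VE0 g 0) = ~~ s -> tilde S g = c * TS g) ->
  (forall g, is_loop g -> is_even (nth VE0 g 0) = s -> tilde A g = a * TA g) ->
  (forall g, is_loop g -> is_even (nth VE0 g 0) = s -> tilde B g = b * TB g) ->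
  (c * j_sum v0 (gauged psi L) TS =
     r1 * (a * a) * circ_sum v0 (gauged psi L) TA TA + r2 * (a * b) * circ_sum v0 (gauged psi L) TA TB +
     r3 * (a * b) * circ_sum v0 (gauged psi L) TB TA + r4 * (b * b) * circ_sum v0 (gauged psi L) TB TB) ->
  jdiag dim S psi (enc v0 :: L) =
    r1 * circ dim A A psi (enc v0 :: L) + r2 * circ dim A B psi (enc v0 :: L) +
    r3 * circ dim B A psi (enc v0 :: L) + r4 * circ dim B B psi (enc v0 :: L).
Proof.
move=> ev hS hA hB eq; rewrite (jdiag_sum hdim) !(circ_sum_gauged hdim).
have hS' g : is_loop g -> is_even (nth VE0 g 0) = ~~ is_even v0 -> tilde S g = c * TS g by rewrite ev; exact: hS.
have hA' g : is_loop g -> is_even (nth VE0 g 0) = is_even v0 -> tilde A g = a * TA g by rewrite ev; exact: hA.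
have hB' g : is_loop g -> is_even (nth VE0 g 0) = is_even v0 -> tilde B g = b * TB g by rewrite ev; exact: hB.
rewrite (j_sum_ext _ hS') eq (circ_sum_ext _ hA' hA') (circ_sum_ext _ hA' hB').
rewrite (circ_sum_ext _ hB' hA') (circ_sum_ext _ hB' hB').
move: (circ_sum _ _ _ _) (circ_sum _ _ _ _) (circ_sum _ _ _ _) (circ_sum _ _ _ _) (_ ^+ 3).
by move=> x y z w n; ring.
Qed.

Lemma tilde_check (sigma c : C) (x : gpa3 true) g : is_loop g -> is_even (nth VE0 g 0) = ~~ true ->
  tilde (check dim sigma (c *: x)) g = c * weight_map dim sigma x g.
Proof.
move=> h ev; rewrite /weight_map ev /check !tilde_scale.
have e1 : tilde (fourier dim (c *: x)) g = tilde (c *: x) (rot 1 g) by exact: (@tilde_fourier _ _ _ hdim true _ _ h ev).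
have e2 : tilde (fourier dim x) g = tilde x (rot 1 g) by exact: (@tilde_fourier _ _ _ hdim true _ _ h ev).
by rewrite [X in _ * X = _]e1 [X in _ = _ * (_ * X)]e2 tilde_scale mulrCA.
Qed.

Lemma tilde_even (sigma c : C) (x : gpa3 true) g : is_even (nth VE0 g 0) = true ->
  tilde (c *: x) g = c * weight_map dim sigma x g.
Proof. by move=> ev; rewrite /weight_map ev tilde_scale. Qed.

End Relations.

Section Assembly.
Variable R : realType.
Local Open Scope ring_scope.
Local Open Scope complex_scope.
Local Notation C := R[i].
Variables (dim : V2221 -> R) (delta : R).
Hypothesis hdim : perron_frobenius e2221 dim delta.
Local Notation gpa3 s := (gpa R e2221 root2221 3 s).
Local Notation E p := (map enc p).
Local Notation jw := (jones_wenzl e2221 root2221 dim delta).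

Lemma combination_at (s : bool) (r1 r2 r3 r4 : C) (F1 F2 F3 F4 : gpa R e2221 root2221 4 s) g :
  (r1 *: F1 + r2 *: F2 + r3 *: F3 + r4 *: F4) g = r1 * F1 g + r2 * F2 g + r3 * F3 g + r4 * F4 g.
Proof. by rewrite !ffunE. Qed.

Lemma relation_ext s (S : gpa3 (~~ s)) (A B : gpa3 s) (r1 r2 r3 r4 : C) :
  (forall v0 t chi, path adj v0 t -> is_even v0 = s ->
     jdiag dim S (jw 8 chi) (enc v0 :: E t) =
       r1 * circ dim A A (jw 8 chi) (enc v0 :: E t) + r2 * circ dim A B (jw 8 chi) (enc v0 :: E t) +
       r3 * circ dim B A (jw 8 chi) (enc v0 :: E t) + r4 * circ dim B B (jw 8 chi) (enc v0 :: E t)) ->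
  @to_gpa_bottom R V2221 e2221 root2221 dim 4 s (jdiag dim S \o jw 8) =
    r1 *: f_circ dim delta A A + r2 *: f_circ dim delta A B +
    r3 *: f_circ dim delta B A + r4 *: f_circ dim delta B B.
Proof.
move=> h; apply/ffunP => g; have [v0 [t [chi [pt ev D]]]] := bottom_at dim g.
have e x y : f_circ dim delta x y g = circ dim x y (jw 8 chi) (enc v0 :: E t).
  exact: (D (circ dim x y \o jw 8)).
have sum_eq (x y z w x' y' z' w' : C) : x = x' -> y = y' -> z = z' -> w = w' ->
    r1 * x + r2 * y + r3 * z + r4 * w = r1 * x' + r2 * y' + r3 * z' + r4 * w'.
  by move=> -> -> -> ->.
apply: (etrans (D _)); apply: (etrans (h v0 t chi pt ev)); apply: esym.
apply: (etrans (combination_at _ _ _ _ _ _ _ _ _)).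
exact: (sum_eq _ _ _ _ _ _ _ _ (e A A) (e A B) (e B A) (e B B)).
Qed.

Lemma value_table_mem (a b c d e f : C) :
  let T := value_table a b c d e f in
  [/\ (1, 1, 2, a)%N \in T, (1, 2, 2, b)%N \in T, (1, 1, 3, c)%N \in T &
   [/\ (2, 2, 3, d)%N \in T, (1, 2, 3, e)%N \in T & (1, 3, 2, f)%N \in T]].
Proof. by split; last split; rewrite !inE eqxx ?orbT. Qed.

Lemma A_tabE : lists_values genA (A_values R).
Proof.
have [h1 h2 h3 [h4 h5 h6]] := value_table_mem (fval R A112) (fval R A122) (fval R A113)
  (fval R A113) (fval R A123) (fval R A132).
rewrite -A_values_fval in h1 h2 h3 h4 h5 h6.
move=> a b c; rewrite !inE => /or3P[]/eqP-> /or3P[]/eqP-> /or3P[]/eqP->;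
  by [|exact: h1|exact: h2|exact: h3|exact: h4|exact: h5|exact: h6].
Qed.

Lemma B_tabE : lists_values genB (B_values R).
Proof.
have [h1 h2 h3 [h4 h5 h6]] := value_table_mem (fval R B112) (fval R B122) (fval R B113)
  (fval R B113) (fval R B123) (fval R B132).
rewrite -B_values_fval in h1 h2 h3 h4 h5 h6.
move=> a b c; rewrite !inE => /or3P[]/eqP-> /or3P[]/eqP-> /or3P[]/eqP->;
  by [|exact: h1|exact: h2|exact: h3|exact: h4|exact: h5|exact: h6].
Qed.

Lemma weight_A kappa A0 : generator_spec dim kappa (omega_A R) (A_values R) A0 ->
  lowest_weight genA (weight_map dim (sigma_A R) A0) kappa%:C.
Proof.
move=> spec; apply: (generator_weight hdim (X := genA) spec (omega_A_fval R) (sigma_A_fval R) _ A_tabE).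
by have /(feqP R) : feqb (fmul omA omA) omA2 by []; rewrite fval_mul.
Qed.

Lemma fval_one : fval R (fint 1) = 1.
Proof. by rewrite fval_int intval_1. Qed.

Lemma weight_B kappa B0 : generator_spec dim kappa (omega_B R) (B_values R) B0 ->
  lowest_weight genB (weight_map dim (sigma_B R) B0) kappa%:C.
Proof.
move=> spec; apply: (generator_weight hdim (X := genB) spec _ _ _ B_tabE).
- by rewrite fval_one.
- by rewrite /sigma_B invr1 fval_one.
by rewrite !fval_one mulr1.
Qed.

Lemma coefficient (r : C) x y z : r = fval R x ->
  fval R (fmul x (fmul y z)) = r * (fval R y * fval R z).
Proof. by move=> ->; rewrite !fval_mul. Qed.

Lemma subst_coefficients (j a b c d x y z w a' b' c' d' : C) :
  j = a * x + b * y + c * z + d * w -> a = a' -> b = b' -> c = c' -> d = d' ->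
  j = a' * x + b' * y + c' * z + d' * w.
Proof. by move=> -> -> -> -> ->. Qed.

End Assembly.

Local Open Scope ring_scope.
Local Open Scope complex_scope.

Theorem lemma4p13 (R : realType) (dim : V2221 -> R) (delta : R)
    (hdim : perron_frobenius e2221 dim delta)
    (kappa : R) (A0 B0 : gpa R e2221 root2221 3 true)
    (hkappa : 0 < kappa)
    (hA0 : generator_spec dim kappa (omega_A R) (A_values R) A0)
    (hB0 : generator_spec dim kappa (omega_B R) (B_values R) B0)
    (hTr : forall v : V2221, even_vertex e2221 root2221 v ->
       gpa_tr dim (gpa_mul (gamma_A R *: A0) (gamma_A R *: A0)) v
         = (3 * Num.sqrt (55 + 12 * sqrt21 R))%:C) :
  let A : gpa R e2221 root2221 3 true := gamma_A R *: A0 in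
  let B : gpa R e2221 root2221 3 true := gamma_B R *: B0 in
  let A' : gpa R e2221 root2221 3 false := check dim (sigma_A R) A in
  let B' : gpa R e2221 root2221 3 false := check dim (sigma_B R) B in
  ((f_j dim delta A' : gpa R e2221 root2221 4 true) =
     r11 R *: f_circ dim delta A A + r12 R *: f_circ dim delta A B
     + r13 R *: f_circ dim delta B A + r14 R *: f_circ dim delta B B /\
   (f_j dim delta B' : gpa R e2221 root2221 4 true) =
     r21 R *: f_circ dim delta A A + r22 R *: f_circ dim delta A B
     + r23 R *: f_circ dim delta B A + r24 R *: f_circ dim delta B B) /\
  ((f_j dim delta A : gpa R e2221 root2221 4 false) =
     r11 R *: f_circ dim delta A' A' + r12 R *: f_circ dim delta A' B'
     + r13 R *: f_circ dim delta B' A' + r14 R *: f_circ dim delta B' B' /\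
   (f_j dim delta B : gpa R e2221 root2221 4 false) =
     r21 R *: f_circ dim delta A' A' + r22 R *: f_circ dim delta A' B'
     + r23 R *: f_circ dim delta B' A' + r24 R *: f_circ dim delta B' B').
Proof.
have lwA := weight_A hdim hA0; have lwB := weight_B hdim hB0.
have k1 : kappa = 1.
  by apply: (kappa_eq1 hdim hkappa lwA); apply: hTr; rewrite even_vertex_enc.
rewrite k1 rmorph1 in lwA lwB.
set TA := weight_map dim (sigma_A R) A0 in lwA; set TB := weight_map dim (sigma_B R) B0 in lwB.
move=> A B A' B'.
have evenA g : is_loop g -> is_even (nth VE0 g 0) = true -> tilde A g = fval R gamA * TA g.
  by move=> _ ev; rewrite /A gamma_A_fval; exact: tilde_even.
have evenB g : is_loop g -> is_even (nth VE0 g 0) = true -> tilde B g = fval R gamB * TB g.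
  by move=> _ ev; rewrite /B gamma_B_fval; exact: tilde_even.
have oddA g : is_loop g -> is_even (nth VE0 g 0) = ~~ true -> tilde A' g = fval R gamA * TA g.
  by move=> h ev; rewrite /A' /A gamma_A_fval; exact: (tilde_check hdim).
have oddB g : is_loop g -> is_even (nth VE0 g 0) = ~~ true -> tilde B' g = fval R gamB * TB g.
  by move=> h ev; rewrite /B' /B gamma_B_fval; exact: (tilde_check hdim).
have relA v0 t chi : path adj v0 t ->
    let f := gauged (jones_wenzl e2221 root2221 dim delta 8 chi) (map enc t) in
    fval R gamA * j_sum v0 f TA =
      r11 R * (fval R gamA * fval R gamA) * circ_sum v0 f TA TA +
      r12 R * (fval R gamA * fval R gamB) * circ_sum v0 f TA TB +
      r13 R * (fval R gamA * fval R gamB) * circ_sum v0 f TB TA +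
      r14 R * (fval R gamB * fval R gamB) * circ_sum v0 f TB TB.
  move=> pt f; apply: (subst_coefficients (equation_A_holds (jw_harmonic hdim chi pt) lwA lwB)).
  - exact: (coefficient gamA gamA (r11_fval R)).
  - exact: (coefficient gamA gamB (r12E R)).
  - exact: (coefficient gamA gamB (r13E R)).
  exact: (coefficient gamB gamB (r14_fval R)).
have relB v0 t chi : path adj v0 t ->
    let f := gauged (jones_wenzl e2221 root2221 dim delta 8 chi) (map enc t) in
    fval R gamB * j_sum v0 f TB =
      r21 R * (fval R gamA * fval R gamA) * circ_sum v0 f TA TA +
      r22 R * (fval R gamA * fval R gamB) * circ_sum v0 f TA TB +
      r23 R * (fval R gamA * fval R gamB) * circ_sum v0 f TB TA +
      r24 R * (fval R gamB * fval R gamB) * circ_sum v0 f TB TB.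
  move=> pt f; apply: (subst_coefficients (equation_B_holds (jw_harmonic hdim chi pt) lwA lwB)).
  - exact: (coefficient gamA gamA (r21_lambda R)).
  - exact: (coefficient gamA gamB (r22E R)).
  - exact: (coefficient gamA gamB (r23E R)).
  exact: (coefficient gamB gamB (r24_lambda R)).
split; split.
- apply: (@relation_ext R dim delta true A' A B) => v0 t chi pt ev.
  exact: (jellyfish hdim ev oddA evenA evenB (relA _ _ _ pt)).
- apply: (@relation_ext R dim delta true B' A B) => v0 t chi pt ev.
  exact: (jellyfish hdim ev oddB evenA evenB (relB _ _ _ pt)).
- apply: (@relation_ext R dim delta false A A' B') => v0 t chi pt ev.
  exact: (jellyfish hdim ev evenA oddA oddB (relA _ _ _ pt)).
apply: (@relation_ext R dim delta false B A' B') => v0 t chi pt ev.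
exact: (jellyfish hdim ev evenB oddA oddB (relB _ _ _ pt)).
Qed.
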